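(* Let $r\in\mathbb{N}=\{1,2,\dots\}$, let $c>0$, and let $x\in\mathbb{R}$ with $-2c\le x<2c$ (or $-2c\le x\le 2c$ if $r\ge 2$). Then $$r(2r-1)\sum_{n=1}^\infty\frac{1}{n^{2r+1}}\cos\frac{n\pi x}{c}+\frac12\left(\frac{\pi x}{c}\right)^2\sum_{n=1}^\infty\frac{1}{n^{2r-1}}\cos\frac{n\pi x}{c}=\sum_{k=0}^{r-1}(-1)^k\frac{(r-k)(2r+2k-1)}{(2k)!}\left(\frac{\pi x}{c}\right)^{2k}\zeta(2r+1-2k)+(-1)^{r-1}\sum_{k=0}^\infty\frac{(2k)!\,(4r+2k-1)}{(2r+2k)!}\frac{\zeta(2k)}{(2\pi)^{2k}}\left(\frac{\pi x}{c}\right)^{2r+2k}.$$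
   Context: $\zeta$ is the Riemann zeta function (analytically continued), so in particular $\zeta(0)=-1/2$. *)

(* Defs.v *)
(* Classical reals of Stdlib, with Coquelicot for limits, series and C. *)
From Stdlib Require Import Reals Factorial.
From Coquelicot Require Import Coquelicot.

Open Scope R_scope.

Definition Cexp (z : C) : C :=
  (exp (Re z) * cos (Im z), exp (Re z) * sin (Im z)).

(* m^(-s) = exp (- s * ln m); meaningful for m >= 1 only. *)
Definition nat_cpow_opp (m : nat) (s : C) : C :=
  Cexp (- (s * RtoC (ln (INR m))))%C.

Definition analytic_at (f : C -> C) (s0 : C) : Prop :=
  exists (a : nat -> C) (rho : R), 0 < rho /\
    forall s : C, Cmod (s - s0)%C < rho ->
      @is_pseries C_AbsRing C_NormedModule a (s - s0)%C (f s).

(* [zeta] is the analytic continuation to C \ {1} of the Dirichlet series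
   sum_{n >= 1} n^(-s), Re s > 1.  As C \ {1} is connected, this determines
   [zeta] away from 1; the value at the pole 1 is left arbitrary. *)
Definition is_riemann_zeta (zeta : C -> C) : Prop :=
  (forall s : C, s <> RtoC 1 -> analytic_at zeta s) /\
  (forall s : C, 1 < Re s ->
     @is_series C_AbsRing C_NormedModule
       (fun n : nat => nat_cpow_opp (S n) s) (zeta s)).

(* zeta at a natural number m <> 1, where it is real. *)
Definition zeta_nat (zeta : C -> C) (m : nat) : R := Re (zeta (RtoC (INR m))).

(* The real series sum_{n >= 0} a n converges to l, or diverges properly to
   the infinite value l. *)
Definition is_Rbar_series (a : nat -> R) (l : Rbar) : Prop :=
  is_lim_seq (sum_n a) l.

(* Main.v *)
Require Import Defs.
From Stdlib Require Import Reals Factorial.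
From Coquelicot Require Import Coquelicot.
From Stdlib Require Import Lra Lia ClassicalEpsilon.
Open Scope R_scope.

(** Put [t = PI x / c]. On [0 < t < 2 PI], the sum of [cos (n t) / n] is
    [- ln (2 sin (t / 2))], and by Euler's product
    [- ln (sin (t / 2) / (t / 2))] is the sum of [zeta (2k) / k (t / 2 PI)^(2k)].
    So the sum of [cos (n t) / n] is [- ln t] plus an explicit power series;
    integrating [m] times from [0] expands the sum of
    [cos (n t - m PI / 2) / n^(m+1)] as a polynomial with zeta values as
    coefficients, plus [t^m / m! (H_m - ln t)], plus a power series in [t].
    In [r (2r-1) C_(2r+1) + t^2 / 2 C_(2r-1)] the logarithms cancel; what
    remains of the harmonic numbers is the term with [zeta 0 = - 1 / 2]. At
    [t = 2 PI] pass to the limit, except for [r = 1], where both sides are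
    infinite.

    For [zeta 0]: with [a n = n^(-s)] and [1 < Re s],
    [2 (1 - 2^(1-s)) zeta s = 1 + sum of (a (2n-1) - 2 a (2n) + a (2n+1))], and
    the right-hand side is analytic for [- 1 < Re s], so that the equation
    propagates along the segment from [2 + i] to [0].

    Euler's product comes from the integrals of [cos (al t) cos^n t] over
    [[0, PI / 2]], whose ratios to their values at [al = 0] tend to [1]. *)

(** The weights of the identity are dictated by one computation. Put [T n = n (2n-1)]. Multiplying
    by [t^2 / 2] turns [t^(2n-2) / (2n-2)!] into [T n * t^(2n) / (2n)!], and the two cosine series
    carry opposite signs. So the coefficient of [t^(2n) / (2n)!] gets the factor
    [T r - T n = (r-n) (2r+2n-1)], up to sign, in the polynomial ([n = k]) and in the power series
    ([n = r + k]); for the logarithm [n = r], and it vanishes.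

    Obstacle on the real side: the series of [cos (n t) / n] converges only conditionally and its
    sum is unbounded near [0] and [2 PI]. Hence the uniform estimate on compact subintervals, and
    constants of integration read off at [0] only from the integrated series, which are continuous
    there.

    Obstacle on the complex side: the alternating series reaches only [0 < Re s], not [s = 0]. Each
    further difference gains a factor [1 / m], so second differences have size [m^(- Re s - 2)] and
    converge absolutely on a disc around [0].

    The two sides meet in two facts: [zeta 0 = - 1 / 2], and [zeta m] is its Dirichlet series for
    [2 <= m]. *)

(** * Series *)

(* [ring] and [field] do not see through the carriers of Coquelicot's structures. *)
Ltac R_eq := match goal with |- ?x = ?y => change (@eq R x y) end.

Lemma Rsum_Sn (a : nat -> R) (n : nat) : sum_n a (S n) = sum_n a n + a (S n).
Proof. exact (sum_Sn a n). Qed.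

Lemma sum_n_le (a b : nat -> R) (N : nat) :
  (forall n, a n <= b n) -> sum_n a N <= sum_n b N.
Proof.
  intros H. induction N as [|N IH].
  - rewrite !sum_O. apply H.
  - rewrite !sum_Sn. unfold plus; simpl. specialize (H (S N)). lra.
Qed.

Lemma sum_n_nonneg (a : nat -> R) (N : nat) :
  (forall n, 0 <= a n) -> 0 <= sum_n a N.
Proof.
  intros H. induction N as [|N IH].
  - rewrite sum_O. apply H.
  - rewrite sum_Sn. unfold plus; simpl. specialize (H (S N)). lra.
Qed.

Lemma is_lim_seq_incr_bounded (u : nat -> R) (l : R) (N : nat) :
  (forall n, u n <= u (S n)) -> is_lim_seq u l -> u N <= l.
Proof. intros H1 H2. exact (is_lim_seq_incr_compare u l H2 H1 N). Qed.

Lemma sum_n_le_Series (a : nat -> R) (N : nat) :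
  (forall n, 0 <= a n) -> ex_series a -> sum_n a N <= Series a.
Proof.
  intros H1 H2. apply is_lim_seq_incr_bounded.
  - intros n. rewrite sum_Sn. unfold plus; simpl. specialize (H1 (S n)). lra.
  - exact (Series_correct a H2).
Qed.

Lemma series_nonneg_bounded (a : nat -> R) (M : R) :
  (forall n, 0 <= a n) -> (forall N, sum_n a N <= M) ->
  ex_series a /\ Series a <= M.
Proof.
  intros H1 H2.
  destruct (ex_finite_lim_seq_incr (sum_n a) M) as [l Hl].
  - intros n. rewrite sum_Sn. unfold plus; simpl. specialize (H1 (S n)). lra.
  - exact H2.
  - assert (Hs : is_series a l) by exact Hl.
    split. { now exists l. }
    rewrite (is_series_unique _ _ Hs).
    exact (is_lim_seq_le (sum_n a) (fun _ => M) l M H2 Hl (is_lim_seq_const M)).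
Qed.

Lemma is_series_Rmult_l (c : R) (a : nat -> R) (l : R) :
  is_series a l -> is_series (fun n => c * a n) (c * l).
Proof. exact (is_series_scal_l (K:=R_AbsRing) c a l). Qed.

Lemma is_series_Rplus (a b : nat -> R) (l m : R) :
  is_series a l -> is_series b m -> is_series (fun n => a n + b n) (l + m).
Proof. exact (is_series_plus (V:=R_NormedModule) a b l m). Qed.

Lemma Series_nonneg (a : nat -> R) :
  (forall n, 0 <= a n) -> ex_series a -> 0 <= Series a.
Proof.
  intros H1 H2. apply Rle_trans with (sum_n a 0).
  - rewrite sum_O. apply H1.
  - now apply sum_n_le_Series.
Qed.

Lemma ex_series_dominated (a b : nat -> R) :
  (forall n, Rabs (a n) <= b n) -> ex_series b -> ex_series a.
Proof. intros H1 H2. exact (ex_series_le a b H1 H2). Qed.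

Lemma Series_Rabs_le (a b : nat -> R) :
  (forall n, Rabs (a n) <= b n) -> ex_series b -> Rabs (Series a) <= Series b.
Proof.
  intros H1 H2. apply Rle_trans with (Series (fun n => Rabs (a n))).
  - apply Series_Rabs. apply ex_series_dominated with b; auto.
    intros n. now rewrite Rabs_Rabsolu.
  - apply Series_le; auto. intros n. split; auto using Rabs_pos.
Qed.

Lemma is_lim_seq_sum_n (d : nat -> nat -> R) (l : nat -> R) (N : nat) :
  (forall n, is_lim_seq (d n) (l n)) ->
  is_lim_seq (fun j => sum_n (fun n => d n j) N) (sum_n l N).
Proof.
  intros H. induction N as [|N IH].
  - rewrite sum_O. apply is_lim_seq_ext with (d O); auto.
    intros j. now rewrite sum_O.
  - rewrite sum_Sn.
    apply is_lim_seq_ext with (fun j => sum_n (fun n => d n j) N + d (S N) j).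
    + intros j. now rewrite sum_Sn.
    + apply (is_lim_seq_plus' _ _ _ _ IH (H (S N))).
Qed.

(** The tail beyond [N] is at most the tail of [M], uniformly in [j]; the finitely many remaining
    terms tend to 0 with [j]. *)
Lemma tannery_zero (d : nat -> nat -> R) (M : nat -> R) :
  (forall n j, 0 <= d n j <= M n) -> ex_series M ->
  (forall n, is_lim_seq (d n) 0) ->
  is_lim_seq (fun j => Series (fun n => d n j)) 0.
Proof.
  intros Hd HM H0. apply is_lim_seq_spec. intros eps.
  assert (He : 0 < eps / 2) by (destruct eps; simpl; lra).
  pose proof (Series_correct M HM) as HS.
  assert (HS' : is_lim_seq (sum_n M) (Series M)) by exact HS.
  apply is_lim_seq_spec in HS'. destruct (HS' (mkposreal _ He)) as [N HN].
  specialize (HN N (le_n N)). simpl in HN.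
  pose proof (is_lim_seq_sum_n d (fun _ => 0) N H0) as HL.
  assert (HZ : sum_n (fun _ => 0) N = 0).
  { clear. induction N. now rewrite sum_O. rewrite sum_Sn, IHN.
    unfold plus; simpl; ring. }
  rewrite HZ in HL. apply is_lim_seq_spec in HL.
  destruct (HL (mkposreal _ He)) as [J HJ].
  exists J. intros j Hj. specialize (HJ j Hj). simpl in HJ.
  assert (Hex : ex_series (fun n => d n j)).
  { apply ex_series_dominated with M; auto. intros n.
    rewrite Rabs_pos_eq; apply Hd. }
  rewrite Rminus_0_r in *.
  rewrite (Series_incr_n (fun n => d n j) (S N)); [| lia | exact Hex].
  rewrite (Series_incr_n M (S N)) in HN; [| lia | exact HM].
  simpl pred in *. rewrite <- sum_n_Reals in *.
  assert (Ht : 0 <= Series (fun k => d (S N + k)%nat j)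
                 <= Series (fun k => M (S N + k)%nat)).
  { split.
    - apply Series_nonneg. intros; apply Hd.
      apply (ex_series_incr_n (fun n => d n j)) ; auto.
    - apply Series_le. intros; apply Hd. apply (ex_series_incr_n M); auto. }
  assert (Hp : 0 <= sum_n (fun n => d n j) N)
    by (apply sum_n_nonneg; intros; apply Hd).
  rewrite Rabs_pos_eq in HJ by auto.
  apply Rabs_def2 in HN. rewrite Rabs_pos_eq; lra.
Qed.

(** Dominated convergence for series: [tannery_zero] applies to [Rabs (a n j - b n)], which is at
    most [2 * M n]. *)
Lemma tannery (a : nat -> nat -> R) (b M : nat -> R) :
  (forall n j, Rabs (a n j) <= M n) -> ex_series M ->
  (forall n, is_lim_seq (a n) (b n)) ->
  ex_series b /\
  is_lim_seq (fun j => Series (fun n => a n j)) (Series b).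
Proof.
  intros Ha HM Hl.
  assert (Hb : forall n, Rabs (b n) <= M n).
  { intros n.
    exact (is_lim_seq_le (fun j => Rabs (a n j)) (fun _ => M n) (Rabs (b n)) (M n)
             (Ha n) (is_lim_seq_abs _ (b n) (Hl n)) (is_lim_seq_const (M n))). }
  assert (Hexb : ex_series b) by (now apply ex_series_dominated with M).
  assert (Hexa : forall j, ex_series (fun n => a n j))
    by (intros j; now apply ex_series_dominated with M).
  split; auto.
  assert (HM2 : ex_series (fun n => 2 * M n)) by now apply (ex_series_scal_l 2 M).
  assert (Hd : forall n j, 0 <= Rabs (a n j - b n) <= 2 * M n).
  { intros n j. split. apply Rabs_pos.
    specialize (Ha n j). specialize (Hb n).
    apply Rabs_le. apply Rabs_le_between in Ha. apply Rabs_le_between in Hb. lra. }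
  pose proof (tannery_zero (fun n j => Rabs (a n j - b n)) (fun n => 2 * M n)
                Hd HM2) as HT.
  assert (H0 : is_lim_seq (fun j => Series (fun n => Rabs (a n j - b n))) 0).
  { apply HT. intros n. apply (proj1 (is_lim_seq_abs_0 (fun j => a n j - b n))).
    replace (Finite 0) with (Finite (b n - b n)) by (f_equal; ring).
    apply is_lim_seq_minus'; auto. apply is_lim_seq_const. }
  apply is_lim_seq_spec. intros eps. apply is_lim_seq_spec in H0.
  destruct (H0 eps) as [J HJ]. exists J. intros j Hj. specialize (HJ j Hj).
  rewrite Rminus_0_r in HJ. rewrite <- Series_minus; auto.
  eapply Rle_lt_trans; [| exact HJ].
  eapply Rle_trans; [| apply Rle_abs].
  apply Series_Rabs_le. intros; apply Rle_refl.
  apply ex_series_dominated with (fun n => 2 * M n); auto.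
  intros n. rewrite Rabs_Rabsolu. apply Hd.
Qed.

(** * Series of complex numbers *)

Definition is_Cseries (a : nat -> C) (l : C) : Prop :=
  @is_series C_AbsRing C_NormedModule a l.

Lemma Csum_Sn (a : nat -> C) (n : nat) :
  sum_n a (S n) = (sum_n a n + a (S n))%C.
Proof. exact (sum_Sn a n). Qed.

Lemma is_Cseries_Cmod (a : nat -> C) (l : C) :
  is_Cseries a l <-> is_lim_seq (fun N => Cmod (sum_n a N - l)%C) 0.
Proof.
  unfold is_Cseries, is_series. split.
  - intros H. apply is_lim_seq_spec. intros eps.
    pose proof (proj1 (filterlim_locally_ball_norm (K:=C_AbsRing) (U:=C_NormedModule)
      (sum_n a : nat -> C_NormedModule) l) H eps) as [N HN].
    exists N. intros n Hn. specialize (HN n Hn).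
    rewrite Rminus_0_r, Rabs_pos_eq by apply Cmod_ge_0. exact HN.
  - intros H. apply is_lim_seq_spec in H.
    apply (proj2 (filterlim_locally_ball_norm (K:=C_AbsRing) (U:=C_NormedModule)
      (sum_n a : nat -> C_NormedModule) l)).
    intros eps. destruct (H eps) as [N HN]. exists N. intros n Hn.
    specialize (HN n Hn).
    rewrite Rminus_0_r, Rabs_pos_eq in HN by apply Cmod_ge_0. exact HN.
Qed.

Lemma is_Cseries_unique (a : nat -> C) (l1 l2 : C) :
  is_Cseries a l1 -> is_Cseries a l2 -> l1 = l2.
Proof.
  intros H1 H2.
  exact (filterlim_locally_unique (F:=Hierarchy.eventually) (K:=C_AbsRing) (V:=C_NormedModule) _ l1 l2 H1 H2).
Qed.

Lemma Csum_Cmod_le (a : nat -> C) (N : nat) :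
  Cmod (sum_n a N) <= sum_n (fun n => Cmod (a n)) N.
Proof.
  induction N as [|N IH].
  - rewrite !sum_O. apply Rle_refl.
  - rewrite Csum_Sn, sum_Sn. unfold plus; simpl.
    eapply Rle_trans; [apply Cmod_triangle |]. lra.
Qed.

Lemma is_Cseries_Cmod_le (a : nat -> C) (l : C) (M : R) :
  is_Cseries a l -> (forall N, Cmod (sum_n a N) <= M) -> Cmod l <= M.
Proof.
  intros H HM. apply is_Cseries_Cmod in H.
  assert (H2 : is_lim_seq (fun N => M + Cmod (sum_n a N - l)%C) (M + 0)).
  { apply is_lim_seq_plus'; auto. apply is_lim_seq_const. }
  rewrite Rplus_0_r in H2.
  refine (is_lim_seq_le (fun _ => Cmod l) _ (Cmod l) M _ (is_lim_seq_const _) H2).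
  intros n. specialize (HM n).
  replace l with (sum_n a n - (sum_n a n - l))%C at 1 by ring.
  eapply Rle_trans; [apply Cmod_triangle |]. rewrite Cmod_opp. lra.
Qed.

Lemma ex_Cseries (a : nat -> C) (b : nat -> R) :
  (forall n, Cmod (a n) <= b n) -> ex_series b ->
  exists l, is_Cseries a l /\ Cmod l <= Series b.
Proof.
  intros H1 H2.
  assert (Hb : forall n, 0 <= b n)
    by (intros n; eapply Rle_trans; [apply Cmod_ge_0 | apply H1]).
  destruct (@ex_series_le C_AbsRing C_CompleteNormedModule a b H1 H2) as [l Hl].
  exists l. split; [exact Hl |].
  apply is_Cseries_Cmod_le with a; [exact Hl |]. intros N.
  eapply Rle_trans; [apply Csum_Cmod_le |].
  eapply Rle_trans; [apply sum_n_le, H1 |]. now apply sum_n_le_Series.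
Qed.

Lemma is_Cseries_plus (a b : nat -> C) (l m : C) :
  is_Cseries a l -> is_Cseries b m ->
  is_Cseries (fun n => a n + b n)%C (l + m)%C.
Proof. exact (is_series_plus (V:=C_NormedModule) a b l m). Qed.

Lemma is_Cseries_scal (c : C) (a : nat -> C) (l : C) :
  is_Cseries a l -> is_Cseries (fun n => c * a n)%C (c * l)%C.
Proof. exact (is_series_scal (V:=C_NormedModule) c a l). Qed.

Lemma is_Cseries_ext (a b : nat -> C) (l : C) :
  (forall n, a n = b n) -> is_Cseries a l -> is_Cseries b l.
Proof. exact (is_series_ext (V:=C_NormedModule) a b l). Qed.

Lemma is_Cseries_0 : is_Cseries (fun _ => RtoC 0) 0.
Proof.
  apply is_Cseries_Cmod. apply is_lim_seq_ext with (fun _ => 0).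
  - intros N. symmetry.
    replace (sum_n (fun _ : nat => RtoC 0) N) with (RtoC 0).
    + replace (0 - 0)%C with (RtoC 0) by ring. apply Cmod_0.
    + induction N as [|N IH]. now rewrite sum_O.
      rewrite Csum_Sn, <- IH. ring.
  - apply is_lim_seq_const.
Qed.

Lemma is_Cseries_sum (f : nat -> nat -> C) (l : nat -> C) (J : nat) :
  (forall j, is_Cseries (fun n => f n j) (l j)) ->
  is_Cseries (fun n => sum_n (f n) J) (sum_n l J).
Proof.
  intros H. induction J as [|J IH].
  - rewrite sum_O. apply is_Cseries_ext with (fun n => f n O); auto.
    intros n. now rewrite sum_O.
  - rewrite Csum_Sn.
    apply is_Cseries_ext with (fun n => sum_n (f n) J + f n (S J))%C.
    + intros n. now rewrite Csum_Sn.
    + now apply is_Cseries_plus.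
Qed.

Lemma is_Cseries_incr_1 (a : nat -> C) (l : C) :
  is_Cseries a (l + a O)%C -> is_Cseries (fun n => a (S n)) l.
Proof. exact (is_series_incr_1 (V:=C_NormedModule) a l). Qed.

Lemma is_Cseries_decr_1 (a : nat -> C) (l : C) :
  is_Cseries (fun n => a (S n)) (l - a O)%C -> is_Cseries a l.
Proof. exact (is_series_decr_1 (V:=C_NormedModule) a l). Qed.

(** * Complex power series with absolutely bounded coefficients *)

(** Expansions are given by existentials; summing a sequence of functions needs all their
    coefficient sequences at once. *)
Lemma choice_function (A B : Type) (P : A -> B -> Prop) :
  (forall x, exists y, P x y) -> exists f : A -> B, forall x, P x (f x).
Proof.
  intros H.
  exists (fun x => proj1_sig (constructive_indefinite_description _ (H x))).
  intros x. exact (proj2_sig (constructive_indefinite_description _ (H x))).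
Qed.

Lemma sum_n_shift_le (b : nat -> R) (m N : nat) :
  (forall j, 0 <= b j) -> sum_n (fun j => b (m + j)%nat) N <= sum_n b (m + N)%nat.
Proof.
  intros Hb. induction N as [|N IH].
  - rewrite sum_O, PeanoNat.Nat.add_0_r. destruct m as [|m].
    + rewrite sum_O. apply Rle_refl.
    + rewrite sum_Sn. unfold plus; simpl.
      pose proof (sum_n_nonneg b m Hb). lra.
  - rewrite <- plus_n_Sm, !sum_Sn, <- plus_n_Sm. unfold plus; simpl. lra.
Qed.

(** [M] bounds the norm of [f] in the Banach algebra of power series converging absolutely on the
    closed disc of radius [rho]. Carrying this bound along makes sums, products and dominated series
    of such functions available without Cauchy's integral formula. *)
Definition expandable (s0 : C) (rho M : R) (f : C -> C) : Prop :=
  exists a : nat -> C,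
    (forall N, sum_n (fun j => Cmod (a j) * rho ^ j) N <= M) /\
    forall s : C, Cmod (s - s0)%C <= rho ->
      is_Cseries (fun j => a j * (s - s0) ^ j)%C (f s).

Lemma expandable_ext (s0 : C) (rho M : R) (f g : C -> C) :
  (forall s, Cmod (s - s0)%C <= rho -> f s = g s) ->
  expandable s0 rho M f -> expandable s0 rho M g.
Proof.
  intros H [a [H1 H2]]. exists a. split; auto.
  intros s Hs. rewrite <- H; auto.
Qed.

Lemma expandable_weaken (s0 : C) (rho M M' : R) (f : C -> C) :
  M <= M' -> expandable s0 rho M f -> expandable s0 rho M' f.
Proof.
  intros H [a [H1 H2]]. exists a. split; auto.
  intros N. now apply Rle_trans with M.
Qed.

Lemma expandable_radius (s0 : C) (rho rho' M : R) (f : C -> C) :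
  0 <= rho' <= rho -> expandable s0 rho M f -> expandable s0 rho' M f.
Proof.
  intros H [a [H1 H2]]. exists a. split.
  - intros N. apply Rle_trans with (2 := H1 N). apply sum_n_le. intros n.
    apply Rmult_le_compat_l. apply Cmod_ge_0. now apply pow_incr.
  - intros s Hs. apply H2. lra.
Qed.

Lemma expandable_Cmod_le (s0 : C) (rho M : R) (f : C -> C) (s : C) :
  expandable s0 rho M f -> Cmod (s - s0)%C <= rho -> Cmod (f s) <= M.
Proof.
  intros [a [H1 H2]] Hs. apply is_Cseries_Cmod_le with (1 := H2 s Hs).
  intros N. eapply Rle_trans; [apply Csum_Cmod_le |].
  apply Rle_trans with (2 := H1 N). apply sum_n_le. intros n.
  rewrite Cmod_mult, Cmod_pow. apply Rmult_le_compat_l. apply Cmod_ge_0.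
  apply pow_incr. split; auto. apply Cmod_ge_0.
Qed.

Lemma expandable_const (s0 : C) (rho : R) (c : C) :
  expandable s0 rho (Cmod c) (fun _ => c).
Proof.
  exists (fun j => match j with O => c | _ => RtoC 0 end). split.
  - intros N. replace (sum_n _ N) with (Cmod c). apply Rle_refl.
    induction N as [|N IH].
    + rewrite sum_O. simpl. ring.
    + rewrite sum_Sn, <- IH. unfold plus; simpl. rewrite Cmod_0. ring.
  - intros s _. apply is_Cseries_decr_1. simpl.
    replace (c - c * 1)%C with (RtoC 0) by ring.
    apply is_Cseries_ext with (2 := is_Cseries_0). intros n.  ring.
Qed.

Lemma expandable_plus (s0 : C) (rho M1 M2 : R) (f g : C -> C) :
  0 <= rho -> expandable s0 rho M1 f -> expandable s0 rho M2 g ->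
  expandable s0 rho (M1 + M2) (fun s => f s + g s)%C.
Proof.
  intros Hr [a [A1 A2]] [b [B1 B2]].
  exists (fun j => a j + b j)%C. split.
  - intros N. apply Rle_trans with (2 := Rplus_le_compat _ _ _ _ (A1 N) (B1 N)).
    eapply Rle_trans; [| apply Req_le; exact (sum_n_plus _ _ N)].
    apply sum_n_le. intros n. unfold plus; simpl.
    rewrite <- Rmult_plus_distr_r. apply Rmult_le_compat_r. now apply pow_le.
    apply Cmod_triangle.
  - intros s Hs.
    apply is_Cseries_ext with (2 := is_Cseries_plus _ _ _ _ (A2 s Hs) (B2 s Hs)).
    intros n. ring.
Qed.

Lemma expandable_scal (s0 : C) (rho M : R) (f : C -> C) (c : C) :
  expandable s0 rho M f ->
  expandable s0 rho (Cmod c * M) (fun s => c * f s)%C.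
Proof.
  intros [a [A1 A2]].
  exists (fun j => c * a j)%C. split.
  - intros N. apply Rle_trans with (2 := Rmult_le_compat_l _ _ _ (Cmod_ge_0 c) (A1 N)).
    apply Req_le. rewrite <- (sum_n_mult_l (K:=R_AbsRing)).
    apply sum_n_ext. intros n. rewrite Cmod_mult. unfold mult; simpl. ring.
  - intros s Hs.
    apply is_Cseries_ext with (2 := is_Cseries_scal c _ _ (A2 s Hs)).
    intros n. ring.
Qed.

Lemma expandable_shift (s0 : C) (rho M : R) (f : C -> C) :
  0 <= rho -> expandable s0 rho M f ->
  expandable s0 rho (rho * M) (fun s => (s - s0) * f s)%C.
Proof.
  intros Hr [a [A1 A2]].
  exists (fun j => match j with O => RtoC 0 | S j => a j end). split.
  - intros N.
    assert (H : forall N, sum_n (fun j : nat =>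
      Cmod match j with O => RtoC 0 | S j => a j end * rho ^ j) (S N)
      = rho * sum_n (fun j => Cmod (a j) * rho ^ j) N).
    { clear N. intros N. induction N as [|N IH].
      - rewrite sum_Sn, !sum_O. unfold plus; simpl. rewrite Cmod_0. ring.
      - rewrite sum_Sn, IH, (sum_Sn _ N). unfold plus; simpl. ring. }
    destruct N as [|N].
    + rewrite sum_O, Cmod_0. rewrite Rmult_0_l.
      apply Rmult_le_pos; auto. eapply Rle_trans; [|apply (A1 O)].
      rewrite sum_O. simpl. rewrite Rmult_1_r. apply Cmod_ge_0.
    + rewrite H. apply Rmult_le_compat_l; auto.
  - intros s Hs. apply is_Cseries_decr_1.
    replace ((s - s0) * f s - 0 * (s - s0) ^ 0)%C with ((s - s0) * f s)%C by ring.
    apply is_Cseries_ext with (2 := is_Cseries_scal (s - s0)%C _ _ (A2 s Hs)).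
    intros n. simpl. ring.
Qed.

(** Weierstrass's double series theorem. The coefficients [b j] are the column sums of [a n j],
    which converge because [Cmod (a n j) * rho ^ j <= M n]; the order of summation is exchanged by
    [tannery_zero]. *)
Lemma expandable_series (s0 : C) (rho : R) (M : nat -> R) (f : nat -> C -> C)
    (F : C -> C) :
  0 < rho -> (forall n, expandable s0 rho (M n) (f n)) -> ex_series M ->
  (forall s, Cmod (s - s0)%C <= rho -> is_Cseries (fun n => f n s) (F s)) ->
  expandable s0 rho (Series M) F.
Proof.
  intros Hr Hf HM HF.
  destruct (choice_function _ _ (fun n (a : nat -> C) =>
    (forall N, sum_n (fun j => Cmod (a j) * rho ^ j) N <= M n) /\
    forall s : C, Cmod (s - s0)%C <= rho ->
      is_Cseries (fun j => a j * (s - s0) ^ j)%C (f n s))) as [a Ha].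
  { exact Hf. }
  assert (Hpos : forall n j, 0 <= Cmod (a n j) * rho ^ j).
  { intros. apply Rmult_le_pos. apply Cmod_ge_0. apply pow_le. lra. }
  assert (Hle : forall n j, Cmod (a n j) * rho ^ j <= M n).
  { intros n j. apply Rle_trans with (2 := proj1 (Ha n) j). destruct j.
    - rewrite sum_O. apply Rle_refl.
    - rewrite sum_Sn. unfold plus; simpl.
      assert (H := sum_n_nonneg (fun j => Cmod (a n j) * rho ^ j) j (Hpos n)). simpl in H. lra. }
  assert (Hex : forall j, ex_series (fun n => Cmod (a n j) * rho ^ j)).
  { intros j. apply ex_series_dominated with M; auto. intros n.
    rewrite Rabs_pos_eq; auto. }
  assert (Hex' : forall j, ex_series (fun n => Cmod (a n j))).
  { intros j. apply ex_series_ext with (fun n => / rho ^ j * (Cmod (a n j) * rho ^ j)).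
    - intros n. R_eq. field. apply pow_nonzero. lra.
    - apply (ex_series_scal_l (/ rho ^ j) (fun n => Cmod (a n j) * rho ^ j)), Hex. }
  destruct (choice_function _ _ (fun j (b : C) =>
    is_Cseries (fun n => a n j) b /\ Cmod b <= Series (fun n => Cmod (a n j)))) as [b Hb].
  { intros j. apply ex_Cseries; auto. intros; apply Rle_refl. }
  exists b. split.
  - intros J.
    apply Rle_trans with (sum_n (fun j => Series (fun n => Cmod (a n j) * rho ^ j)) J).
    { apply sum_n_le. intros j. rewrite Series_scal_r.
      apply Rmult_le_compat_r. apply pow_le; lra. apply Hb. }
    assert (Hs : is_series (fun n => sum_n (fun j => Cmod (a n j) * rho ^ j) J)
       (sum_n (fun j => Series (fun n => Cmod (a n j) * rho ^ j)) J)).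
    { induction J as [|J IH].
      - rewrite sum_O. apply is_series_ext with (fun n => Cmod (a n O) * rho ^ 0).
        + intros n. now rewrite sum_O.
        + apply Series_correct, Hex.
      - rewrite sum_Sn. eapply is_series_ext;
          [| apply (is_series_plus _ _ _ _ IH (Series_correct _ (Hex (S J))))].
        intros n. now rewrite sum_Sn. }
    rewrite <- (is_series_unique _ _ Hs). apply Series_le; auto.
    intros n. split. apply sum_n_nonneg, Hpos. apply Ha.
  - intros s Hs. apply is_Cseries_Cmod.
    (* [t n J] is the error of the [J]-th Taylor sum of [f n] at [s]: at most [2 * M n], and tending
       to 0 in [J] for each [n]. *)
    set (t := fun n J => Cmod (sum_n (fun j => a n j * (s - s0) ^ j)%C J - f n s)%C).
    assert (Hsum : forall n J, Cmod (sum_n (fun j => a n j * (s - s0) ^ j)%C J) <= M n).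
    { intros n J. eapply Rle_trans; [apply Csum_Cmod_le |].
      apply Rle_trans with (2 := proj1 (Ha n) J). apply sum_n_le. intros j.
      rewrite Cmod_mult, Cmod_pow. apply Rmult_le_compat_l. apply Cmod_ge_0.
      apply pow_incr. split; auto. apply Cmod_ge_0. }
    assert (Ht : forall n J, 0 <= t n J <= 2 * M n).
    { intros n J. unfold t. split. apply Cmod_ge_0.
      unfold Cminus at 1. eapply Rle_trans; [apply Cmod_triangle |].
      rewrite Cmod_opp. specialize (Hsum n J).
      pose proof (expandable_Cmod_le _ _ _ _ _ (Hf n) Hs). lra. }
    assert (HM2 : ex_series (fun n => 2 * M n)) by now apply (ex_series_scal_l 2 M).
    assert (HT : is_lim_seq (fun J => Series (fun n => t n J)) 0).
    { apply tannery_zero with (fun n => 2 * M n); auto. intros n.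
      apply is_Cseries_Cmod. now apply Ha. }
    apply is_lim_seq_le_le with (fun _ => 0) (fun J => Series (fun n => t n J)); auto.
    2: apply is_lim_seq_const.
    intros J. split. apply Cmod_ge_0.
    assert (H1 : is_Cseries (fun n => sum_n (fun j => a n j * (s - s0) ^ j)%C J)
       (sum_n (fun j => b j * (s - s0) ^ j)%C J)).
    { apply (is_Cseries_sum (fun n j => a n j * (s - s0) ^ j)%C). intros j.
      rewrite Cmult_comm.
      apply is_Cseries_ext with (2 := is_Cseries_scal ((s - s0) ^ j)%C _ _ (proj1 (Hb j))).
      intros n. ring. }
    pose proof (is_Cseries_plus _ _ _ _ H1 (is_Cseries_scal (-1)%C _ _ (HF s Hs))) as H2.
    destruct (ex_Cseries (fun n => sum_n (fun j => a n j * (s - s0) ^ j)%C J + (-1) * f n s)%C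
       (fun n => t n J)) as [l [Hl1 Hl2]].
    { intros n. unfold t. apply Req_le. f_equal. ring. }
    { apply ex_series_dominated with (fun n => 2 * M n); auto. intros n.
      rewrite Rabs_pos_eq; apply Ht. }
    replace (sum_n (fun j => b j * (s - s0) ^ j)%C J - F s)%C with l; auto.
    rewrite (is_Cseries_unique _ _ _ Hl1 H2). ring.
Qed.

(** In place of a Cauchy product, [f * g] is the series over [j] of [a j * (s - s0) ^ j * g s]; each
    term is a scaled, [j] times shifted copy of [g], so [expandable_series] applies. *)
Lemma expandable_mult (s0 : C) (rho M1 M2 : R) (f g : C -> C) :
  0 < rho -> expandable s0 rho M1 f -> expandable s0 rho M2 g ->
  expandable s0 rho (M1 * M2) (fun s => f s * g s)%C.
Proof.
  intros Hr [a [A1 A2]] Hg.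
  assert (HM2 : 0 <= M2).
  { eapply Rle_trans; [apply Cmod_ge_0 |].
    apply (expandable_Cmod_le _ _ _ _ s0 Hg).
    replace (s0 - s0)%C with (RtoC 0) by ring. rewrite Cmod_0. lra. }
  destruct (series_nonneg_bounded (fun j => Cmod (a j) * rho ^ j) M1) as [E1 E2]; auto.
  { intros. apply Rmult_le_pos. apply Cmod_ge_0. apply pow_le. lra. }
  apply expandable_weaken with (Series (fun j => Cmod (a j) * rho ^ j * M2)).
  { rewrite Series_scal_r. now apply Rmult_le_compat_r. }
  apply expandable_series with (fun j s => (a j * (s - s0) ^ j) * g s)%C; auto.
  - intros j.
    apply expandable_ext with (fun s => a j * ((s - s0) ^ j * g s))%C.
    { intros. ring. }
    rewrite Rmult_assoc. apply expandable_scal.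
    induction j as [|j IH].
    + simpl. rewrite Rmult_1_l. apply expandable_ext with (2 := Hg).
      intros. ring.
    + simpl. rewrite Rmult_assoc.
      apply expandable_ext with (fun s => (s - s0) * ((s - s0) ^ j * g s))%C.
      intros; ring. apply expandable_shift; auto. lra.
  - now apply (ex_series_scal_r M2 (fun j => Cmod (a j) * rho ^ j)).
  - intros s Hs. rewrite Cmult_comm.
    apply is_Cseries_ext with (2 := is_Cseries_scal (g s) _ _ (A2 s Hs)).
    intros n. ring.
Qed.

Lemma pow_n_Cpow (z : C) (n : nat) : @pow_n C_Ring z n = (z ^ n)%C.
Proof.
  induction n as [|n IH]. reflexivity.
  simpl pow_n. rewrite IH. reflexivity.
Qed.

Lemma is_Cseries_terms_bounded (a : nat -> C) (l : C) :
  is_Cseries a l -> exists B, forall n, Cmod (a n) <= B.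
Proof.
  intros H. apply is_Cseries_Cmod in H.
  destruct (proj2 (is_lim_seq_spec _ _) H (mkposreal 1 Rlt_0_1)) as [N HN].
  assert (Hfin : forall K : nat, exists B, forall n, (n <= K)%nat -> Cmod (a n) <= B).
  { induction K as [|K [B HB]].
    - exists (Cmod (a O)). intros n Hn. replace n with O by lia. lra.
    - exists (Rmax B (Cmod (a (S K)))). intros n Hn.
      destruct (PeanoNat.Nat.eq_dec n (S K)) as [->|].
      + apply Rmax_r.
      + eapply Rle_trans; [apply HB; lia | apply Rmax_l]. }
  destruct (Hfin (S N)) as [B HB]. exists (Rmax B 2). intros n.
  destruct (Compare_dec.le_lt_dec n (S N)) as [Hn|Hn].
  - eapply Rle_trans; [apply HB; lia | apply Rmax_l].
  - eapply Rle_trans; [| apply Rmax_r].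
    destruct n as [|n]; [lia |].
    replace (a (S n)) with ((sum_n a (S n) - l) - (sum_n a n - l))%C
      by (rewrite Csum_Sn; ring).
    unfold Cminus at 1. eapply Rle_trans; [apply Cmod_triangle |]. rewrite Cmod_opp.
    pose proof (HN (S n) ltac:(lia)) as H1. pose proof (HN n ltac:(lia)) as H2.
    simpl in H1, H2. rewrite Rminus_0_r, Rabs_pos_eq in H1, H2 by apply Cmod_ge_0.
    lra.
Qed.

(** Convergence at the single point [s0 + r / 2] bounds [Cmod (a j) * (r / 2) ^ j] by some [B]. At
    radius [r / 4] the series is then dominated by [B / 2 ^ j], of sum [2 * B]. *)
Lemma analytic_expandable (f : C -> C) (s0 : C) :
  analytic_at f s0 -> exists rho M, 0 < rho /\ expandable s0 rho M f.
Proof.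
  intros [a [r [Hr H]]].
  assert (H' : forall s, Cmod (s - s0)%C < r ->
     is_Cseries (fun j => a j * (s - s0) ^ j)%C (f s)).
  { intros s Hs. specialize (H s Hs). unfold is_pseries in H.
    apply is_Cseries_ext with (2 := H). intros n.
    rewrite pow_n_Cpow. apply Cmult_comm. }
  destruct (is_Cseries_terms_bounded _ _ (H' (s0 + RtoC (r / 2))%C
     ltac:(replace (s0 + RtoC (r / 2) - s0)%C with (RtoC (r / 2)) by ring;
           rewrite Cmod_R, Rabs_pos_eq; lra))) as [B HB].
  exists (r / 4), (B * 2). split; [lra |].
  exists a. split.
  - intros N.
    assert (HBB : forall j, Cmod (a j) * (r / 4) ^ j <= B * (/ 2) ^ j).
    { intros j. specialize (HB j).
      replace (s0 + RtoC (r / 2) - s0)%C with (RtoC (r / 2)) in HB by ring.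
      rewrite Cmod_mult, Cmod_pow, Cmod_R, Rabs_pos_eq in HB by lra.
      replace (r / 4) with (r / 2 * / 2) by field.
      rewrite Rpow_mult_distr, <- Rmult_assoc. apply Rmult_le_compat_r; auto.
      apply pow_le. lra. }
    eapply Rle_trans; [apply sum_n_le, HBB |].
    assert (HB0 : 0 <= B) by (eapply Rle_trans; [apply Cmod_ge_0 | apply (HB O)]).
    eapply Rle_trans; [apply sum_n_le_Series |].
    + intros n. apply Rmult_le_pos; auto. apply pow_le. lra.
    + apply (ex_series_scal_l B (fun n => (/ 2) ^ n)). apply ex_series_geom.
      rewrite Rabs_pos_eq; lra.
    + rewrite Series_scal_l, Series_geom by (rewrite Rabs_pos_eq; lra).
      apply Req_le. field.
  - intros s Hs. apply H'. lra.
Qed.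

(** Identity theorem on one disc. If the coefficients below [n] vanish, a zero at [s0 + z] with
    [z <> 0] expresses [a n * z ^ n] by the later terms, whence
    [Cmod (a n) <= Cmod z * M / rho ^ (n+1)]. Zeros with [z] arbitrarily small force [a n = 0]. *)
Lemma expandable_zeros (s0 : C) (rho M : R) (f : C -> C) :
  0 < rho -> expandable s0 rho M f ->
  (forall eps, 0 < eps -> exists s, s <> s0 /\ Cmod (s - s0)%C < eps /\ f s = 0) ->
  forall s, Cmod (s - s0)%C <= rho -> f s = 0.
Proof.
  intros Hr [a [A1 A2]] Hz.
  assert (Ha : forall n j, (j < n)%nat -> a j = 0).
  { induction n as [|n IH]; intros j Hj. lia.
    destruct (PeanoNat.Nat.eq_dec j n) as [->|]; [| apply IH; lia]. clear Hj.
    apply Cmod_eq_0. apply Rle_antisym; [| apply Cmod_ge_0].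
    assert (HM : 0 <= M).
    { eapply Rle_trans; [| apply (A1 O)]. rewrite sum_O. simpl.
      rewrite Rmult_1_r. apply Cmod_ge_0. }
    (* Dividing [f] by [(s - s0)^n] leaves a function bounded near [s0]. *)
    assert (Hbd : forall s, s <> s0 -> Cmod (s - s0)%C <= rho -> f s = 0 ->
       Cmod (a n) <= Cmod (s - s0)%C * (M / rho ^ S n)).
    { intros s Hs1 Hs2 Hs3. pose proof (A2 s Hs2) as HA. rewrite Hs3 in HA.
      assert (Hz0 : (s - s0)%C <> 0).
      { intros Hc. apply Hs1. replace s with (s - s0 + s0)%C by ring. rewrite Hc. ring. }
      assert (Hzn := proj1 (Cmod_gt_0 _) Hz0).
      set (z := (s - s0)%C) in *.
      assert (HAn : is_Cseries (fun j => a (n + j)%nat * z ^ (n + j))%C 0).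
      { assert (Hk : forall k, (k <= n)%nat -> is_Cseries (fun j => a (k + j)%nat * z ^ (k + j))%C 0).
        { induction k as [|k IHk]; intros Hk. exact HA.
          apply (is_Cseries_ext (fun j => a (k + S j)%nat * z ^ (k + S j))%C).
          { intros j. now rewrite <- !plus_n_Sm. }
          apply (is_Cseries_incr_1 (fun j => a (k + j)%nat * z ^ (k + j))%C).
          rewrite (IH (k + 0)%nat) by lia.
          replace (0 + 0 * z ^ (k + 0))%C with (RtoC 0) by ring. apply IHk. lia. }
        now apply Hk. }
      assert (HAn' : is_Cseries (fun j => a (S n + j)%nat * z ^ (S n + j))%C (- (a n * z ^ n))%C).
      { apply (is_Cseries_ext (fun j => a (n + S j)%nat * z ^ (n + S j))%C).
        { intros j. now rewrite <- !plus_n_Sm. }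
        apply (is_Cseries_incr_1 (fun j => a (n + j)%nat * z ^ (n + j))%C).
        rewrite PeanoNat.Nat.add_0_r. replace (- (a n * z ^ n) + a n * z ^ n)%C with (RtoC 0) by ring.
        exact HAn. }
      assert (HC : Cmod (a n * z ^ n)%C <= Cmod z ^ S n * (M / rho ^ S n)).
      { rewrite <- Cmod_opp. apply is_Cseries_Cmod_le with (1 := HAn').
        intros N. eapply Rle_trans; [apply Csum_Cmod_le |].
        assert (Hrn : 0 < rho ^ S n) by now apply pow_lt.
        apply Rle_trans with (sum_n (fun j => Cmod z ^ S n / rho ^ S n *
          (Cmod (a (S n + j)%nat) * rho ^ (S n + j))) N).
        - apply sum_n_le. intros j. rewrite Cmod_mult, Cmod_pow, !pow_add.
          replace (Cmod z ^ S n / rho ^ S n * (Cmod (a (S n + j)%nat) * (rho ^ S n * rho ^ j)))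
            with (Cmod (a (S n + j)%nat) * (Cmod z ^ S n * rho ^ j)) by (field; lra).
          apply Rmult_le_compat_l. apply Cmod_ge_0.
          apply Rmult_le_compat_l. apply pow_le, Cmod_ge_0.
          apply pow_incr. split. apply Cmod_ge_0. exact Hs2.
        - rewrite (sum_n_mult_l (K:=R_AbsRing)). unfold mult; simpl Ring.AbelianMonoid.
          apply Rle_trans with (Cmod z ^ S n / rho ^ S n * M).
          2: apply Req_le; field; lra.
          apply Rmult_le_compat_l.
          { apply Rmult_le_pos. apply pow_le, Cmod_ge_0. apply Rlt_le, Rinv_0_lt_compat, Hrn. }
          apply Rle_trans with (2 := A1 (S n + N)%nat).
          apply (sum_n_shift_le (fun j => Cmod (a j) * rho ^ j)).
          intros j. apply Rmult_le_pos. apply Cmod_ge_0. apply pow_le; lra. }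
      rewrite Cmod_mult, Cmod_pow in HC.
      apply Rmult_le_reg_r with (Cmod z ^ n). now apply pow_lt.
      eapply Rle_trans; [exact HC |]. simpl. apply Req_le. ring. }
    apply Rnot_lt_le. intros Hc.
    set (K := M / rho ^ S n) in *.
    assert (HK : 0 <= K).
    { apply Rmult_le_pos; auto. apply Rlt_le, Rinv_0_lt_compat, pow_lt, Hr. }
    (* This close to [s0], the bound [Cmod (s - s0) * K] is below [Cmod (a n)], against [Hbd];
       [K + 1] avoids dividing by 0. *)
    destruct (Hz (Rmin rho (Cmod (a n) / (K + 1)))) as [s [S1 [S2 S3]]].
    { apply Rmin_glb_lt; auto. apply Rdiv_lt_0_compat; lra. }
    pose proof (Rmin_l rho (Cmod (a n) / (K + 1))).
    pose proof (Rmin_r rho (Cmod (a n) / (K + 1))).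
    specialize (Hbd s S1 ltac:(lra) S3).
    assert (Cmod (s - s0)%C * (K + 1) < Cmod (a n)).
    { replace (Cmod (a n)) with (Cmod (a n) / (K + 1) * (K + 1)) by (field; lra).
      apply Rmult_lt_compat_r; lra. }
    pose proof (Cmod_ge_0 (s - s0)%C). nra. }
  intros s Hs. apply (is_Cseries_unique _ _ _ (A2 s Hs)).
  apply is_Cseries_ext with (2 := is_Cseries_0). intros j.
  rewrite (Ha (S j) j) by lia. ring.
Qed.

(** * The complex exponential *)

Lemma Cexp_plus (z w : C) : Cexp (z + w)%C = (Cexp z * Cexp w)%C.
Proof.
  destruct z as [x y], w as [u v]. unfold Cexp, Cplus, Cmult; simpl.
  rewrite exp_plus, cos_plus, sin_plus. f_equal; ring.
Qed.

Lemma Cexp_0 : Cexp 0 = 1.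
Proof.
  unfold Cexp; simpl. rewrite exp_0, cos_0, sin_0. unfold RtoC. f_equal; ring.
Qed.

Lemma Cmod_Cexp (z : C) : Cmod (Cexp z) = exp (Re z).
Proof.
  unfold Cexp, Cmod; simpl.
  replace (_ + _) with (Rsqr (exp (Re z)) * (Rsqr (sin (Im z)) + Rsqr (cos (Im z))))
    by (unfold Rsqr; ring).
  rewrite sin2_cos2, Rmult_1_r. apply sqrt_Rsqr. left. apply exp_pos.
Qed.

Lemma is_lim_seq_pow_fact (x : R) : is_lim_seq (fun n => x ^ n / INR (fact n)) 0.
Proof.
  apply is_lim_seq_ext with (fun n => / INR (fact n) * x ^ n).
  { intros n. unfold Rdiv. apply Rmult_comm. }
  apply ex_series_lim_0. exists (exp x). apply is_pseries_R, is_exp_Reals.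
Qed.

Lemma is_derive_Re_Cexp (z w : C) (t : R) :
  is_derive (fun t => Re (w * Cexp (RtoC t * z))%C) t
    (Re (w * z * Cexp (RtoC t * z))%C).
Proof.
  destruct z as [x y], w as [u v]. unfold Cexp, Cmult, RtoC, Re, Im; simpl.
  auto_derive; [easy |]. unfold Rminus. ring.
Qed.

Lemma Derive_n_Re_Cexp (z w : C) (n : nat) (t : R) :
  ex_derive_n (fun t => Re (w * Cexp (RtoC t * z))%C) n t /\
  Derive_n (fun t => Re (w * Cexp (RtoC t * z))%C) n t
    = Re (w * z ^ n * Cexp (RtoC t * z))%C.
Proof.
  set (f := fun (w : C) (t : R) => Re (w * Cexp (RtoC t * z))%C).
  change (ex_derive_n (f w) n t /\ Derive_n (f w) n t = f (w * z ^ n)%C t).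
  revert t. induction n as [|n IH]; intros t.
  - split. exact I. change (f w t = f (w * 1)%C t). now rewrite Cmult_1_r.
  - assert (H : is_derive (Derive_n (f w) n) t (f (w * z ^ S n)%C t)).
    { apply is_derive_ext with (f (w * z ^ n)%C).
      { intros u. symmetry. apply IH. }
      replace (w * z ^ S n)%C with (w * z ^ n * z)%C by (simpl; ring).
      apply is_derive_Re_Cexp. }
    split.
    + exists (f (w * z ^ S n)%C t). exact H.
    + simpl Derive_n. apply is_derive_unique. exact H.
Qed.

(** Taylor's formula with Lagrange remainder is a real statement, so it is applied on [[0, 1]] to
    [t -> Re (w * Cexp (t * z))], whose derivatives are explicit. The factor [w] lets the same lemma
    treat real and imaginary parts. *)
Lemma Cexp_Re_taylor (z w : C) :
  is_lim_seq (fun N => Re (w * sum_n (fun j => RtoC (/ INR (fact j)) * z ^ j) N)%C)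
    (Re (w * Cexp z)%C).
Proof.
  set (S := fun N => Re (w * sum_n (fun j => RtoC (/ INR (fact j)) * z ^ j) N)%C).
  set (B := Cmod w * exp (Rabs (Re z))).
  assert (H : forall N, Rabs (S N - Re (w * Cexp z)%C) <=
      B * (Cmod z ^ (N + 1) / INR (fact (N + 1)))).
  { intros N.
    destruct (Taylor_Lagrange (fun t => Re (w * Cexp (RtoC t * z))%C) N 0 1 Rlt_0_1)
      as [c [Hc Heq]].
    { intros t _ k _. apply Derive_n_Re_Cexp. }
    replace (RtoC 1 * z)%C with z in Heq by ring.
    rewrite Heq, (proj2 (Derive_n_Re_Cexp z w _ c)).
    assert (HS : sum_f_R0 (fun m => (1 - 0) ^ m / INR (fact m) *
        Derive_n (fun t => Re (w * Cexp (RtoC t * z))%C) m 0) N = S N).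
    { unfold S. clear -z w. induction N as [|N IH].
      - rewrite sum_O. cbn [sum_f_R0 Derive_n].
        replace (RtoC 0 * z)%C with (RtoC 0) by ring.
        rewrite Cexp_0. simpl. rewrite Rinv_1. destruct w; simpl; field.
      - rewrite Csum_Sn, Cmult_plus_distr_l. cbn [sum_f_R0]. rewrite IH.
        rewrite (proj2 (Derive_n_Re_Cexp z w _ 0)).
        replace (RtoC 0 * z)%C with (RtoC 0) by ring. rewrite Cexp_0.
        replace (1 - 0) with 1 by ring. rewrite pow1.
        destruct (z ^ Datatypes.S N)%C as [p q], w as [u v], (sum_n _ N) as [a b].
        simpl. unfold Rdiv. ring. }
    rewrite HS.
    replace (S N - _) with (- ((1 - 0) ^ Datatypes.S N / INR (fact (Datatypes.S N)) *
        Re (w * z ^ Datatypes.S N * Cexp (c * z))%C)) by ring.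
    rewrite Rabs_Ropp, Rabs_mult. replace (1 - 0) with 1 by ring. rewrite pow1.
    replace (N + 1)%nat with (Datatypes.S N) by lia.
    assert (Hf : 0 < / INR (fact (Datatypes.S N))) by apply Rinv_0_lt_compat, INR_fact_lt_0.
    unfold Rdiv. rewrite Rmult_1_l, (Rabs_pos_eq (/ _)) by lra.
    rewrite (Rmult_comm (Cmod z ^ _)), <- Rmult_assoc, (Rmult_comm B), Rmult_assoc.
    apply Rmult_le_compat_l; [lra |].
    eapply Rle_trans; [apply re_le_Cmod |].
    rewrite !Cmod_mult, Cmod_pow, Cmod_Cexp. unfold B.
    rewrite (Rmult_assoc (Cmod w)), (Rmult_assoc (Cmod w)).
    apply Rmult_le_compat_l. apply Cmod_ge_0.
    rewrite Rmult_comm. apply Rmult_le_compat_r. apply pow_le, Cmod_ge_0.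
    assert (Hle : Re (c * z)%C <= Rabs (Re z)).
    { destruct z as [x y]; simpl. rewrite Rmult_0_l, Rminus_0_r.
      unfold Rabs. destruct (Rcase_abs x); nra. }
    destruct Hle as [Hlt | ->]; [left; now apply exp_increasing | apply Rle_refl]. }
  assert (H0 : is_lim_seq (fun N => B * (Cmod z ^ (N + 1) / INR (fact (N + 1)))) (B * 0)).
  { apply (is_lim_seq_scal_l _ B 0).
    apply is_lim_seq_incr_n with (N := 1%nat)
      (u := fun n => Cmod z ^ n / INR (fact n)).
    apply is_lim_seq_pow_fact. }
  rewrite Rmult_0_r in H0. apply is_lim_seq_spec in H0. apply is_lim_seq_spec.
  intros eps. destruct (H0 eps) as [N HN]. exists N. intros n Hn.
  specialize (HN n Hn). rewrite Rminus_0_r in HN.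
  eapply Rle_lt_trans; [apply H |]. eapply Rle_lt_trans; [apply Rle_abs | exact HN].
Qed.

Lemma is_Cseries_Cexp (z : C) :
  is_Cseries (fun j => RtoC (/ INR (fact j)) * z ^ j)%C (Cexp z).
Proof.
  apply is_Cseries_Cmod.
  set (S := fun N => sum_n (fun j => RtoC (/ INR (fact j)) * z ^ j)%C N).
  (* The choice [w = - Ci] yields imaginary parts, since [Re (- Ci * c) = Im c]. *)
  pose proof (Cexp_Re_taylor z 1) as H1. pose proof (Cexp_Re_taylor z (- Ci)%C) as H2.
  assert (K1 : is_lim_seq (fun N => Rabs (Re (S N) - Re (Cexp z))) 0).
  { apply (proj1 (is_lim_seq_abs_0 _)).
    replace (Finite 0) with (Finite (Re (Cexp z) - Re (Cexp z))) by (f_equal; ring).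
    apply is_lim_seq_minus'; [| apply is_lim_seq_const].
    rewrite Cmult_1_l in H1. apply is_lim_seq_ext with (2 := H1).
    intros N. fold (S N). now rewrite Cmult_1_l. }
  assert (K2 : is_lim_seq (fun N => Rabs (Im (S N) - Im (Cexp z))) 0).
  { apply (proj1 (is_lim_seq_abs_0 _)).
    replace (Finite 0) with (Finite (Im (Cexp z) - Im (Cexp z))) by (f_equal; ring).
    apply is_lim_seq_minus'; [| apply is_lim_seq_const].
    assert (HI : forall c, Re (- Ci * c)%C = Im c) by (intros [a b]; simpl; ring).
    rewrite HI in H2. apply is_lim_seq_ext with (2 := H2).
    intros N. fold (S N). now rewrite HI. }
  apply is_lim_seq_le_le with (fun _ => 0)
    (fun N => Rabs (Re (S N) - Re (Cexp z)) + Rabs (Im (S N) - Im (Cexp z))).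
  - intros N. split. apply Cmod_ge_0. fold (S N).
    replace (S N - Cexp z)%C with
      (RtoC (Re (S N) - Re (Cexp z)) + Ci * RtoC (Im (S N) - Im (Cexp z)))%C.
    + eapply Rle_trans; [apply Cmod_triangle |].
      rewrite Cmod_mult, Cmod_Ci, !Cmod_R. lra.
    + destruct (S N), (Cexp z). unfold Cminus, Cplus, Cmult, Copp, RtoC, Ci; simpl.
      f_equal; ring.
  - apply is_lim_seq_const.
  - replace (Finite 0) with (Finite (0 + 0)) by (f_equal; ring).
    now apply is_lim_seq_plus'.
Qed.

Lemma exp_partial_sum_le (x : R) (N : nat) :
  0 <= x -> sum_n (fun j => x ^ j / INR (fact j)) N <= exp x.
Proof.
  intros Hx.
  assert (Hs : is_series (fun j => x ^ j / INR (fact j)) (exp x)).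
  { apply is_series_ext with (fun n => / INR (fact n) * x ^ n).
    intros n. unfold Rdiv. apply Rmult_comm. apply is_pseries_R, is_exp_Reals. }
  rewrite <- (is_series_unique _ _ Hs). apply sum_n_le_Series.
  - intros n. apply Rmult_le_pos. now apply pow_le.
    apply Rlt_le, Rinv_0_lt_compat, INR_fact_lt_0.
  - now exists (exp x).
Qed.

(** Factor out [Cexp (- s0 * L)], of modulus [exp (- Re s0 * L)]; the absolute series of the other
    factor sums to [exp (L * rho)]. *)
Lemma expandable_Cexp_opp (s0 : C) (rho L : R) :
  0 <= rho -> 0 <= L ->
  expandable s0 rho (exp (L * (rho - Re s0))) (fun s => Cexp (- (s * RtoC L)))%C.
Proof.
  intros Hr HL.
  exists (fun j => Cexp (- (s0 * RtoC L)) * RtoC ((- L) ^ j / INR (fact j)))%C. split.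
  - intros N.
    apply Rle_trans with (exp (- (Re s0 * L)) * sum_n (fun j => (L * rho) ^ j / INR (fact j)) N).
    + apply Req_le. rewrite <- (sum_n_mult_l (K:=R_AbsRing)).
      apply sum_n_ext. intros j. R_eq. rewrite Cmod_mult, Cmod_Cexp, Cmod_R.
      unfold mult; simpl. unfold Rdiv.
      rewrite Rabs_mult, <- RPow_abs, Rabs_Ropp, (Rabs_pos_eq L) by auto.
      rewrite (Rabs_pos_eq (/ _)) by apply Rlt_le, Rinv_0_lt_compat, INR_fact_lt_0.
      rewrite Rpow_mult_distr. replace (- (_ - _)) with (- (Re s0 * L)). ring.
      destruct s0; simpl; ring.
    + replace (L * (rho - Re s0)) with (- (Re s0 * L) + L * rho) by ring.
      rewrite exp_plus. apply Rmult_le_compat_l. left; apply exp_pos.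
      apply exp_partial_sum_le. now apply Rmult_le_pos.
  - intros s _.
    replace (Cexp (- (s * L)))%C with (Cexp (- (s0 * L)) * Cexp (- ((s - s0) * L)))%C
      by (rewrite <- Cexp_plus; f_equal; ring).
    apply is_Cseries_ext with (2 := is_Cseries_scal (Cexp (- (s0 * L)))%C _ _
      (is_Cseries_Cexp (- ((s - s0) * L))%C)).
    intros j. rewrite <- Cmult_assoc. f_equal.
    replace (- ((s - s0) * L))%C with (RtoC (- L) * (s - s0))%C
      by (rewrite RtoC_opp; ring).
    rewrite Cpow_mult_l. unfold Rdiv. rewrite RtoC_mult, RtoC_pow. ring.
Qed.

Lemma expandable_id (s0 : C) (rho : R) :
  0 <= rho -> expandable s0 rho (Cmod s0 + rho) (fun s => s).
Proof.
  intros Hr.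
  apply expandable_ext with (fun s => s0 + (s - s0) * 1)%C. { intros; ring. }
  apply expandable_plus; auto. apply expandable_const.
  apply expandable_weaken with (rho * Cmod 1). rewrite Cmod_1; lra.
  apply expandable_shift; auto. apply expandable_const.
Qed.

Lemma expandable_pow (s0 : C) (rho : R) (n : nat) :
  0 < rho -> expandable s0 rho ((Cmod s0 + rho) ^ n) (fun s => s ^ n)%C.
Proof.
  intros Hr. induction n as [|n IH].
  - apply expandable_weaken with (Cmod 1). rewrite Cmod_1; simpl; lra.
    exact (expandable_const s0 rho 1).
  - simpl. apply expandable_mult; auto. apply expandable_id. lra.
Qed.

(** The bound is the same remainder of the real exponential, with [s] replaced by the bound
    [Cmod s0 + rho] of the identity function. It is of second order in [c], which the second
    differences rely on. *)
Lemma expandable_Cexp_remainder (s0 : C) (rho c : R) :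
  0 < rho ->
  expandable s0 rho
    (exp (Rabs c * (Cmod s0 + rho)) - 1 - Rabs c * (Cmod s0 + rho))
    (fun s => Cexp (RtoC c * s) - 1 - RtoC c * s)%C.
Proof.
  intros Hr. set (q := Cmod s0 + rho).
  assert (Hs : is_series (fun n => Rabs (c ^ (2 + n) / INR (fact (2 + n))) * q ^ (2 + n))
    (exp (Rabs c * q) - 1 - Rabs c * q)).
  { apply is_series_ext with (fun n => / INR (fact (S (S n))) * (Rabs c * q) ^ (S (S n))).
    - intros n. R_eq. change (2 + n)%nat with (S (S n)). unfold Rdiv.
      rewrite Rabs_mult, <- RPow_abs, Rpow_mult_distr.
      rewrite (Rabs_pos_eq (/ _)) by apply Rlt_le, Rinv_0_lt_compat, INR_fact_lt_0. ring.
    - apply (is_series_incr_1 (fun n => / INR (fact (S n)) * (Rabs c * q) ^ (S n))).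
      apply (is_series_incr_1 (fun n => / INR (fact n) * (Rabs c * q) ^ n)).
      simpl. unfold plus; simpl.
      replace (_ + _) with (exp (Rabs c * q)) by field.
      apply is_pseries_R, is_exp_Reals. }
  rewrite <- (is_series_unique _ _ Hs).
  apply expandable_series with
    (fun n s => RtoC (c ^ (2 + n) / INR (fact (2 + n))) * s ^ (2 + n))%C; auto.
  - intros n. rewrite <- Cmod_R. apply expandable_scal. now apply expandable_pow.
  - eexists; exact Hs.
  - intros s _.
    apply (is_Cseries_ext (fun n => RtoC (/ INR (fact (S (S n)))) * (RtoC c * s) ^ (S (S n)))%C).
    + intros n. change (2 + n)%nat with (S (S n)). rewrite Cpow_mult_l. unfold Rdiv.
      rewrite RtoC_mult, RtoC_pow. ring.
    + apply (is_Cseries_incr_1 (fun n => RtoC (/ INR (fact (S n))) * (RtoC c * s) ^ (S n))%C).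
      apply (is_Cseries_incr_1 (fun n => RtoC (/ INR (fact n)) * (RtoC c * s) ^ n)%C).
      replace (_ + _)%C with (Cexp (c * s)%C).
      2: { simpl fact. simpl INR. rewrite Rinv_1. simpl. ring. }
      apply is_Cseries_Cexp.
Qed.

(** * The value of the zeta function at 0 *)

Lemma ln_le_minus_1 (x : R) : 0 < x -> ln x <= x - 1.
Proof.
  intros Hx. pose proof (exp_ineq1_le (ln x)) as H. rewrite exp_ln in H by auto. lra.
Qed.

(** From [1 - x <= exp (- x)] follows [exp x - 1 <= x * exp x]; using this twice gives the bound. *)
Lemma exp_remainder_le (x : R) : 0 <= x -> exp x - 1 - x <= x ^ 2 * exp x.
Proof.
  intros Hx.
  pose proof (exp_ineq1_le (- x)) as H. rewrite exp_Ropp in H.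
  pose proof (exp_pos x) as Hp.
  assert (H1 : exp x * (1 + - x) <= 1).
  { replace 1 with (exp x * / exp x) at 2 by (field; lra).
    apply Rmult_le_compat_l; lra. }
  nra.
Qed.

(** With [a = ln (m / (m-1))] and [b = ln ((m+1) / m)] the second difference is
    [m^(-s) * (exp (a s) - 2 + exp (- b s))]. Its linear part has the factor [a - b = O(1/m^2)], the
    remainders are [O(a^2 + b^2) = O(1/m^2)], and [m^(-s)] is at most [sqrt m] on the disc because
    [0 <= Re s0]. *)
Lemma expandable_second_difference (s0 : C) :
  0 <= Re s0 -> exists K, 0 <= K /\ forall m : nat, (2 <= m)%nat ->
    expandable s0 (1 / 2) (K * (sqrt (INR m) / INR m ^ 2))
      (fun s => nat_cpow_opp (m - 1) s - 2 * nat_cpow_opp m s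
                + nat_cpow_opp (m + 1) s)%C.
Proof.
  intros Hs0. set (q := Cmod s0 + 1 / 2).
  assert (Hq : 0 < q) by (unfold q; pose proof (Cmod_ge_0 s0); lra).
  (* [2 * q] comes from [a - b <= 2 / m^2]; the [5] is [4 + 1], from [a <= 2 / m] and
     [b <= 1 / m]. *)
  exists (2 * q + 5 * q ^ 2 * exp q). split.
  { pose proof (exp_pos q). assert (0 <= q ^ 2) by (apply pow_le; lra). nra. }
  intros m Hm.
  assert (Hm' : 2 <= INR m) by (apply (le_INR 2 m); auto).
  set (x := INR m) in *.
  assert (Hm1 : INR (m - 1) = x - 1) by (rewrite minus_INR by lia; reflexivity).
  assert (Hm2 : INR (m + 1) = x + 1) by (rewrite plus_INR; reflexivity).
  set (a := ln x - ln (x - 1)). set (b := ln (x + 1) - ln x).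
  assert (Hix : 0 < / x) by (apply Rinv_0_lt_compat; lra).
  assert (Hix2 : / x <= / 2) by (apply Rinv_le_contravar; lra).
  assert (Ha0 : 0 <= a).
  { unfold a. pose proof (ln_increasing (x - 1) x). lra. }
  assert (Hb0 : 0 <= b).
  { unfold b. pose proof (ln_increasing x (x + 1)). lra. }
  assert (Ha : a <= 2 / x).
  { unfold a. rewrite <- ln_div by lra.
    eapply Rle_trans; [apply ln_le_minus_1; apply Rdiv_lt_0_compat; lra |].
    apply Rmult_le_reg_r with (x * (x - 1)); [nra |]. field_simplify; nra. }
  assert (Hb : b <= 1 / x).
  { unfold b. rewrite <- ln_div by lra.
    eapply Rle_trans; [apply ln_le_minus_1; apply Rdiv_lt_0_compat; lra |].
    apply Req_le. field. lra. }
  assert (Hab : Rabs (a - b) <= 2 / x ^ 2).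
  { assert (Hab0 : a - b = ln (x * x / ((x - 1) * (x + 1)))).
    { rewrite ln_div by nra. rewrite !ln_mult by lra. unfold a, b. ring. }
    assert (Hpos : 0 < (x - 1) * (x + 1)) by nra.
    rewrite Rabs_pos_eq.
    - rewrite Hab0. eapply Rle_trans; [apply ln_le_minus_1; apply Rdiv_lt_0_compat; nra |].
      apply Rmult_le_reg_r with (x ^ 2 * ((x - 1) * (x + 1))); [nra |].
      field_simplify; nra.
    - rewrite Hab0, <- ln_1. apply Rcomplements.ln_le; [lra |].
      apply Rmult_le_reg_r with ((x - 1) * (x + 1)); auto. field_simplify; nra. }
  apply expandable_ext with (fun s => Cexp (- (s * RtoC (ln x))) *
    ((RtoC (a - b) * s + (Cexp (RtoC a * s) - 1 - RtoC a * s))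
      + (Cexp (RtoC (- b) * s) - 1 - RtoC (- b) * s)))%C.
  { intros s _. unfold nat_cpow_opp. rewrite Hm1, Hm2. fold x.
    replace (- (s * ln (x - 1)))%C with (- (s * ln x) + RtoC a * s)%C
      by (unfold a; rewrite RtoC_minus; ring).
    replace (- (s * ln (x + 1)))%C with (- (s * ln x) + RtoC (- b) * s)%C
      by (unfold b; rewrite RtoC_opp, RtoC_minus; ring).
    rewrite !Cexp_plus, RtoC_minus, RtoC_opp. ring. }
  apply expandable_weaken with (exp (ln x * (1 / 2 - Re s0)) *
    ((Cmod (RtoC (a - b)) * q + (exp (Rabs a * q) - 1 - Rabs a * q))
      + (exp (Rabs (- b) * q) - 1 - Rabs (- b) * q))).
  2: { assert (Hh : 0 < 1 / 2) by lra.
    apply expandable_mult; auto.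
    - apply expandable_Cexp_opp. lra. rewrite <- ln_1. apply Rcomplements.ln_le; lra.
    - apply expandable_plus; [lra | apply expandable_plus; [lra | |] |].
      + apply expandable_scal. apply expandable_id. lra.
      + now apply expandable_Cexp_remainder.
      + now apply expandable_Cexp_remainder. }
  assert (Hsq : exp (ln x * (1 / 2 - Re s0)) <= sqrt x).
  { rewrite <- Rpower_sqrt by lra. unfold Rpower.
    assert (0 <= ln x) by (rewrite <- ln_1; apply Rcomplements.ln_le; lra).
    destruct (Rle_lt_or_eq_dec (ln x * (1 / 2 - Re s0)) (/ 2 * ln x)) as [Hl | ->].
    - nra.
    - left. now apply exp_increasing.
    - apply Rle_refl. }
  rewrite Cmod_R, Rabs_Ropp, (Rabs_pos_eq a), (Rabs_pos_eq b) by auto.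
  assert (E : forall c, 0 <= c -> c <= 2 / x -> exp (c * q) - 1 - c * q <= c ^ 2 * q ^ 2 * exp q).
  { intros c Hc Hc2. eapply Rle_trans; [apply exp_remainder_le; nra |].
    rewrite Rpow_mult_distr. apply Rmult_le_compat_l.
    apply Rmult_le_pos; apply pow_le; lra.
    assert (c * q <= q) by (unfold Rdiv in Hc2; nra).
    destruct (Rle_lt_or_eq_dec (c * q) q) as [Hl | ->]; auto.
    left; now apply exp_increasing. apply Rle_refl. }
  pose proof (E a Ha0 Ha) as Ea.
  pose proof (E b Hb0 ltac:(unfold Rdiv in *; lra)) as Eb.
  assert (Hq2 : 0 < q ^ 2 * exp q).
  { apply Rmult_lt_0_compat. apply pow_lt; auto. apply exp_pos. }
  assert (Ea2 : a ^ 2 <= 4 / x ^ 2).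
  { replace (4 / x ^ 2) with ((2 / x) ^ 2) by (field; lra). now apply pow_incr. }
  assert (Eb2 : b ^ 2 <= 1 / x ^ 2).
  { replace (1 / x ^ 2) with ((1 / x) ^ 2) by (field; lra). now apply pow_incr. }
  apply Rle_trans with (sqrt x * ((2 * q + 5 * q ^ 2 * exp q) / x ^ 2)).
  2: apply Req_le; field; lra.
  apply Rle_trans with (exp (ln x * (1 / 2 - Re s0)) * ((2 * q + 5 * q ^ 2 * exp q) / x ^ 2)).
  - apply Rmult_le_compat_l. left; apply exp_pos.
    replace ((2 * q + 5 * q ^ 2 * exp q) / x ^ 2) with
      (2 / x ^ 2 * q + 4 / x ^ 2 * (q ^ 2 * exp q) + 1 / x ^ 2 * (q ^ 2 * exp q))
      by (field; lra).
    assert (Rabs (a - b) * q <= 2 / x ^ 2 * q) by (apply Rmult_le_compat_r; lra).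
    assert (a ^ 2 * (q ^ 2 * exp q) <= 4 / x ^ 2 * (q ^ 2 * exp q))
      by (apply Rmult_le_compat_r; lra).
    assert (b ^ 2 * (q ^ 2 * exp q) <= 1 / x ^ 2 * (q ^ 2 * exp q))
      by (apply Rmult_le_compat_r; lra).
    lra.
  - apply Rmult_le_compat_r; auto. apply Rmult_le_pos.
    pose proof (exp_pos q). nra. left. apply Rinv_0_lt_compat, pow_lt. lra.
Qed.

(** For [k = n + 1] the term is a multiple of [k^(-3/2)]; it is dominated by four times the
    telescoping difference of [1 / sqrt k] and [1 / sqrt (k+1)]. *)
Lemma ex_series_sqrt_div_square :
  ex_series (fun n => sqrt (INR (2 * n + 2)) / INR (2 * n + 2) ^ 2).
Proof.
  apply ex_series_dominated with (fun n => 4 * (/ sqrt (INR (n + 1)) - / sqrt (INR (n + 2)))).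
  - intros n.
    replace (INR (2 * n + 2)) with (2 * INR (n + 1)) by (rewrite !plus_INR, mult_INR; simpl; ring).
    replace (INR (n + 2)) with (INR (n + 1) + 1) by (rewrite !plus_INR; simpl; ring).
    assert (Hn : 1 <= INR (n + 1)) by (apply (le_INR 1); lia).
    set (k := INR (n + 1)) in *.
    rewrite sqrt_mult by lra.
    assert (Hx : 1 <= sqrt k) by (rewrite <- sqrt_1; apply sqrt_le_1_alt; lra).
    assert (Hxx : k = sqrt k * sqrt k) by (rewrite sqrt_sqrt; lra).
    assert (Hyy : k + 1 = sqrt (k + 1) * sqrt (k + 1)) by (rewrite sqrt_sqrt; lra).
    assert (Hxy : sqrt k <= sqrt (k + 1)) by (apply sqrt_le_1_alt; lra).
    assert (H2 : 0 <= sqrt 2 <= 2).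
    { split. apply sqrt_pos. rewrite <- (sqrt_square 2) at 2 by lra. apply sqrt_le_1_alt; lra. }
    set (x := sqrt k) in *. set (y := sqrt (k + 1)) in *.
    rewrite Rabs_pos_eq.
    2: { apply Rmult_le_pos. nra. left. apply Rinv_0_lt_compat. nra. }
    rewrite Hxx.
    apply Rle_trans with (/ x ^ 3).
    + apply Rmult_le_reg_r with (x ^ 4). apply pow_lt; lra.
      field_simplify; [nra | lra | lra].
    + assert (Hd : / x - / y = / (x * y * (x + y))).
      { assert (He : (y - x) * (y + x) = 1) by nra.
        replace (/ x - / y) with ((y - x) * (y + x) / (x * y * (x + y))) by (field; nra).
        rewrite He. unfold Rdiv. ring. }
      rewrite Hd.
      assert (Hy2 : y <= 2 * x) by nra.
      replace (4 * / (x * y * (x + y))) with (/ (x * y * (x + y) / 4)) by (field; nra).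
      apply Rinv_le_contravar. apply Rdiv_lt_0_compat; [| lra].
      apply Rmult_lt_0_compat; nra.
      assert (y * (x + y) <= 4 * x ^ 2) by nra. nra.
  - apply (ex_series_scal_l 4 (fun n => / sqrt (INR (n + 1)) - / sqrt (INR (n + 2)))).
    apply (series_nonneg_bounded _ 1).
    + intros n. apply Rcomplements.Rle_minus_r. rewrite Rplus_0_l. apply Rinv_le_contravar.
      apply sqrt_lt_R0. apply (lt_INR 0). lia.
      apply sqrt_le_1_alt. apply le_INR. lia.
    + assert (H : forall N, sum_n (fun n => / sqrt (INR (n + 1)) - / sqrt (INR (n + 2))) N
        = 1 - / sqrt (INR (N + 2))).
      { induction N as [|N IH].
        - rewrite sum_O. simpl. rewrite sqrt_1, Rinv_1. reflexivity.
        - rewrite sum_Sn, IH. unfold plus; simpl plus.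
          replace (S N + 1)%nat with (N + 2)%nat by lia. simpl. ring. }
      intros N. rewrite H.
      assert (0 < / sqrt (INR (N + 2))).
      { apply Rinv_0_lt_compat, sqrt_lt_R0, (lt_INR 0). lia. }
      lra.
Qed.

Lemma is_Cseries_pair (a : nat -> C) (l : C) :
  is_Cseries a l -> is_Cseries (fun n => a (2 * n)%nat + a (2 * n + 1)%nat)%C l.
Proof.
  intros H. apply is_Cseries_Cmod in H. apply is_Cseries_Cmod.
  assert (HS : forall N, sum_n (fun n => a (2 * n)%nat + a (2 * n + 1)%nat)%C N
     = sum_n a (2 * N + 1)%nat).
  { induction N as [|N IH].
    - rewrite sum_O. simpl. now rewrite Csum_Sn, sum_O.
    - rewrite Csum_Sn, IH. replace (2 * S N + 1)%nat with (S (S (2 * N + 1))) by lia.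
      rewrite !Csum_Sn. replace (2 * S N)%nat with (S (2 * N + 1)) by lia.
      match goal with |- ?x = ?y => change (@eq C x y) end. ring. }
  apply is_lim_seq_ext with (fun N => Cmod (sum_n a (2 * N + 1)%nat - l)%C).
  { intros N. now rewrite HS. }
  apply (is_lim_seq_subseq (fun N => Cmod (sum_n a N - l)%C)); auto.
  apply eventually_subseq. intros n. lia.
Qed.

Definition zeta_difference (n : nat) (s : C) : C :=
  (nat_cpow_opp (2 * n + 1) s - 2 * nat_cpow_opp (2 * n + 2) s
     + nat_cpow_opp (2 * n + 3) s)%C.

(** Pairing the Dirichlet series from its first term and from its second term, and adding, gives odd
    term plus twice the even term plus next odd term, of sum [z + (z - 1)]. Four times the even
    terms, of sum [4 * 2^(-s) * z], is then subtracted. *)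
Lemma zeta_difference_sum (s z : C) :
  is_Cseries (fun n => nat_cpow_opp (S n) s) z ->
  is_Cseries (fun n => zeta_difference n s)
    (2 * (1 - 2 * nat_cpow_opp 2 s) * z - 1)%C.
Proof.
  intros H.
  assert (H1 : nat_cpow_opp 1 s = 1).
  { unfold nat_cpow_opp. simpl. rewrite ln_1.
    replace (- (s * 0))%C with (RtoC 0) by ring. apply Cexp_0. }
  pose proof (is_Cseries_pair _ _ H) as P1.
  assert (H' : is_Cseries (fun n => nat_cpow_opp (S (S n)) s) (z - 1)%C).
  { apply (is_Cseries_incr_1 (fun n => nat_cpow_opp (S n) s)).
    rewrite H1. now replace (z - 1 + 1)%C with z by ring. }
  pose proof (is_Cseries_pair _ _ H') as P2.
  pose proof (is_Cseries_scal (nat_cpow_opp 2 s) _ _ H) as P3.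
  pose proof (is_Cseries_plus _ _ _ _ (is_Cseries_plus _ _ _ _ P1 P2)
    (is_Cseries_scal (-4)%C _ _ P3)) as P.
  replace (2 * (1 - 2 * nat_cpow_opp 2 s) * z - 1)%C with
    (z + (z - 1) + -4 * (nat_cpow_opp 2 s * z))%C by ring.
  apply is_Cseries_ext with (2 := P). intros n.
  replace (nat_cpow_opp 2 s * nat_cpow_opp (S n) s)%C with (nat_cpow_opp (2 * n + 2) s).
  - unfold zeta_difference.
    replace (S (2 * n)) with (2 * n + 1)%nat by lia.
    replace (S (2 * n + 1)) with (2 * n + 2)%nat by lia.
    replace (S (2 * n + 2)) with (2 * n + 3)%nat by lia. ring.
  - unfold nat_cpow_opp. rewrite <- Cexp_plus. f_equal.
    replace (2 * n + 2)%nat with (2 * S n)%nat by lia.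
    rewrite mult_INR, ln_mult, RtoC_plus. ring.
    apply (lt_INR 0); lia. apply (lt_INR 0); lia.
Qed.

Lemma zeta_difference_expandable :
  exists G : C -> C,
    (forall s0, 0 <= Re s0 -> exists M, expandable s0 (1 / 2) M G) /\
    (forall s l, is_Cseries (fun n => zeta_difference n s) l -> G s = l).
Proof.
  (* [G s] is the sum of the series where it converges and arbitrary elsewhere; convergence is shown
     below on every disc of radius [1 / 2] about a centre with [0 <= Re s0]. *)
  destruct (choice_function C C (fun s l =>
    forall l', is_Cseries (fun n => zeta_difference n s) l' -> l' = l)) as [G HG].
  { intros s. destruct (classic (exists l, is_Cseries (fun n => zeta_difference n s) l)) as [[l Hl]|Hn].
    - exists l. intros l' Hl'. exact (is_Cseries_unique _ _ _ Hl' Hl).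
    - exists (RtoC 0). intros l' Hl'. exfalso. apply Hn. now exists l'. }
  exists G. split.
  2: { intros s l Hl. symmetry. now apply HG. }
  intros s0 Hs0.
  destruct (expandable_second_difference s0 Hs0) as [K [HK HE]].
  set (M := fun n => K * (sqrt (INR (2 * n + 2)) / INR (2 * n + 2) ^ 2)).
  assert (HM : ex_series M).
  { apply (ex_series_scal_l K (fun n => sqrt (INR (2 * n + 2)) / INR (2 * n + 2) ^ 2)).
    apply ex_series_sqrt_div_square. }
  assert (HEn : forall n, expandable s0 (1 / 2) (M n) (zeta_difference n)).
  { intros n. apply expandable_ext with (2 := HE (2 * n + 2)%nat ltac:(lia)).
    intros s _. unfold zeta_difference.
    replace (2 * n + 2 - 1)%nat with (2 * n + 1)%nat by lia.
    replace (2 * n + 2 + 1)%nat with (2 * n + 3)%nat by lia. reflexivity. }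
  exists (Series M). apply expandable_series with zeta_difference; auto. lra.
  intros s Hs.
  destruct (ex_Cseries (fun n => zeta_difference n s) M) as [l [Hl _]]; auto.
  { intros n. exact (expandable_Cmod_le _ _ _ _ _ (HEn n) Hs). }
  now rewrite <- (HG s l Hl).
Qed.

Lemma analytic_sub_expandable (zeta G : C -> C) (s0 : C) (M : R) :
  analytic_at zeta s0 -> expandable s0 (1 / 2) M G ->
  exists rho M', 0 < rho /\
    expandable s0 rho M' (fun s => 2 * (1 - 2 * nat_cpow_opp 2 s) * zeta s - 1 - G s)%C.
Proof.
  intros Hz HG. destruct (analytic_expandable _ _ Hz) as [r [M1 [Hr HZ]]].
  set (rho := Rmin r (1 / 2)).
  assert (Hrho : 0 < rho) by (apply Rmin_glb_lt; lra).
  assert (Hl : 0 <= ln (INR 2)).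
  { rewrite <- ln_1. apply Rcomplements.ln_le; simpl; lra. }
  pose proof (expandable_radius _ r rho _ _ ltac:(pose proof (Rmin_l r (1/2)); unfold rho in *; lra) HZ) as Z'.
  pose proof (expandable_radius _ (1/2) rho _ _ ltac:(pose proof (Rmin_r r (1/2)); unfold rho in *; lra) HG) as G'.
  pose proof (expandable_Cexp_opp s0 rho _ (Rlt_le _ _ Hrho) Hl) as N'.
  pose proof (expandable_plus _ _ _ _ _ _ (Rlt_le _ _ Hrho) (expandable_const s0 rho 2)
    (expandable_scal _ _ _ _ (-4)%C N')) as A.
  pose proof (expandable_mult _ _ _ _ _ _ Hrho A Z') as B.
  pose proof (expandable_plus _ _ _ _ _ _ (Rlt_le _ _ Hrho)
    (expandable_plus _ _ _ _ _ _ (Rlt_le _ _ Hrho) B (expandable_const s0 rho (-1)%C))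
    (expandable_scal _ _ _ _ (-1)%C G')) as D.
  exists rho. eexists. split; [exact Hrho |].
  apply expandable_ext with (2 := D). intros s _. unfold nat_cpow_opp. ring.
Qed.

(* The segment from [2 + i] to [0] avoids the pole [1]; zeros propagate along
   it because at the supremum of the part where [D] vanishes, zeros of [D]
   accumulate at the centre of an expansion. *)
Lemma expandable_zero_segment (D : C -> C) (w : C) (t0 : R) :
  w <> 0 -> 0 < t0 <= 1 ->
  (forall t, 0 <= t <= 1 ->
     exists rho M, 0 < rho /\ expandable (RtoC (1 - t) * w)%C rho M D) ->
  (forall t, 0 <= t < t0 -> D (RtoC (1 - t) * w)%C = 0) ->
  D 0 = 0.
Proof.
  intros Hw Ht0 HD H0.
  set (E := fun u => 0 <= u <= 1 /\ forall t, 0 <= t < u -> D (RtoC (1 - t) * w)%C = 0).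
  destruct (completeness E) as [m [Hub Hlub]].
  { exists 1. intros u [Hu _]. lra. }
  { exists t0. split; auto. lra. }
  assert (Hm1 : t0 <= m) by (apply Hub; split; auto; lra).
  assert (Hm2 : m <= 1) by (apply Hlub; intros u [Hu _]; lra).
  assert (Hlt : forall t, 0 <= t < m -> D (RtoC (1 - t) * w)%C = 0).
  { intros t Ht. apply NNPP. intros Hc. apply (Rlt_not_le m t); [lra |].
    apply Hlub. intros u [Hu1 Hu2]. apply Rnot_lt_le. intros Hu.
    apply Hc, Hu2. lra. }
  destruct (HD m ltac:(lra)) as [rho [M [Hrho HM]]].
  assert (Hw0 := proj1 (Cmod_gt_0 _) Hw).
  assert (Hdist : forall t, Cmod (RtoC (1 - t) * w - RtoC (1 - m) * w)%C = Rabs (m - t) * Cmod w).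
  { intros t. rewrite <- Cmod_R, <- Cmod_mult. f_equal. rewrite !RtoC_minus. ring. }
  assert (Hdisc : forall s, Cmod (s - RtoC (1 - m) * w)%C <= rho -> D s = 0).
  { apply expandable_zeros with M; auto. intros eps Heps.
    set (d := Rmin m (eps / (2 * Cmod w))).
    assert (Hd : 0 < d) by (apply Rmin_glb_lt; [lra | apply Rdiv_lt_0_compat; lra]).
    assert (Hd1 : d <= m) by apply Rmin_l.
    assert (Hd2 : d <= eps / (2 * Cmod w)) by apply Rmin_r.
    exists (RtoC (1 - (m - d)) * w)%C.
    assert (Hc : Cmod (RtoC (1 - (m - d)) * w - RtoC (1 - m) * w)%C = d * Cmod w).
    { rewrite Hdist. f_equal. replace (m - (m - d)) with d by ring. apply Rabs_pos_eq. lra. }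
    split; [| split].
    - intros He. rewrite He in Hc.
      replace (RtoC (1 - m) * w - RtoC (1 - m) * w)%C with (RtoC 0) in Hc by ring.
      rewrite Cmod_0 in Hc. nra.
    - rewrite Hc. apply Rle_lt_trans with (eps / 2); [| lra].
      replace (eps / 2) with (eps / (2 * Cmod w) * Cmod w) by (field; lra).
      apply Rmult_le_compat_r; lra.
    - apply Hlt. lra. }
  destruct (Rle_lt_or_eq_dec m 1 Hm2) as [Hlt1 | ->].
  2: { apply Hdisc. replace (0 - RtoC (1 - 1) * w)%C with (RtoC 0).
       rewrite Cmod_0; lra. rewrite RtoC_minus. ring. }
  (* If [m < 1], the disc of zeros around the centre covers a further piece of the segment, of
     parameter length [d], against the choice of [m]. *)
  exfalso. set (d := Rmin (1 - m) (rho / Cmod w)).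
  assert (Hd : 0 < d) by (apply Rmin_glb_lt; [lra | apply Rdiv_lt_0_compat; lra]).
  assert (Hd1 : d <= 1 - m) by apply Rmin_l.
  assert (Hd2 : d <= rho / Cmod w) by apply Rmin_r.
  assert (HE : E (m + d)).
  { split. lra. intros t Ht. destruct (Rlt_le_dec t m). apply Hlt; lra.
    apply Hdisc. rewrite Hdist. rewrite Rabs_minus_sym, Rabs_pos_eq by lra.
    replace rho with (rho / Cmod w * Cmod w) by (field; lra).
    apply Rmult_le_compat_r; lra. }
  specialize (Hub _ HE). lra.
Qed.

(** At [s = 0] every second difference is [1 - 2 + 1 = 0], so [G 0 = 0], and the propagated equation
    reads [2 * (1 - 2) * zeta 0 - 1 = 0]. *)
Lemma zeta_0 (zeta : C -> C) :
  is_riemann_zeta zeta -> Re (zeta 0) = - 1 / 2.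
Proof.
  intros [Han Hser].
  destruct zeta_difference_expandable as [G [HG1 HG2]].
  set (D := fun s => (2 * (1 - 2 * nat_cpow_opp 2 s) * zeta s - 1 - G s)%C).
  assert (HD0 : D 0 = 0).
  { apply (expandable_zero_segment D (2, 1) (1 / 4)).
    - intros H. injection H. lra.
    - lra.
    - intros t Ht. destruct (HG1 (RtoC (1 - t) * (2, 1))%C) as [M HM].
      { simpl. lra. }
      apply analytic_sub_expandable with M; auto. apply Han.
      intros H. injection H. lra.
    - intros t Ht. unfold D.
      assert (Hre : 1 < Re (RtoC (1 - t) * (2, 1))%C) by (simpl; lra).
      rewrite (HG2 _ _ (zeta_difference_sum _ _ (Hser _ Hre))). ring. }
  assert (Hn : forall n, nat_cpow_opp n 0 = 1).
  { intros n. unfold nat_cpow_opp. replace (- (0 * ln (INR n)))%C with (RtoC 0) by ring.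
    apply Cexp_0. }
  assert (HG0 : G 0 = 0).
  { apply HG2. apply is_Cseries_ext with (2 := is_Cseries_0).
    intros n. unfold zeta_difference. rewrite !Hn. ring. }
  unfold D in HD0. rewrite HG0, Hn in HD0.
  apply (f_equal Re) in HD0. destruct (zeta 0) as [x y].
  simpl in HD0. simpl. lra.
Qed.

(** * Euler's sine product and the even zeta values *)

Definition wallis (al : R) (n : nat) : R :=
  RInt (fun t => cos (al * t) * cos t ^ n) 0 (PI / 2).

Lemma continuous_of_ex_derive (f : R -> R) (x : R) : ex_derive f x -> continuous f x.
Proof. apply (ex_derive_continuous (V:=R_NormedModule)). Qed.

Lemma continuity_pt_of_ex_derive (f : R -> R) (x : R) :
  ex_derive f x -> continuity_pt f x.
Proof. intros H. apply continuity_pt_filterlim. now apply continuous_of_ex_derive. Qed.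

Lemma ex_RInt_of_ex_derive (f : R -> R) (a b : R) :
  (forall x, ex_derive f x) -> ex_RInt f a b.
Proof.
  intros H. apply (ex_RInt_continuous (V:=R_CompleteNormedModule)).
  intros z _. now apply continuous_of_ex_derive.
Qed.

Lemma ex_RInt_wallis (al : R) (n : nat) :
  ex_RInt (fun t => cos (al * t) * cos t ^ n) 0 (PI / 2).
Proof. apply ex_RInt_of_ex_derive. intros x. auto_derive. easy. Qed.

Lemma wallis_rec (al : R) (n : nat) :
  (INR (n + 2) ^ 2 - al ^ 2) * wallis al (n + 2)
    = INR (n + 2) * INR (n + 1) * wallis al n.
Proof.
  set (N := INR (n + 2)).
  (* [F] collects the boundary terms of two integrations by parts: its derivative is [f], and it
     vanishes at [0] through the sines and at [PI / 2] through the cosine powers. *)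
  set (F := fun t => N * cos t ^ (n + 1) * sin t * cos (al * t)
                     - al * cos t ^ (n + 2) * sin (al * t)).
  set (f := fun t => (N ^ 2 - al ^ 2) * (cos (al * t) * cos t ^ (n + 2))
                     - N * INR (n + 1) * (cos (al * t) * cos t ^ n)).
  assert (HF : is_RInt f 0 (PI / 2) (F (PI / 2) - F 0)).
  { apply (is_RInt_derive (V:=R_CompleteNormedModule) F f).
    - intros t _. unfold F, f. auto_derive; [easy |].
      replace (Init.Nat.pred (n + 1)) with n by lia.
      replace (Init.Nat.pred (n + 2)) with (n + 1)%nat by lia.
      fold N. replace (INR (n + 1)) with (N - 1)
        by (unfold N; rewrite !plus_INR; simpl; ring).
      rewrite !pow_add. pose proof (sin2_cos2 t) as H. unfold Rsqr in H.
      assert (Hs : sin t * sin t = 1 - cos t * cos t) by lra.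
      simpl. ring_simplify. replace (sin t ^ 2) with (1 - cos t * cos t) by lra. ring.
    - intros t _. apply continuous_of_ex_derive. unfold f. auto_derive. easy. }
  assert (Hz : F (PI / 2) - F 0 = 0).
  { unfold F. rewrite (Rmult_0_r al), cos_PI2, sin_0, !pow_i by lia. ring. }
  rewrite Hz in HF.
  assert (HI : is_RInt f 0 (PI / 2)
     ((N ^ 2 - al ^ 2) * wallis al (n + 2) - N * INR (n + 1) * wallis al n)).
  { apply (is_RInt_minus (V:=R_NormedModule)).
    - apply (is_RInt_scal (V:=R_NormedModule)).
      apply (RInt_correct (V:=R_CompleteNormedModule)), ex_RInt_wallis.
    - apply (is_RInt_scal (V:=R_NormedModule)).
      apply (RInt_correct (V:=R_CompleteNormedModule)), ex_RInt_wallis. }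
  apply (is_RInt_unique (V:=R_CompleteNormedModule)) in HF.
  apply (is_RInt_unique (V:=R_CompleteNormedModule)) in HI.
  rewrite HF in HI. simpl in HI |- *. lra.
Qed.

Lemma wallis_0_l (n : nat) : wallis 0 n = RInt (fun t => cos t ^ n) 0 (PI / 2).
Proof.
  apply RInt_ext. intros x _. rewrite Rmult_0_l, cos_0. R_eq. ring.
Qed.

Lemma wallis_0_pos (n : nat) : 0 < wallis 0 n.
Proof.
  apply RInt_gt_0.
  - pose proof PI_RGT_0. lra.
  - intros x Hx. rewrite Rmult_0_l, cos_0, Rmult_1_l. apply pow_lt, cos_gt_0; lra.
  - intros x _. apply continuous_of_ex_derive. auto_derive. easy.
Qed.

(** The derivative of [sin t - t * cos t] is [t * sin t]. The inequality trades [t^2 * cos t ^ 2]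
    for [sin t ^ 2] in [wallis_close]. *)
Lemma mul_cos_le_sin (t : R) : 0 <= t <= PI / 2 -> t * cos t <= sin t.
Proof.
  intros Ht.
  destruct (MVT_gen (fun t => sin t - t * cos t) 0 t (fun t => t * sin t)) as [c [Hc E]].
  - intros x _. auto_derive. easy. ring.
  - intros x _. apply continuity_pt_of_ex_derive. auto_derive. easy.
  - rewrite Rmin_left, Rmax_right in Hc by lra. rewrite sin_0 in E.
    assert (0 <= sin c) by (apply sin_ge_0; pose proof PI_RGT_0; lra).
    assert (0 <= c * sin c) by (apply Rmult_le_pos; lra). nra.
Qed.

Lemma one_minus_cos_bound (x : R) : 0 <= 1 - cos x <= x ^ 2 / 2.
Proof.
  split. pose proof (COS_bound x). lra.
  replace x with (2 * (x / 2)) at 1 by field. rewrite cos_2a_sin.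
  assert (H : Rabs (sin (x / 2)) <= Rabs (x / 2)).
  { destruct (Rtotal_order x 0) as [Hx|[->|Hx]].
    - rewrite <- (Rabs_Ropp (sin _)), <- sin_neg, <- (Rabs_Ropp (x / 2)).
      apply Rabs_le. rewrite (Rabs_pos_eq (- (x / 2))) by lra. split.
      + destruct (Rle_lt_dec (- (x / 2)) 1).
        * assert (0 <= sin (- (x / 2))) by (apply sin_ge_0; pose proof PI2_1; lra). lra.
        * pose proof (SIN_bound (- (x / 2))). lra.
      + left. apply sin_lt_x. lra.
    - replace (0 / 2) with 0 by field. rewrite sin_0. lra.
    - apply Rabs_le. rewrite (Rabs_pos_eq (x / 2)) by lra. split.
      + destruct (Rle_lt_dec (x / 2) 1).
        * assert (0 <= sin (x / 2)) by (apply sin_ge_0; pose proof PI2_1; lra). lra.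
        * pose proof (SIN_bound (x / 2)). lra.
      + left. apply sin_lt_x. lra. }
  apply Rsqr_le_abs_1 in H. unfold Rsqr in H. nra.
Qed.

(** Since [1 - cos (al t) <= (al t)^2 / 2] and [t * cos t <= sin t], the difference is at most
    [al^2 / 2] times the integral of [cos t ^ m * sin t ^ 2]. That integral is
    [wallis 0 m - wallis 0 (m + 2)], which the recurrence evaluates. *)
Lemma wallis_close (al : R) (m : nat) :
  Rabs (wallis al (m + 2) - wallis 0 (m + 2))
    <= al ^ 2 / 2 * (wallis 0 (m + 2) / INR (m + 1)).
Proof.
  assert (Hpi := PI_RGT_0).
  assert (Hrec := wallis_rec 0 m).
  assert (Hm1 : 0 < INR (m + 1)) by (apply (lt_INR 0); lia).
  assert (Hm2 : INR (m + 2) = INR (m + 1) + 1) by (rewrite !plus_INR; simpl; ring).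
  assert (HI : wallis 0 m - wallis 0 (m + 2) = wallis 0 (m + 2) / INR (m + 1)).
  { rewrite Hm2 in Hrec.
    assert (Hw : wallis 0 m = (INR (m + 1) + 1) / INR (m + 1) * wallis 0 (m + 2)).
    { apply Rmult_eq_reg_l with ((INR (m + 1) + 1) * INR (m + 1)); [| nra].
      rewrite <- Hrec. field. lra. }
    rewrite Hw. field. lra. }
  rewrite <- HI.
  assert (E1 : ex_RInt (fun t => cos t ^ m * sin t ^ 2) 0 (PI / 2)).
  { apply ex_RInt_of_ex_derive. intros x. auto_derive. easy. }
  assert (H1 : wallis 0 m - wallis 0 (m + 2) = RInt (fun t => cos t ^ m * sin t ^ 2) 0 (PI / 2)).
  { unfold wallis. change minus with Rminus.
    rewrite <- (RInt_minus (V:=R_CompleteNormedModule)) by apply ex_RInt_wallis.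
    apply RInt_ext. intros x _. unfold minus, plus, opp; simpl.
    rewrite Rmult_0_l, cos_0, pow_add. pose proof (sin2_cos2 x) as H. unfold Rsqr in H.
    replace (sin x * (sin x * 1)) with (1 - cos x * cos x) by lra. R_eq. ring. }
  rewrite H1.
  assert (E2 : ex_RInt (fun t => cos (al * t) * cos t ^ (m + 2) - cos (0 * t) * cos t ^ (m + 2)) 0 (PI / 2)).
  { apply ex_RInt_of_ex_derive. intros x. auto_derive. easy. }
  replace (wallis al (m + 2) - wallis 0 (m + 2)) with
    (RInt (fun t => cos (al * t) * cos t ^ (m + 2) - cos (0 * t) * cos t ^ (m + 2)) 0 (PI / 2)).
  2: { unfold wallis. rewrite (RInt_minus (V:=R_CompleteNormedModule)) by apply ex_RInt_wallis. reflexivity. }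
  eapply Rle_trans; [apply abs_RInt_le; [lra | exact E2] |].
  replace (al ^ 2 / 2 * RInt (fun t => cos t ^ m * sin t ^ 2) 0 (PI / 2)) with
    (RInt (fun t => al ^ 2 / 2 * (cos t ^ m * sin t ^ 2)) 0 (PI / 2)).
  2: { rewrite (RInt_scal (V:=R_CompleteNormedModule)) by exact E1. reflexivity. }
  apply RInt_le.
  - lra.
  - apply ex_RInt_norm; exact E2.
  - apply (ex_RInt_scal (V:=R_NormedModule)); exact E1.
  - intros t Ht. rewrite Rmult_0_l, cos_0.
    replace (_ - _) with (- ((1 - cos (al * t)) * cos t ^ (m + 2))) by ring.
    assert (Hc : 0 <= cos t) by (apply cos_ge_0; lra).
    pose proof (one_minus_cos_bound (al * t)) as Hb.
    pose proof (mul_cos_le_sin t ltac:(lra)) as Hs.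
    assert (Hcm : 0 <= cos t ^ m) by (now apply pow_le).
    rewrite Rabs_Ropp, Rabs_pos_eq by (apply Rmult_le_pos; [lra | now apply pow_le]).
    apply Rle_trans with ((al * t) ^ 2 / 2 * cos t ^ (m + 2)).
    apply Rmult_le_compat_r. now apply pow_le. lra.
    rewrite pow_add.
    replace ((al * t) ^ 2 / 2 * (cos t ^ m * cos t ^ 2)) with
      (al ^ 2 / 2 * (cos t ^ m * (t * cos t) ^ 2)) by field.
    apply Rmult_le_compat_l. nra. apply Rmult_le_compat_l; auto.
    apply pow_incr. split; auto. apply Rmult_le_pos; lra.
Qed.

Lemma one_minus_sq_div_pos (u : R) (n : nat) : 0 <= u < 1 -> 0 < 1 - u ^ 2 / INR (S n) ^ 2.
Proof.
  intros Hu. assert (H : 1 <= INR (S n)) by (apply (le_INR 1); lia).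
  assert (u ^ 2 / INR (S n) ^ 2 < 1); [| lra].
  apply Rlt_div_l. nra. nra.
Qed.

(** Taking [al = 2 * u] and even exponents turns the recurrence for the ratio [rho] into
    multiplication by the factors [1 - u^2 / m^2]. The logarithms telescope between [rho 0], which
    is the sine quotient, and the limit 1. *)
Lemma ln_sine_product (u : R) : 0 < u < 1 ->
  is_series (fun n => - ln (1 - u ^ 2 / INR (S n) ^ 2))
    (- ln (sin (PI * u) / (PI * u))).
Proof.
  intros Hu. assert (Hpi := PI_RGT_0).
  set (rho := fun m => wallis (2 * u) (2 * m) / wallis 0 (2 * m)).
  assert (Hrec : forall m, rho m = rho (S m) * (1 - u ^ 2 / INR (S m) ^ 2)).
  { intros m. unfold rho. replace (2 * S m)%nat with (2 * m + 2)%nat by lia.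
    pose proof (wallis_rec (2 * u) (2 * m)) as R1. pose proof (wallis_rec 0 (2 * m)) as R2.
    pose proof (wallis_0_pos (2 * m)). pose proof (wallis_0_pos (2 * m + 2)).
    replace (INR (2 * m + 2)) with (2 * INR (S m)) in R1, R2
      by (rewrite S_INR, plus_INR, mult_INR; simpl; ring).
    assert (HS : 1 <= INR (S m)) by (apply (le_INR 1); lia).
    assert (HS2 : 1 <= INR (2 * m + 1)) by (apply (le_INR 1); lia).
    set (k := INR (S m)) in *. set (j := INR (2 * m + 1)) in *.
    set (A := wallis (2 * u) (2 * m)) in *. set (B := wallis (2 * u) (2 * m + 2)) in *.
    set (A0 := wallis 0 (2 * m)) in *. set (B0 := wallis 0 (2 * m + 2)) in *.
    assert (EA : A = 2 * (k ^ 2 - u ^ 2) / (k * j) * B).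
    { apply Rmult_eq_reg_l with (2 * k * j); [| nra]. rewrite <- R1. field. lra. }
    assert (EA0 : A0 = 2 * k ^ 2 / (k * j) * B0).
    { apply Rmult_eq_reg_l with (2 * k * j); [| nra]. rewrite <- R2. field. lra. }
    rewrite EA, EA0. field. repeat split; lra. }
  assert (Hr0 : rho O = sin (PI * u) / (PI * u)).
  { unfold rho. simpl Nat.mul.
    assert (H1 : wallis (2 * u) 0 = sin (PI * u) / (2 * u)).
    { unfold wallis. apply (is_RInt_unique (V:=R_CompleteNormedModule)).
      replace (sin (PI * u) / (2 * u)) with
        (sin (2 * u * (PI / 2)) / (2 * u) - sin (2 * u * 0) / (2 * u)).
      2: { rewrite Rmult_0_r, sin_0. replace (2 * u * (PI / 2)) with (PI * u) by field. field. lra. }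
      apply (is_RInt_derive (V:=R_CompleteNormedModule) (fun t => sin (2 * u * t) / (2 * u))).
      - intros t _. auto_derive. lra. simpl. field. lra.
      - intros t _. apply continuous_of_ex_derive. auto_derive. easy. }
    assert (H2 : wallis 0 0 = PI / 2).
    { rewrite wallis_0_l. simpl. rewrite RInt_const. unfold scal; simpl. unfold mult; simpl. ring. }
    rewrite H1, H2. field. lra. }
  assert (Hs0 : 0 < sin (PI * u)) by (apply sin_gt_0; nra).
  assert (Hr0pos : 0 < rho O) by (rewrite Hr0; apply Rdiv_lt_0_compat; nra).
  assert (Hpos : forall m, 0 < rho m).
  { induction m as [|m IH]; auto. rewrite Hrec in IH.
    pose proof (one_minus_sq_div_pos u m ltac:(lra)). nra. }
  assert (Hsum : forall N, sum_n (fun n => - ln (1 - u ^ 2 / INR (S n) ^ 2)) N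
      = - ln (rho O) + ln (rho (S N))).
  { induction N as [|N IH].
    - rewrite sum_O, (Hrec O), ln_mult. R_eq. ring. apply Hpos.
      apply one_minus_sq_div_pos. lra.
    - rewrite Rsum_Sn, IH, (Hrec (S N)), ln_mult. R_eq. ring. apply Hpos.
      apply one_minus_sq_div_pos. lra. }
  assert (Hlim : is_lim_seq (fun N => rho (S N)) 1).
  { apply is_lim_seq_le_le with
      (fun N => 1 - 2 * u ^ 2 * / INR (2 * N + 1)) (fun N => 1 + 2 * u ^ 2 * / INR (2 * N + 1)).
    - intros N. unfold rho. replace (2 * S N)%nat with (2 * N + 2)%nat by lia.
      pose proof (wallis_close (2 * u) (2 * N)) as H.
      pose proof (wallis_0_pos (2 * N + 2)) as Hp.
      assert (Hi : 0 < / INR (2 * N + 1)) by (apply Rinv_0_lt_compat, (lt_INR 0); lia).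
      set (A := wallis (2 * u) (2 * N + 2)) in *. set (B := wallis 0 (2 * N + 2)) in *.
      apply Rabs_le_between in H. unfold Rdiv in H.
      set (i := / INR (2 * N + 1)) in *.
      replace ((2 * u) ^ 2 * / 2 * (B * i)) with (2 * u ^ 2 * i * B) in H by field.
      split.
      + apply Rle_div_r; lra.
      + apply Rle_div_l; lra.
    - replace (Finite 1) with (Finite (1 - 2 * u ^ 2 * 0)) by (f_equal; ring).
      apply is_lim_seq_minus'. apply is_lim_seq_const.
      apply (is_lim_seq_scal_l _ _ 0).
      replace (Finite 0) with (Rbar_inv p_infty) by reflexivity.
      apply is_lim_seq_inv; [| easy].
      apply (is_lim_seq_subseq INR). apply eventually_subseq; intros; lia.
      apply is_lim_seq_INR.
    - replace (Finite 1) with (Finite (1 + 2 * u ^ 2 * 0)) by (f_equal; ring).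
      apply is_lim_seq_plus'. apply is_lim_seq_const.
      apply (is_lim_seq_scal_l _ _ 0).
      replace (Finite 0) with (Rbar_inv p_infty) by reflexivity.
      apply is_lim_seq_inv; [| easy].
      apply (is_lim_seq_subseq INR). apply eventually_subseq; intros; lia.
      apply is_lim_seq_INR. }
  rewrite <- Hr0.
  assert (HL : is_lim_seq (fun N => - ln (rho O) + ln (rho (S N))) (- ln (rho O))).
  { replace (Finite (- ln (rho O))) with (Finite (- ln (rho O) + ln 1)) by (rewrite ln_1; f_equal; ring).
    apply is_lim_seq_plus'. apply is_lim_seq_const.
    apply is_lim_seq_continuous; auto. apply continuity_pt_of_ex_derive. auto_derive. lra. }
  apply is_lim_seq_ext with (2 := HL). intros n. now rewrite Hsum.
Qed.

(** * The logarithmic series and the zeta values *)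

Lemma ln_one_minus_partial (x : R) (N : nat) : 0 <= x < 1 ->
  0 <= - ln (1 - x) - sum_n (fun k => x ^ (k + 1) / INR (k + 1)) N
    <= x ^ (N + 1) * (x / (1 - x)).
Proof.
  intros Hx.
  destruct (MVT_gen (fun x => - ln (1 - x) - sum_n (fun k => x ^ (k + 1) / INR (k + 1)) N)
     0 x (fun x => x ^ (N + 1) / (1 - x))) as [c [Hc E]].
  - intros y Hy. rewrite Rmin_left, Rmax_right in Hy by lra.
    replace (y ^ (N + 1) / (1 - y)) with (/ (1 - y) - sum_n (fun k => y ^ k) N).
    2: { assert (HG : sum_n (fun k => y ^ k) N = (1 - y ^ (N + 1)) / (1 - y)).
         { clear -Hy Hx. induction N as [|N IH].
           - rewrite sum_O. simpl. field. lra.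
           - rewrite sum_Sn, IH. unfold plus; simpl plus. simpl pow.
             R_eq. rewrite !pow_add. simpl. field. lra. }
         rewrite HG. field. lra. }
    apply (is_derive_minus (V:=R_NormedModule)).
    + auto_derive. lra. field. lra.
    + apply (is_derive_sum_n (K:=R_AbsRing) (V:=R_NormedModule)
        (fun k y => y ^ (k + 1) / INR (k + 1)) N y (fun k => y ^ k)).
      intros k _. auto_derive. easy.
      replace (Init.Nat.pred (k + 1)) with k by lia.
      rewrite plus_INR. simpl. field. pose proof (pos_INR k). lra.
  - intros y Hy. rewrite Rmin_left, Rmax_right in Hy by lra.
    apply continuity_pt_of_ex_derive.
    apply (ex_derive_minus (V:=R_NormedModule)).
    + auto_derive. lra.
    + apply (ex_derive_sum_n (K:=R_AbsRing) (V:=R_NormedModule)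
        (fun k y => y ^ (k + 1) / INR (k + 1)) N y).
      intros k _. auto_derive. easy.
  - rewrite Rmin_left, Rmax_right in Hc by lra.
    replace (1 - 0) with 1 in E by ring. rewrite ln_1 in E.
    assert (Hz : sum_n (fun k => 0 ^ (k + 1) / INR (k + 1)) N = 0).
    { clear. induction N as [|N IH].
      - rewrite sum_O. simpl. field.
      - rewrite sum_Sn, IH. unfold plus; simpl. unfold Rdiv. ring. }
    rewrite Hz in E. rewrite !Rminus_0_r, Ropp_0, Rminus_0_r in E. rewrite E.
    assert (H1 : 0 <= c ^ (N + 1) <= x ^ (N + 1)).
    { split. apply pow_le; lra. apply pow_incr; lra. }
    assert (H2 : 0 < / (1 - c) <= / (1 - x)).
    { split. apply Rinv_0_lt_compat; lra. apply Rinv_le_contravar; lra. }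
    split.
    + apply Rmult_le_pos; [apply Rmult_le_pos |]; lra.
    + replace (x ^ (N + 1) * (x / (1 - x))) with (x ^ (N + 1) * / (1 - x) * x) by (unfold Rdiv; ring).
      apply Rmult_le_compat_r; [lra |]. apply Rmult_le_compat; lra.
Qed.

Lemma is_series_ln_one_minus (x : R) : 0 <= x < 1 ->
  is_series (fun k => x ^ (k + 1) / INR (k + 1)) (- ln (1 - x)).
Proof.
  intros Hx.
  set (S := sum_n (fun k => x ^ (k + 1) / INR (k + 1))).
  change (is_lim_seq S (- ln (1 - x))).
  apply is_lim_seq_le_le with
    (fun N => - ln (1 - x) - x ^ (N + 1) * (x / (1 - x))) (fun _ => - ln (1 - x)).
  - intros N. pose proof (ln_one_minus_partial x N Hx). fold S in H. lra.
  - replace (Finite (- ln (1 - x))) with (Finite (- ln (1 - x) - 0 * (x / (1 - x)))) by (f_equal; ring).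
    apply is_lim_seq_minus'. apply is_lim_seq_const.
    apply (is_lim_seq_scal_r _ _ 0).
    apply (is_lim_seq_incr_n (fun n => x ^ n) 1).
    apply is_lim_seq_geom. rewrite Rabs_pos_eq; lra.
  - apply is_lim_seq_const.
Qed.

(** Meaningful for [2 <= m]; for smaller [m] the series diverges and [Series] returns a default
    value. *)
Definition zeta_sum (m : nat) : R := Series (fun n => / INR (S n) ^ m).

Lemma inv_pow_telescope (n : nat) :
  / INR (S (S n)) ^ 2 <= / INR (S n) - / INR (S (S n)).
Proof.
  rewrite (S_INR (S n)). assert (H : 1 <= INR (S n)) by (apply (le_INR 1); lia).
  set (x := INR (S n)) in *.
  replace (/ x - / (x + 1)) with (/ (x * (x + 1))) by (field; lra).
  apply Rinv_le_contravar; nra.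
Qed.

Lemma inv_pow_pos (m n : nat) : 0 < / INR (S n) ^ m.
Proof. apply Rinv_0_lt_compat, pow_lt, (lt_INR 0). lia. Qed.

Lemma ex_series_inv_square : ex_series (fun n => / INR (S n) ^ 2).
Proof.
  apply (series_nonneg_bounded _ 2).
  - intros n. apply Rlt_le, inv_pow_pos.
  - assert (H : forall N, sum_n (fun n => / INR (S n) ^ 2) N <= 2 - / INR (S N)).
    { induction N as [|N IH].
      - rewrite sum_O. simpl. lra.
      - rewrite Rsum_Sn. pose proof (inv_pow_telescope N). lra. }
    intros N. specialize (H N). pose proof (inv_pow_pos 1 N) as Hp. rewrite pow_1 in Hp. lra.
Qed.

Lemma inv_pow_le_inv_square (m n : nat) : (2 <= m)%nat ->
  / INR (S n) ^ m <= / INR (S n) ^ 2.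
Proof.
  intros Hm. assert (H : 1 <= INR (S n)) by (apply (le_INR 1); lia).
  apply Rinv_le_contravar. apply pow_lt; lra. now apply Rle_pow.
Qed.

Lemma is_series_zeta_sum (m : nat) : (2 <= m)%nat ->
  is_series (fun n => / INR (S n) ^ m) (zeta_sum m).
Proof.
  intros Hm. apply Series_correct.
  apply ex_series_dominated with (2 := ex_series_inv_square).
  intros n. rewrite Rabs_pos_eq by apply Rlt_le, inv_pow_pos. now apply inv_pow_le_inv_square.
Qed.

Lemma zeta_sum_bounds (m : nat) : (2 <= m)%nat -> 1 <= zeta_sum m <= 2.
Proof.
  intros Hm. assert (Hs := is_series_zeta_sum m Hm). split.
  - apply Rle_trans with (sum_n (fun n => / INR (S n) ^ m) 0).
    + rewrite sum_O. simpl INR. rewrite pow1. lra.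
    + apply sum_n_le_Series. intros; apply Rlt_le, inv_pow_pos. eexists; exact Hs.
  - apply (series_nonneg_bounded (fun n => / INR (S n) ^ m) 2).
    + intros n. apply Rlt_le, inv_pow_pos.
    + assert (H : forall N, sum_n (fun n => / INR (S n) ^ m) N <= 2 - / INR (S N)).
      { induction N as [|N IH].
        - rewrite sum_O. simpl INR. rewrite pow1. lra.
        - rewrite Rsum_Sn. pose proof (inv_pow_telescope N).
          pose proof (inv_pow_le_inv_square m (S N) Hm). lra. }
      intros N. specialize (H N). pose proof (inv_pow_pos 1 N) as Hp. rewrite pow_1 in Hp. lra.
Qed.

(** Each logarithm of the product is expanded in powers of [x n], and the double series is summed
    the other way. All terms are nonnegative, so the full logarithms, whose series converges by
    [ln_sine_product], dominate their partial sums. *)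
Lemma ln_sinc_zeta_series (u : R) : 0 < u < 1 ->
  is_series (fun k => zeta_sum (2 * (k + 1)) * u ^ (2 * (k + 1)) / INR (k + 1))
    (- ln (sin (PI * u) / (PI * u))).
Proof.
  intros Hu.
  set (x := fun n => u ^ 2 / INR (S n) ^ 2).
  assert (Hx : forall n, 0 <= x n < 1).
  { intros n. pose proof (one_minus_sq_div_pos u n ltac:(lra)). split.
    apply Rmult_le_pos. nra. apply Rlt_le, inv_pow_pos. unfold x. lra. }
  assert (Hpart : forall n J, 0 <= sum_n (fun k => x n ^ (k + 1) / INR (k + 1)) J <= - ln (1 - x n)).
  { intros n J. split.
    - apply sum_n_nonneg. intros k. apply Rmult_le_pos. apply pow_le, Hx.
      apply Rlt_le, Rinv_0_lt_compat, (lt_INR 0). lia.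
    - pose proof (ln_one_minus_partial (x n) J (Hx n)). lra. }
  pose proof (ln_sine_product u Hu) as HP.
  destruct (tannery (fun n J => sum_n (fun k => x n ^ (k + 1) / INR (k + 1)) J)
    (fun n => - ln (1 - x n)) (fun n => - ln (1 - x n))) as [_ HT].
  - intros n J. rewrite Rabs_pos_eq; apply Hpart.
  - eexists; exact HP.
  - intros n. exact (is_series_ln_one_minus (x n) (Hx n)).
  - unfold x in HT at 2. rewrite (is_series_unique _ _ HP) in HT.
    apply is_lim_seq_ext with (2 := HT). intros J. apply is_series_unique.
    induction J as [|J IH].
    + rewrite sum_O. apply is_series_ext with (fun n => (u ^ 2 / INR 1) * / INR (S n) ^ 2).
      * intros n. rewrite sum_O. R_eq. unfold x. simpl. field.
        apply (not_INR (S n) 0). lia.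
      * replace (zeta_sum (2 * (0 + 1)) * u ^ (2 * (0 + 1)) / INR (0 + 1))
          with (u ^ 2 / INR 1 * zeta_sum 2)
          by (change (2 * (0 + 1))%nat with 2%nat; simpl; field).
        apply is_series_Rmult_l. apply is_series_zeta_sum. lia.
    + rewrite sum_Sn.
      pose proof (is_series_Rmult_l (u ^ (2 * (S J + 1)) / INR (S J + 1)) _ _
        (is_series_zeta_sum (2 * (S J + 1)) ltac:(lia))) as HS.
      replace (zeta_sum (2 * (S J + 1)) * u ^ (2 * (S J + 1)) / INR (S J + 1)) with
        (u ^ (2 * (S J + 1)) / INR (S J + 1) * zeta_sum (2 * (S J + 1))) by (unfold Rdiv; ring).
      apply is_series_ext with (2 := is_series_Rplus _ _ _ _ IH HS).
      intros n. rewrite Rsum_Sn. R_eq. unfold x.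
      rewrite !(pow_mult _ 2). unfold Rdiv. rewrite Rpow_mult_distr, pow_inv. ring.
Qed.

(** * The Fourier series of the logarithm of the sine *)

Definition log_cos_sum (N : nat) (t : R) : R :=
  sum_n (fun n => cos (INR (S n) * t) / INR (S n)) N.

(** Each product is a difference of two cosines, and the sum telescopes: the conjugate Dirichlet
    kernel. *)
Lemma sum_n_sin (N : nat) (t : R) :
  sum_n (fun n => sin (INR (S n) * t)) N * (2 * sin (t / 2))
    = cos (t / 2) - cos ((2 * INR N + 3) * (t / 2)).
Proof.
  assert (H : forall A B, sin A * (2 * sin B) = cos (A - B) - cos (A + B)).
  { intros A B. rewrite cos_minus, cos_plus. ring. }
  induction N as [|N IH].
  - rewrite sum_O, H. simpl INR. f_equal; f_equal; field.
  - rewrite Rsum_Sn, Rmult_plus_distr_r, IH, H.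
    replace (INR (S (S N)) * t - t / 2) with ((2 * INR N + 3) * (t / 2))
      by (rewrite !S_INR; field).
    replace (INR (S (S N)) * t + t / 2) with ((2 * INR (S N) + 3) * (t / 2))
      by (rewrite !S_INR; field). ring.
Qed.

Lemma INR_S_neq_0 (n : nat) : INR (S n) <> 0.
Proof. apply not_0_INR. discriminate. Qed.

Lemma is_derive_log_cos_sum (N : nat) (t : R) :
  is_derive (log_cos_sum N) t (- sum_n (fun n => sin (INR (S n) * t)) N).
Proof.
  unfold log_cos_sum.
  replace (- sum_n (fun n => sin (INR (S n) * t)) N)
    with (sum_n (fun n => - sin (INR (S n) * t)) N).
  - apply (is_derive_sum_n (K:=R_AbsRing) (V:=R_NormedModule)
      (fun n t => cos (INR (S n) * t) / INR (S n)) N t (fun n => - sin (INR (S n) * t))).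
    intros k _. set (x := INR (S k)). assert (Hx := INR_S_neq_0 k). fold x in Hx.
    auto_derive; [easy |]. field. exact Hx.
  - induction N as [|N IH].
    + now rewrite !sum_O.
    + rewrite !Rsum_Sn, IH. R_eq. ring.
Qed.

(** At [PI] the cosines are alternating signs, so this is the alternating harmonic series with an
    error bound. It fixes the constant when the derivative of [log_cos_sum] is integrated from
    [PI]. *)
Lemma log_cos_sum_PI (N : nat) :
  Rabs (log_cos_sum N PI + ln 2) <= / INR (N + 2).
Proof.
  assert (Hcos : forall n, cos (INR n * PI) = (-1) ^ n).
  { induction n as [|n IH].
    - simpl. rewrite Rmult_0_l. apply cos_0.
    - rewrite S_INR, Rmult_plus_distr_r, Rmult_1_l, neg_cos, IH. simpl. ring. }
  set (f := fun x => ln (1 + x) + sum_n (fun n => (- x) ^ (n + 1) / INR (n + 1)) N).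
  set (g := fun x => x ^ (N + 2) / INR (N + 2)).
  assert (HN : 0 < INR (N + 2)) by (apply (lt_INR 0); lia).
  assert (Hf : forall x, 0 <= x <= 1 -> is_derive f x ((- x) ^ (N + 1) / (1 + x))).
  { intros x Hx. unfold f.
    replace ((- x) ^ (N + 1) / (1 + x)) with (/ (1 + x) + sum_n (fun n => - (- x) ^ n) N).
    - apply (is_derive_plus (V:=R_NormedModule)).
      + auto_derive. lra. field. lra.
      + apply (is_derive_sum_n (K:=R_AbsRing) (V:=R_NormedModule)
          (fun n x => (- x) ^ (n + 1) / INR (n + 1)) N x (fun n => - (- x) ^ n)).
        intros k _. auto_derive. easy. replace (Init.Nat.pred (k + 1)) with k by lia.
        rewrite plus_INR. simpl. field. pose proof (pos_INR k). lra.
    - assert (HG : sum_n (fun n => - (- x) ^ n) N = ((- x) ^ (N + 1) - 1) / (1 + x)).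
      { clear -Hx. induction N as [|N IH].
        - rewrite sum_O. simpl. field. lra.
        - rewrite Rsum_Sn, IH. replace (S N + 1)%nat with (S (N + 1)) by lia.
          rewrite !pow_add. simpl. rewrite !pow_add. simpl. field. lra. }
      rewrite HG. field. lra. }
  assert (Hg : forall x, is_derive g x (x ^ (N + 1))).
  { intros x. unfold g. auto_derive. easy.
    replace (Init.Nat.pred (N + 2)) with (N + 1)%nat by lia. field. lra. }
  assert (Hfg : forall x, 0 <= x <= 1 -> Rabs ((- x) ^ (N + 1) / (1 + x)) <= x ^ (N + 1)).
  { intros x Hx. assert (Hp : 0 <= x ^ (N + 1)) by (apply pow_le; lra).
    unfold Rdiv. rewrite Rabs_mult, <- RPow_abs, Rabs_Ropp, (Rabs_pos_eq x) by lra.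
    rewrite (Rabs_pos_eq (/ _)) by (left; apply Rinv_0_lt_compat; lra).
    rewrite <- (Rmult_1_r (x ^ (N + 1))) at 2. apply Rmult_le_compat_l; auto.
    rewrite <- Rinv_1 at 2. apply Rinv_le_contravar; lra. }
  assert (Hf0 : f 0 = 0).
  { unfold f. rewrite Rplus_0_r, ln_1, Rplus_0_l. clear. induction N as [|N IH].
    - rewrite sum_O. simpl. field.
    - rewrite Rsum_Sn, IH. simpl. rewrite pow_add. simpl. unfold Rdiv. ring. }
  assert (Hg0 : g 0 = 0) by (unfold g; rewrite pow_i by lia; unfold Rdiv; ring).
  assert (Hg1 : g 1 = / INR (N + 2)) by (unfold g; rewrite pow1; unfold Rdiv; ring).
  assert (Hf1 : f 1 = log_cos_sum N PI + ln 2).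
  { unfold f, log_cos_sum. replace (1 + 1) with 2 by ring. rewrite Rplus_comm. f_equal.
    apply sum_n_ext. intros n. rewrite Hcos. now replace (n + 1)%nat with (S n) by lia. }
  rewrite <- Hf1, <- Hg1.
  (* By [Hfg], [f - g] does not increase and [f + g] does not decrease on [[0, 1]]; both vanish at
     0, so [Rabs (f 1) <= g 1]. *)
  destruct (MVT_gen (fun x => f x - g x) 0 1 (fun x => (- x) ^ (N + 1) / (1 + x) - x ^ (N + 1)))
    as [c [Hc E]].
  { intros x Hx. rewrite Rmin_left, Rmax_right in Hx by lra.
    apply (is_derive_minus (V:=R_NormedModule)); [apply Hf; lra | apply Hg]. }
  { intros x Hx. rewrite Rmin_left, Rmax_right in Hx by lra. apply continuity_pt_of_ex_derive.
    eexists. apply (is_derive_minus (V:=R_NormedModule)); [apply Hf; lra | apply Hg]. }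
  destruct (MVT_gen (fun x => f x + g x) 0 1 (fun x => (- x) ^ (N + 1) / (1 + x) + x ^ (N + 1)))
    as [d [Hd E']].
  { intros x Hx. rewrite Rmin_left, Rmax_right in Hx by lra.
    apply (is_derive_plus (V:=R_NormedModule)); [apply Hf; lra | apply Hg]. }
  { intros x Hx. rewrite Rmin_left, Rmax_right in Hx by lra. apply continuity_pt_of_ex_derive.
    eexists. apply (is_derive_plus (V:=R_NormedModule)); [apply Hf; lra | apply Hg]. }
  rewrite Rmin_left, Rmax_right in Hc, Hd by lra.
  pose proof (Hfg c Hc) as Bc. pose proof (Hfg d Hd) as Bd.
  apply Rabs_le_between in Bc. apply Rabs_le_between in Bd.
  apply Rabs_le. rewrite Hf0, Hg0 in E, E'. lra.
Qed.

Lemma sin_half_ge (a t : R) : 0 < a <= PI -> a <= t <= 2 * PI - a ->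
  sin (a / 2) <= sin (t / 2).
Proof.
  intros Ha Ht. destruct (Rle_lt_dec t PI).
  - apply sin_incr_1; lra.
  - rewrite <- (sin_PI_x (t / 2)). apply sin_incr_1; lra.
Qed.

(* The antiderivative of the conjugate Dirichlet kernel, minus its oscillating
   part, has derivative [O(1/N)]. *)
Lemma log_cos_sum_uniform (a : R) : 0 < a <= PI ->
  exists K, forall N t, a <= t <= 2 * PI - a ->
    Rabs (log_cos_sum N t - - ln (2 * sin (t / 2))) <= K * / INR (N + 1).
Proof.
  intros Ha. assert (Hpi := PI_RGT_0).
  set (d := sin (a / 2)).
  assert (Hd : 0 < d) by (apply sin_gt_0; lra).
  (* [PI / d ^ 2]: variation of [w] between [PI] and [t]. [/ d]: oscillating term at [t]. [2]:
     oscillating term at [PI], and the error of [log_cos_sum_PI]. *)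
  exists (PI / d ^ 2 + / d + 2). intros N t Ht.
  set (M := 2 * INR N + 3).
  assert (HN1 : 0 < INR (N + 1)) by (apply (lt_INR 0); lia).
  assert (HNr : INR (N + 1) = INR N + 1) by (rewrite plus_INR; simpl; ring).
  assert (HM : INR (N + 1) <= M) by (unfold M; pose proof (pos_INR N); lra).
  (* By [sum_n_sin], the derivative of [log_cos_sum N] has a non-oscillating part, cancelled by that
     of the logarithm, and a part in [cos (M * (t / 2))], cancelled by the last term. What is left,
     [w'], has [M] in its denominator. *)
  set (w := fun t => log_cos_sum N t + ln (sin (t / 2)) - sin (M * (t / 2)) / (M * sin (t / 2))).
  set (w' := fun t => sin (M * (t / 2)) * cos (t / 2) / (2 * M * sin (t / 2) ^ 2)).
  assert (Hs : forall x, a <= x <= 2 * PI - a -> d <= sin (x / 2)).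
  { intros x Hx. now apply sin_half_ge. }
  assert (Hw : forall x, a <= x <= 2 * PI - a -> is_derive w x (w' x)).
  { intros x Hx. pose proof (Hs x Hx) as Hsx. unfold w.
    apply is_derive_ext with (fun t => log_cos_sum N t +
      (ln (sin (t / 2)) - sin (M * (t / 2)) / (M * sin (t / 2)))).
    { intros y. R_eq. ring. }
    pose proof (sum_n_sin N x) as HS. fold M in HS.
    set (Sg := sum_n (fun n => sin (INR (S n) * x)) N) in *.
    replace (w' x) with (- Sg + (cos (x / 2) / (2 * sin (x / 2)) -
      (cos (M * (x / 2)) / (2 * sin (x / 2)) - w' x))).
    - apply (is_derive_plus (V:=R_NormedModule)). apply is_derive_log_cos_sum.
      unfold w'. auto_derive.
      + repeat split; try lra. unfold Rdiv in *. nra.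
      + unfold Rdiv in *. field. split; lra.
    - replace Sg with ((cos (x / 2) - cos (M * (x / 2))) / (2 * sin (x / 2)))
        by (rewrite <- HS; field; lra). field. lra. }
  assert (Hw' : forall x, a <= x <= 2 * PI - a -> Rabs (w' x) <= / (d ^ 2 * INR (N + 1))).
  { intros x Hx. pose proof (Hs x Hx) as Hsx. unfold w'.
    unfold Rdiv. rewrite !Rabs_mult.
    assert (H1 : Rabs (sin (M * (x * / 2))) <= 1) by (apply Rabs_le, SIN_bound).
    assert (H2 : Rabs (cos (x * / 2)) <= 1) by (apply Rabs_le, COS_bound).
    pose proof (Rabs_pos (sin (M * (x * / 2)))). pose proof (Rabs_pos (cos (x * / 2))).
    assert (Hd2 : d ^ 2 <= sin (x / 2) ^ 2) by (apply pow_incr; lra).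
    assert (H3 : 0 < d ^ 2) by (apply pow_lt; auto).
    rewrite (Rabs_pos_eq (/ _)).
    2: { left. apply Rinv_0_lt_compat. unfold Rdiv in *. nra. }
    rewrite <- (Rmult_1_l (/ (d ^ 2 * _))).
    apply Rmult_le_compat.
    - apply Rmult_le_pos; auto.
    - left. apply Rinv_0_lt_compat. unfold Rdiv in *. nra.
    - nra.
    - apply Rinv_le_contravar. nra. unfold Rdiv in *. nra. }
  assert (Hosc : forall x, a <= x <= 2 * PI - a ->
     Rabs (sin (M * (x / 2)) / (M * sin (x / 2))) <= / d * / INR (N + 1)).
  { intros x Hx. pose proof (Hs x Hx) as Hsx. unfold Rdiv at 1. rewrite Rabs_mult.
    assert (H1 : Rabs (sin (M * (x / 2))) <= 1) by (apply Rabs_le, SIN_bound).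
    rewrite (Rabs_pos_eq (/ _)) by (left; apply Rinv_0_lt_compat; nra).
    rewrite <- Rinv_mult, <- (Rmult_1_l (/ (d * _))).
    apply Rmult_le_compat; auto using Rabs_pos.
    left; apply Rinv_0_lt_compat; nra.
    apply Rinv_le_contravar; nra. }
  assert (Hpi_in : a <= PI <= 2 * PI - a) by lra.
  assert (Hdiff : Rabs (w t - w PI) <= / (d ^ 2 * INR (N + 1)) * PI).
  { assert (Hmm : forall x, Rmin PI t <= x <= Rmax PI t -> a <= x <= 2 * PI - a).
    { intros x Hx. pose proof (Rmin_glb PI t a ltac:(lra) ltac:(lra)).
      pose proof (Rmax_lub PI t (2 * PI - a) ltac:(lra) ltac:(lra)). lra. }
    destruct (MVT_gen w PI t w') as [c [Hc E]].
    - intros x Hx. apply Hw, Hmm. lra.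
    - intros x Hx. apply continuity_pt_of_ex_derive. eexists. apply Hw, Hmm. lra.
    - rewrite E, Rabs_mult. apply Rmult_le_compat; auto using Rabs_pos.
      apply Rabs_le. lra. }
  pose proof (Hosc t Ht) as O1. pose proof (Hosc PI Hpi_in) as O2.
  pose proof (log_cos_sum_PI N) as HP.
  pose proof (Hs t Ht) as Hst.
  rewrite ln_mult by lra.
  unfold w in Hdiff. rewrite sin_PI2, ln_1 in Hdiff.
  assert (O3 : Rabs (sin (M * (PI / 2)) / (M * 1)) <= / INR (N + 1)).
  { unfold Rdiv at 1. rewrite Rabs_mult.
    assert (H1 : Rabs (sin (M * (PI / 2))) <= 1) by (apply Rabs_le, SIN_bound).
    rewrite (Rabs_pos_eq (/ _)) by (left; apply Rinv_0_lt_compat; nra).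
    rewrite <- (Rmult_1_l (/ INR (N + 1))).
    apply Rmult_le_compat; auto using Rabs_pos.
    left; apply Rinv_0_lt_compat; nra.
    apply Rinv_le_contravar; nra. }
  assert (HP' : Rabs (log_cos_sum N PI + ln 2) <= / INR (N + 1)).
  { eapply Rle_trans; [exact HP |]. apply Rinv_le_contravar; auto. apply le_INR. lia. }
  rewrite Rinv_mult in Hdiff.
  set (i := / INR (N + 1)) in *.
  replace ((PI / d ^ 2 + / d + 2) * i) with (/ d ^ 2 * i * PI + / d * i + i + i)
    by (field; lra).
  apply Rabs_le_between in Hdiff, O1, O3, HP'. apply Rabs_le. lra.
Qed.

(** * Iterated integrals of the logarithm of the sine *)

Lemma is_lim_seq_of_error (u e : nat -> R) (l : R) :
  (forall N, Rabs (u N - l) <= e N) -> is_lim_seq e 0 -> is_lim_seq u l.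
Proof.
  intros H He. apply is_lim_seq_le_le with (fun N => l - e N) (fun N => l + e N).
  - intros N. specialize (H N). apply Rabs_le_between in H. lra.
  - replace (Finite l) with (Finite (l - 0)) by (f_equal; ring).
    apply is_lim_seq_minus'; auto. apply is_lim_seq_const.
  - replace (Finite l) with (Finite (l + 0)) by (f_equal; ring).
    apply is_lim_seq_plus'; auto. apply is_lim_seq_const.
Qed.

(** Differentiation of a limit, with uniform convergence given by explicit null sequences [e1], [e2]
    instead of the [Lim_seq] of [CVU_Derive]. *)
Lemma is_derive_uniform_limit (F G : nat -> R -> R) (f g : R -> R) (a b : R)
    (e1 e2 : nat -> R) :
  is_lim_seq e1 0 -> is_lim_seq e2 0 ->
  (forall N x, a < x < b -> Rabs (F N x - f x) <= e1 N) ->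
  (forall N x, a < x < b -> Rabs (G N x - g x) <= e2 N) ->
  (forall N x, a < x < b -> is_derive (F N) x (G N x)) ->
  (forall N x, a < x < b -> continuous (G N) x) ->
  forall x, a < x < b -> is_derive f x (g x).
Proof.
  intros H1 H2 HF HG HD HC.
  set (D := fun x => a < x < b).
  assert (HDo : open D).
  { apply open_and. apply open_gt. apply open_lt. }
  assert (LF : forall x, D x -> Lim_seq (fun n => F n x) = f x).
  { intros x Hx. apply is_lim_seq_unique. apply is_lim_seq_of_error with e1; auto. }
  assert (DG : forall n x, D x -> Derive (F n) x = G n x).
  { intros n x Hx. apply is_derive_unique, HD, Hx. }
  assert (LG : forall x, D x -> Lim_seq (fun n => Derive (F n) x) = g x).
  { intros x Hx. apply is_lim_seq_unique. apply is_lim_seq_of_error with e2; auto.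
    intros N. rewrite DG; auto. }
  assert (HE : forall e, is_lim_seq e 0 -> forall eps : posreal,
     Hierarchy.eventually (fun n => e n < eps)).
  { intros e He eps. apply is_lim_seq_spec in He. destruct (He eps) as [N HN].
    exists N. intros n Hn. specialize (HN n Hn). rewrite Rminus_0_r in HN.
    eapply Rle_lt_trans; [apply Rle_abs | exact HN]. }
  intros x Hx.
  assert (H := CVU_Derive F D HDo).
  assert (HR : is_derive (fun y => real (Lim_seq (fun n => F n y))) x
     (real (Lim_seq (fun n => Derive (F n) x)))).
  { apply H; auto.
    - intros u v w Hu Hv Hw. unfold D in *. lra.
    - intros eps. destruct (HE e1 H1 eps) as [N HN]. exists N. intros n Hn y Hy.
      rewrite (LF y Hy). simpl. eapply Rle_lt_trans; [now apply HF | now apply HN].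
    - intros n y Hy. eexists. now apply HD.
    - intros n y Hy. apply continuity_pt_filterlim.
      apply (continuous_ext_loc (U:=R_UniformSpace) (Derive (F n)) (G n) y).
      + destruct (HDo y Hy) as [d Hd]. exists d. intros z Hz. symmetry. now apply DG, Hd.
      + now apply HC.
    - intros eps. destruct (HE e2 H2 eps) as [N HN]. exists N. intros n Hn y Hy.
      rewrite (LG y Hy), DG by auto. simpl.
      eapply Rle_lt_trans; [now apply HG | now apply HN]. }
  rewrite (LG x Hx) in HR.
  apply is_derive_ext_loc with (2 := HR).
  destruct (HDo x Hx) as [d Hd]. exists d. intros z Hz. now rewrite (LF z (Hd z Hz)).
Qed.

Lemma Series_tail_le (a M : nat -> R) (N : nat) :
  (forall n, Rabs (a n) <= M n) -> ex_series M ->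
  Rabs (sum_n a N - Series a) <= Series M - sum_n M N.
Proof.
  intros Ha HM.
  assert (Hex : ex_series a) by (now apply ex_series_dominated with M).
  rewrite (Series_incr_n a (S N)), (Series_incr_n M (S N)) by (auto; lia).
  simpl pred. rewrite <- !sum_n_Reals.
  replace (_ - _) with (- Series (fun k => a (S N + k)%nat)) at 1 by ring.
  replace (_ - _) with (Series (fun k => M (S N + k)%nat)) by ring.
  rewrite Rabs_Ropp. apply Series_Rabs_le. intros n; apply Ha.
  now apply (ex_series_incr_n M).
Qed.

Lemma is_lim_seq_tail (M : nat -> R) :
  ex_series M -> is_lim_seq (fun N => Series M - sum_n M N) 0.
Proof.
  intros HM. replace (Finite 0) with (Finite (Series M - Series M)) by (f_equal; ring).
  apply is_lim_seq_minus'. apply is_lim_seq_const. exact (Series_correct M HM).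
Qed.

Lemma is_derive_sum_n_R (f f' : nat -> R -> R) (N : nat) (x : R) :
  (forall n, is_derive (f n) x (f' n x)) ->
  is_derive (fun y => sum_n (fun n => f n y) N) x (sum_n (fun n => f' n x) N).
Proof.
  intros H.
  apply (is_derive_sum_n (K:=R_AbsRing) (V:=R_NormedModule) f N x (fun n => f' n x)).
  intros; apply H.
Qed.

Lemma continuous_sum_n (f : nat -> R -> R) (N : nat) (x : R) :
  (forall n, continuous (f n) x) -> continuous (fun y => sum_n (fun n => f n y) N) x.
Proof.
  intros H. induction N as [|N IH].
  - apply continuous_ext with (f O); auto. intros y. now rewrite sum_O.
  - apply continuous_ext with (fun y => sum_n (fun n => f n y) N + f (S N) y).
    intros y. now rewrite Rsum_Sn. apply (continuous_plus (V:=R_NormedModule)); auto.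
Qed.

Lemma is_derive_Series (f f' : nat -> R -> R) (M M' : nat -> R) (a b : R) :
  (forall n x, a < x < b -> is_derive (f n) x (f' n x)) ->
  (forall n x, a < x < b -> continuous (f' n) x) ->
  (forall n x, a < x < b -> Rabs (f n x) <= M n) ->
  (forall n x, a < x < b -> Rabs (f' n x) <= M' n) ->
  ex_series M -> ex_series M' ->
  forall x, a < x < b ->
    is_derive (fun y => Series (fun n => f n y)) x (Series (fun n => f' n x)).
Proof.
  intros D C B B' HM HM'.
  apply (is_derive_uniform_limit (fun N x => sum_n (fun n => f n x) N)
    (fun N x => sum_n (fun n => f' n x) N) (fun x => Series (fun n => f n x))
    (fun x => Series (fun n => f' n x)) a b
    (fun N => Series M - sum_n M N) (fun N => Series M' - sum_n M' N)).
  - now apply is_lim_seq_tail.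
  - now apply is_lim_seq_tail.
  - intros N x Hx. apply Series_tail_le; auto.
  - intros N x Hx. apply Series_tail_le; auto.
  - intros N x Hx. apply is_derive_sum_n_R. auto.
  - intros N x Hx. apply continuous_sum_n. auto.
Qed.

(** The phase [m PI / 2] absorbs the alternation of sine and cosine: the derivative of
    [cl_term (S m) n] is exactly [cl_term m n], without sign. *)
Definition cl_term (m n : nat) (t : R) : R :=
  cos (INR (S n) * t - INR m * (PI / 2)) / INR (S n) ^ (m + 1).

(* [clausen 0] is the value of the conditionally convergent series of terms
   [cl_term 0] on [(0, 2 PI)]. *)
Definition clausen (m : nat) (t : R) : R :=
  match m with
  | O => - ln (2 * sin (t / 2))
  | S _ => Series (fun n => cl_term m n t)
  end.

Lemma cl_term_bound (m n : nat) (t : R) : Rabs (cl_term (S m) n t) <= / INR (S n) ^ 2.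
Proof.
  unfold cl_term, Rdiv. rewrite Rabs_mult.
  rewrite (Rabs_pos_eq (/ _)) by (apply Rlt_le, inv_pow_pos).
  rewrite <- (Rmult_1_l (/ INR (S n) ^ 2)).
  apply Rmult_le_compat; auto using Rabs_pos.
  - apply Rlt_le, inv_pow_pos.
  - apply Rabs_le, COS_bound.
  - apply inv_pow_le_inv_square. lia.
Qed.

Lemma is_derive_cl_term (m n : nat) (t : R) :
  is_derive (cl_term (S m) n) t (cl_term m n t).
Proof.
  unfold cl_term. assert (Hx := INR_S_neq_0 n). set (x := INR (S n)) in *.
  assert (Hp : x ^ (m + 1) <> 0) by now apply pow_nonzero.
  replace (cos (x * t - INR m * (PI / 2))) with (- sin (x * t - INR (S m) * (PI / 2))).
  - replace (S m + 1)%nat with (S (m + 1)) by lia. cbn [pow].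
    set (c := INR (S m) * (PI / 2)). auto_derive. easy. unfold Rminus.
    field. auto.
  - rewrite <- sin_neg, <- cos_shift. f_equal. rewrite S_INR. field.
Qed.

Lemma continuous_cl_term (m n : nat) (t : R) : continuous (cl_term m n) t.
Proof. apply continuous_of_ex_derive. unfold cl_term. auto_derive. easy. Qed.

(** For [m = 0] the differentiated series is only conditionally convergent and has no summable
    majorant; [log_cos_sum_uniform] supplies uniform convergence near [t]. For larger [m] both
    series are dominated by [1 / n^2]. *)
Lemma is_derive_clausen (m : nat) (t : R) : 0 < t < 2 * PI ->
  is_derive (clausen (S m)) t (clausen m t).
Proof.
  intros Ht. destruct m as [|m].
  (* Half the distance to the nearer endpoint, so that [t] lies in the open interval from [a] to
     [2 * PI - a]. *)
  - set (a := Rmin (t / 2) ((2 * PI - t) / 2)).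
    assert (Ha1 : a <= t / 2) by apply Rmin_l.
    assert (Ha2 : a <= (2 * PI - t) / 2) by apply Rmin_r.
    assert (Ha : 0 < a) by (apply Rmin_glb_lt; lra).
    destruct (log_cos_sum_uniform a ltac:(lra)) as [K HK].
    apply (is_derive_uniform_limit (fun N x => sum_n (fun n => cl_term 1 n x) N)
      (fun N x => sum_n (fun n => cl_term 0 n x) N) (clausen 1) (clausen 0) a (2 * PI - a)
      (fun N => Series (fun n => / INR (S n) ^ 2) - sum_n (fun n => / INR (S n) ^ 2) N)
      (fun N => K * / INR (N + 1))).
    + apply is_lim_seq_tail, ex_series_inv_square.
    + replace (Finite 0) with (Rbar_mult K (Rbar_inv p_infty)) by (simpl; f_equal; ring).
      apply is_lim_seq_scal_l. apply is_lim_seq_inv; [| easy].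
      apply (is_lim_seq_subseq INR). apply eventually_subseq; intros; lia.
      apply is_lim_seq_INR.
    + intros N x Hx. apply (Series_tail_le (fun n => cl_term 1 n x)).
      intros n; apply cl_term_bound. apply ex_series_inv_square.
    + intros N x Hx. simpl clausen. specialize (HK N x ltac:(lra)).
      replace (sum_n (fun n => cl_term 0 n x) N) with (log_cos_sum N x); auto.
      apply sum_n_ext. intros n. unfold cl_term. f_equal.
      * f_equal. change (INR 0) with 0. ring.
      * change (0 + 1)%nat with 1%nat. now rewrite pow_1.
    + intros N x Hx. apply is_derive_sum_n_R. intros n. apply is_derive_cl_term.
    + intros N x Hx. apply continuous_sum_n. intros n. apply continuous_cl_term.
    + lra.
  - apply (is_derive_Series (cl_term (S (S m))) (cl_term (S m))
      (fun n => / INR (S n) ^ 2) (fun n => / INR (S n) ^ 2) 0 (2 * PI)); auto.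
    + intros; apply is_derive_cl_term.
    + intros; apply continuous_cl_term.
    + intros; apply cl_term_bound.
    + intros; apply cl_term_bound.
    + apply ex_series_inv_square.
    + apply ex_series_inv_square.
Qed.

(** Unlike [clausen 0], the integrated series are continuous on the whole line, in particular at
    [0], where the constants of integration are read off. *)
Lemma clausen_lim (m : nat) (x : nat -> R) (t : R) :
  is_lim_seq x t -> is_lim_seq (fun j => clausen (S m) (x j)) (clausen (S m) t).
Proof.
  intros Hx.
  destruct (tannery (fun n j => cl_term (S m) n (x j)) (fun n => cl_term (S m) n t)
    (fun n => / INR (S n) ^ 2)) as [_ H]; auto.
  - intros; apply cl_term_bound.
  - apply ex_series_inv_square.
  - intros n. apply is_lim_seq_continuous; auto.
    apply continuity_pt_filterlim, continuous_cl_term.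
Qed.

(** The [m]-fold integral from 0 of [zeta (2k+2) / (k+1) * (t / (2 PI))^(2k+2)]: integration brings
    the factor [(2k+2)! / (2k+2+m)!], and [(2k+2)! / (k+1) = 2 * (2k+1)!]. *)
Definition zw_term (m k : nat) (t : R) : R :=
  2 * zeta_sum (2 * (k + 1)) * INR (fact (2 * k + 1))
    / INR (fact (2 * k + 2 + m)) / (2 * PI) ^ (2 * (k + 1)) * t ^ (2 * k + 2 + m).

Definition zeta_part (m : nat) (t : R) : R := Series (fun k => zw_term m k t).

Lemma is_derive_zw_term (m k : nat) (t : R) :
  is_derive (zw_term (S m) k) t (zw_term m k t).
Proof.
  unfold zw_term. replace (2 * k + 2 + S m)%nat with (S (2 * k + 2 + m)) by lia.
  set (p := (2 * k + 2 + m)%nat).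
  set (q := 2 * zeta_sum (2 * (k + 1)) * INR (fact (2 * k + 1))).
  assert (Hd : (2 * PI) ^ (2 * (k + 1)) <> 0)
    by (apply pow_nonzero; pose proof PI_RGT_0; lra).
  set (d := (2 * PI) ^ (2 * (k + 1))) in *.
  change (fact (S p)) with (S p * fact p)%nat. rewrite mult_INR.
  set (f := INR (fact p)). assert (Hf : f <> 0) by apply INR_fact_neq_0.
  assert (Hp := INR_S_neq_0 p). set (s := INR (S p)) in *.
  apply is_derive_ext with (fun t => q / (s * f) / d * t ^ S p). easy.
  auto_derive. easy. change (q / (s * f) / d * (1 * (s * t ^ p)) = q / f / d * t ^ p). field. auto.
Qed.

Lemma zw_term_bound (m k : nat) (t b : R) : 0 <= t <= b ->
  0 <= zw_term m k t <= 4 * b ^ m * ((b / (2 * PI)) ^ 2) ^ k * (b / (2 * PI)) ^ 2.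
Proof.
  intros Ht. assert (Hp := PI_RGT_0).
  assert (Hz := zeta_sum_bounds (2 * (k + 1)) ltac:(lia)).
  assert (Hf : 0 < INR (fact (2 * k + 1)) <= INR (fact (2 * k + 2 + m))).
  { split. apply INR_fact_lt_0. apply le_INR, fact_le. lia. }
  assert (Hpp : 0 < (2 * PI) ^ (2 * (k + 1))) by (apply pow_lt; lra).
  assert (Hfr : 0 <= INR (fact (2 * k + 1)) / INR (fact (2 * k + 2 + m)) <= 1).
  { split. apply Rlt_le, Rdiv_lt_0_compat; lra. apply Rle_div_l; lra. }
  assert (Htt : 0 <= t ^ (2 * k + 2 + m) <= b ^ (2 * k + 2 + m)).
  { split. apply pow_le; lra. apply pow_incr; lra. }
  assert (Hip : 0 < / (2 * PI) ^ (2 * (k + 1))) by now apply Rinv_0_lt_compat.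
  unfold zw_term.
  replace (2 * zeta_sum (2 * (k + 1)) * INR (fact (2 * k + 1))
    / INR (fact (2 * k + 2 + m)) / (2 * PI) ^ (2 * (k + 1)) * t ^ (2 * k + 2 + m)) with
    (2 * zeta_sum (2 * (k + 1)) * (INR (fact (2 * k + 1)) / INR (fact (2 * k + 2 + m)))
     * (/ (2 * PI) ^ (2 * (k + 1)) * t ^ (2 * k + 2 + m))) by (unfold Rdiv; ring).
  replace (4 * b ^ m * ((b / (2 * PI)) ^ 2) ^ k * (b / (2 * PI)) ^ 2) with
    (4 * (/ (2 * PI) ^ (2 * (k + 1)) * b ^ (2 * k + 2 + m))).
  2: { replace (2 * k + 2 + m)%nat with (2 * (k + 1) + m)%nat by lia.
       set (c := 2 * PI).
       rewrite pow_add, !pow_mult, !(pow_add _ k 1), !pow_1. unfold Rdiv.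
       rewrite !Rpow_mult_distr, !pow_inv, Rinv_mult. ring. }
  set (z := zeta_sum (2 * (k + 1))) in *.
  set (r := INR (fact (2 * k + 1)) / INR (fact (2 * k + 2 + m))) in *.
  set (i := / (2 * PI) ^ (2 * (k + 1))) in *.
  assert (0 <= i * t ^ (2 * k + 2 + m) <= i * b ^ (2 * k + 2 + m)).
  { split. apply Rmult_le_pos; lra. apply Rmult_le_compat_l; lra. }
  assert (Hzr : 0 <= 2 * z * r <= 4) by nra.
  split. apply Rmult_le_pos; lra. apply Rmult_le_compat; lra.
Qed.

Lemma ex_series_zw_bound (m : nat) (b : R) : 0 <= b < 2 * PI ->
  ex_series (fun k => 4 * b ^ m * ((b / (2 * PI)) ^ 2) ^ k * (b / (2 * PI)) ^ 2).
Proof.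
  intros Hb.
  apply (ex_series_scal_r ((b / (2 * PI)) ^ 2) (fun k => 4 * b ^ m * ((b / (2 * PI)) ^ 2) ^ k)).
  apply (ex_series_scal_l (4 * b ^ m) (fun k => ((b / (2 * PI)) ^ 2) ^ k)).
  apply ex_series_geom.
  assert (0 <= b / (2 * PI) < 1).
  { split. apply Rmult_le_pos. lra. left; apply Rinv_0_lt_compat; lra.
    apply Rlt_div_l; lra. }
  rewrite Rabs_pos_eq; nra.
Qed.

Lemma is_series_zeta_part (m : nat) (t : R) : 0 <= t < 2 * PI ->
  is_series (fun k => zw_term m k t) (zeta_part m t).
Proof.
  intros Ht. apply Series_correct.
  apply ex_series_dominated with (2 := ex_series_zw_bound m t Ht).
  intros k. rewrite Rabs_pos_eq; apply (zw_term_bound m k t t); lra.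
Qed.

Lemma is_derive_zeta_part (m : nat) (t : R) : 0 < t < 2 * PI ->
  is_derive (zeta_part (S m)) t (zeta_part m t).
Proof.
  (* Any [b] strictly between [t] and [2 * PI] gives a geometric majorant on [(0, b)] with ratio
     below 1. *)
  intros Ht. set (b := (t + 2 * PI) / 2).
  apply (is_derive_Series (zw_term (S m)) (zw_term m)
    (fun k => 4 * b ^ S m * ((b / (2 * PI)) ^ 2) ^ k * (b / (2 * PI)) ^ 2)
    (fun k => 4 * b ^ m * ((b / (2 * PI)) ^ 2) ^ k * (b / (2 * PI)) ^ 2) 0 b).
  - intros; apply is_derive_zw_term.
  - intros n x _. apply continuous_of_ex_derive. unfold zw_term. auto_derive. easy.
  - intros n x Hx. rewrite Rabs_pos_eq; apply (zw_term_bound _ n x b); lra.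
  - intros n x Hx. rewrite Rabs_pos_eq; apply (zw_term_bound _ n x b); lra.
  - apply ex_series_zw_bound. unfold b; lra.
  - apply ex_series_zw_bound. unfold b; lra.
  - unfold b. lra.
Qed.

Fixpoint harmonic (m : nat) : R :=
  match m with O => 0 | S m => harmonic m + / INR (S m) end.

Definition log_part (m : nat) (t : R) : R :=
  t ^ m / INR (fact m) * (harmonic m - ln t).

Lemma is_derive_log_part (m : nat) (t : R) : 0 < t ->
  is_derive (log_part (S m)) t (log_part m t).
Proof.
  intros Ht. unfold log_part.
  change (fact (S m)) with (S m * fact m)%nat. rewrite mult_INR. cbn [harmonic].
  set (f := INR (fact m)). assert (Hf : f <> 0) by apply INR_fact_neq_0.
  assert (Hs := INR_S_neq_0 m). set (s := INR (S m)) in *.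
  set (h := harmonic m).
  auto_derive. auto.
  change (1 * (s * t ^ m) / (s * f) * (h + / s - ln t)
    + t * t ^ m / (s * f) * (- (1 * / t)) = t ^ m / f * (h - ln t)) .
  field. repeat split; auto. lra.
Qed.

(** Taylor polynomial built from the constants of integration [clausen (m - j) 0]. It stops at
    [j = m - 1]: the next constant would be the infinite value of the order 0 sum at [0], whose
    contribution is [log_part]. *)
Definition poly_part (m : nat) (t : R) : R :=
  match m with
  | O => 0
  | S p => sum_n (fun j => clausen (m - j) 0 * (t ^ j / INR (fact j))) p
  end.

Lemma is_derive_poly_part (m : nat) (t : R) :
  is_derive (poly_part (S m)) t (poly_part m t).
Proof.
  destruct m as [|m].
  - apply is_derive_ext with (fun _ => clausen 1 0 * (1 / 1)).
    intros y. unfold poly_part. now rewrite sum_O. apply (is_derive_const (V:=R_NormedModule)).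
  - unfold poly_part.
    replace (sum_n (fun j => clausen (S m - j) 0 * (t ^ j / INR (fact j))) m) with
      (sum_n (fun j => match j with O => 0 | S i => clausen (S m - i) 0 * (t ^ i / INR (fact i)) end) (S m)).
    + apply (is_derive_sum_n_R (fun j t => clausen (S (S m) - j) 0 * (t ^ j / INR (fact j)))
        (fun j t => match j with O => 0 | S i => clausen (S m - i) 0 * (t ^ i / INR (fact i)) end)).
      intros [|i].
      * auto_derive. easy. simpl. field.
      * replace (S (S m) - S i)%nat with (S m - i)%nat by lia.
        change (fact (S i)) with (S i * fact i)%nat. rewrite mult_INR.
        set (c := clausen (S m - i) 0).
        set (f := INR (fact i)). assert (Hf : f <> 0) by apply INR_fact_neq_0.
        assert (Hs := INR_S_neq_0 i). set (s := INR (S i)) in *.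
        auto_derive. easy.
        change (c * (1 * (s * t ^ i) * / (s * f)) = c * (t ^ i / f)). field. auto.
    + assert (HS : forall (g : nat -> R) p,
        sum_n (fun j => match j with O => 0 | S i => g i end) (S p) = sum_n g p).
      { intros g p. induction p as [|p IH].
        - rewrite Rsum_Sn, !sum_O. R_eq. ring.
        - rewrite Rsum_Sn, IH, Rsum_Sn. reflexivity. }
      apply (HS (fun i => clausen (S m - i) 0 * (t ^ i / INR (fact i)))).
Qed.

Lemma poly_part_0 (m : nat) : poly_part (S m) 0 = clausen (S m) 0.
Proof.
  unfold poly_part.
  assert (H : forall p (c : nat -> R), sum_n (fun j => c j * (0 ^ j / INR (fact j))) p = c O).
  { intros p c. induction p as [|p IH].
    - rewrite sum_O. simpl. field.
    - rewrite Rsum_Sn, IH. simpl pow. unfold Rdiv. R_eq. ring. }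
  rewrite (H m (fun j => clausen (S m - j) 0)). reflexivity.
Qed.

(** Substitute [y = / x]: then [x * ln x = - (ln y / y)] with [y] tending to infinity. *)
Lemma is_lim_seq_mul_ln (x : nat -> R) :
  (forall j, 0 < x j) -> is_lim_seq x 0 -> is_lim_seq (fun j => x j * ln (x j)) 0.
Proof.
  intros Hx H0.
  assert (Hinv : is_lim_seq (fun j => / x j) p_infty).
  { apply is_lim_seq_spec. intros A. apply is_lim_seq_spec in H0.
    assert (HA : 0 < / (Rabs A + 1)) by (apply Rinv_0_lt_compat; pose proof (Rabs_pos A); lra).
    destruct (H0 (mkposreal _ HA)) as [N HN]. exists N. intros n Hn. specialize (HN n Hn).
    simpl in HN. rewrite Rminus_0_r, Rabs_pos_eq in HN by (left; apply Hx).
    apply Rlt_le_trans with (Rabs A + 1). pose proof (Rle_abs A); lra.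
    rewrite <- (Rinv_inv (Rabs A + 1)). apply Rinv_le_contravar; auto. lra. }
  assert (H := is_lim_comp_seq _ _ _ _ is_lim_div_ln_p
    ltac:(exists O; intros; discriminate) Hinv).
  replace (Finite 0) with (Rbar_opp (Finite 0)) by (simpl; f_equal; ring).
  apply is_lim_seq_ext with (fun j => - (ln (/ x j) / / x j)).
  - intros j. specialize (Hx j). rewrite ln_Rinv by auto. field. lra.
  - now apply is_lim_seq_opp in H.
Qed.

Lemma log_part_lim_0 (m : nat) (x : nat -> R) :
  (forall j, 0 < x j) -> is_lim_seq x 0 ->
  is_lim_seq (fun j => log_part (S m) (x j)) 0.
Proof.
  intros Hx H0.
  assert (Hpow : is_lim_seq (fun j => x j ^ m) (0 ^ m)).
  { apply (is_lim_seq_continuous (fun y => y ^ m)); auto.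
    apply continuity_pt_of_ex_derive. auto_derive. easy. }
  apply is_lim_seq_ext with
    (fun j => x j ^ m * (/ INR (fact (S m)) * (harmonic (S m) * x j - x j * ln (x j)))).
  { intros j. unfold log_part. cbn [pow]. unfold Rdiv. ring. }
  replace (Finite 0) with (Finite (0 ^ m * (/ INR (fact (S m)) * (harmonic (S m) * 0 - 0))))
    by (f_equal; ring).
  apply is_lim_seq_mult'; auto.
  apply (is_lim_seq_scal_l _ _ (Finite (harmonic (S m) * 0 - 0))).
  apply is_lim_seq_minus'.
  - now apply (is_lim_seq_scal_l _ _ (Finite 0)).
  - now apply is_lim_seq_mul_ln.
Qed.

Lemma zeta_part_lim_0 (m : nat) (x : nat -> R) (b : R) :
  b < 2 * PI -> (forall j, 0 < x j <= b) -> is_lim_seq x 0 ->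
  is_lim_seq (fun j => zeta_part m (x j)) 0.
Proof.
  intros Hb Hx H0. pose proof (Hx O).
  destruct (tannery (fun k j => zw_term m k (x j)) (fun _ => 0)
    (fun k => 4 * b ^ m * ((b / (2 * PI)) ^ 2) ^ k * (b / (2 * PI)) ^ 2)) as [_ HT].
  - intros k j. specialize (Hx j). rewrite Rabs_pos_eq; apply (zw_term_bound m k (x j) b); lra.
  - apply ex_series_zw_bound. lra.
  - intros k. replace (Finite 0) with (Finite (zw_term m k 0)).
    + apply is_lim_seq_continuous; auto. apply continuity_pt_of_ex_derive.
      unfold zw_term. auto_derive. easy.
    + unfold zw_term. rewrite pow_i by lia. f_equal. ring.
  - replace (Series (fun _ => 0)) with 0 in HT; auto.
    symmetry. apply is_series_unique.
    change (is_lim_seq (sum_n (fun _ : nat => 0)) 0).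
    apply is_lim_seq_ext with (fun _ => 0); [| apply is_lim_seq_const].
    induction n as [|n IH]. now rewrite sum_O. rewrite Rsum_Sn, <- IH. R_eq. ring.
Qed.

(** In the induction step the two sides have equal derivatives, so their difference [E] is constant
    on [(0, 2 PI)]. It tends to 0 along [t / (j+1)]: [log_part] and [zeta_part] tend to 0, and
    [poly_part (S m) 0] is [clausen (S m) 0]. *)
Lemma clausen_expansion (m : nat) (t : R) : 0 < t < 2 * PI ->
  clausen m t = poly_part m t + log_part m t + zeta_part m t.
Proof.
  revert t. induction m as [|m IH]; intros t Ht.
  - simpl clausen. simpl poly_part. unfold log_part. simpl.
    assert (Hpi := PI_RGT_0).
    assert (HW : zeta_part 0 t = - ln (sin (t / 2) / (t / 2))).
    { apply is_series_unique.
      assert (Hu : 0 < t / (2 * PI) < 1).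
      { split. apply Rdiv_lt_0_compat; lra. apply Rlt_div_l; lra. }
      pose proof (ln_sinc_zeta_series _ Hu) as HL.
      replace (PI * (t / (2 * PI))) with (t / 2) in HL by (field; lra).
      apply is_series_ext with (2 := HL). intros k. R_eq. unfold zw_term.
      replace (2 * k + 2 + 0)%nat with (S (2 * k + 1)) by lia.
      change (fact (S (2 * k + 1))) with (S (2 * k + 1) * fact (2 * k + 1))%nat.
      rewrite mult_INR.
      replace (INR (S (2 * k + 1))) with (2 * INR (k + 1))
        by (rewrite S_INR, !plus_INR, mult_INR; simpl; ring).
      replace (S (2 * k + 1)) with (2 * (k + 1))%nat by lia.
      unfold Rdiv. rewrite Rpow_mult_distr, pow_inv. field. repeat split.
      - apply pow_nonzero; lra.
      - apply INR_fact_neq_0.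
      - apply (not_0_INR (k + 1)). lia. }
    rewrite HW. assert (0 < sin (t / 2)) by (apply sin_gt_0; lra).
    rewrite ln_div by lra. rewrite ln_mult by lra.
    replace (ln (t / 2)) with (ln t - ln 2) by (rewrite ln_div; lra). field.
  - set (E := fun t => clausen (S m) t - (poly_part (S m) t + log_part (S m) t + zeta_part (S m) t)).
    assert (HE : forall x, 0 < x < 2 * PI -> is_derive E x 0).
    { intros x Hx.
      replace 0 with (clausen m x - (poly_part m x + log_part m x + zeta_part m x))
        by (rewrite (IH x Hx); ring).
      apply (is_derive_minus (V:=R_NormedModule)).
      - now apply is_derive_clausen.
      - apply (is_derive_plus (V:=R_NormedModule)).
        apply (is_derive_plus (V:=R_NormedModule)).
        + apply is_derive_poly_part.
        + apply is_derive_log_part. lra.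
        + now apply is_derive_zeta_part. }
    set (x := fun j => t / INR (S j)).
    assert (Hx : forall j, 0 < x j <= t).
    { intros j. unfold x. assert (1 <= INR (S j)) by (apply (le_INR 1); lia). split.
      apply Rdiv_lt_0_compat; lra. apply Rle_div_l; nra. }
    assert (Hx0 : is_lim_seq x 0).
    { replace (Finite 0) with (Rbar_mult t (Rbar_inv p_infty)) by (simpl; f_equal; ring).
      apply is_lim_seq_scal_l. apply is_lim_seq_inv; [| easy].
      apply (is_lim_seq_incr_1 INR), is_lim_seq_INR. }
    assert (HEx : forall j, E (x j) = E t).
    { intros j. specialize (Hx j).
      destruct (MVT_gen E (x j) t (fun _ => 0)) as [c [_ Ec]].
      - intros y Hy. rewrite Rmin_left, Rmax_right in Hy by lra. apply HE. lra.
      - intros y Hy. rewrite Rmin_left, Rmax_right in Hy by lra.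
        apply continuity_pt_of_ex_derive. exists 0. apply HE. lra.
      - lra. }
    assert (HL : is_lim_seq (fun j => E (x j)) 0).
    { replace (Finite 0) with (Finite (clausen (S m) 0 - (poly_part (S m) 0 + 0 + 0))).
      2: { rewrite poly_part_0. f_equal. ring. }
      apply is_lim_seq_minus'.
      - now apply clausen_lim.
      - apply is_lim_seq_plus'. apply is_lim_seq_plus'.
        + apply is_lim_seq_continuous; auto. apply continuity_pt_of_ex_derive.
          eexists. apply is_derive_poly_part.
        + apply log_part_lim_0; auto. intros j; apply Hx.
        + apply zeta_part_lim_0 with t; auto. lra. }
    assert (HEt : E t = 0).
    { assert (H := is_lim_seq_ext _ _ _ HEx HL).
      apply is_lim_seq_unique in H. rewrite Lim_seq_const in H. now injection H. }
    unfold E in HEt. lra.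
Qed.

(** * The identity *)

Lemma cos_minus_even (q : nat) (x : R) :
  cos (x - INR (2 * q) * (PI / 2)) = (-1) ^ q * cos x.
Proof.
  induction q as [|q IH].
  - simpl. rewrite Rmult_0_l, Rminus_0_r. ring.
  - replace (x - INR (2 * S q) * (PI / 2)) with (x - INR (2 * q) * (PI / 2) - PI).
    + rewrite cos_minus, cos_PI, sin_PI, IH. simpl pow. ring.
    + rewrite !mult_INR, (S_INR q). simpl (INR 2). field.
Qed.

Definition cos_term (q : nat) (t : R) (n : nat) : R :=
  1 / INR (S n) ^ q * cos (INR (S n) * t).

Lemma cos_term_cl_term (q n : nat) (t : R) :
  cos_term (2 * q + 1) t n = (-1) ^ q * cl_term (2 * q) n t.
Proof.
  unfold cos_term, cl_term. rewrite cos_minus_even.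
  assert (H : (-1) ^ q * (-1) ^ q = 1).
  { rewrite <- Rpow_mult_distr. replace (-1 * -1) with 1 by ring. apply pow1. }
  unfold Rdiv. rewrite <- !Rmult_assoc, H. ring.
Qed.

(** [clausen 0] is defined by its closed form, so at [q = 0] this is the Fourier expansion itself,
    obtained from the error estimate; the other orders converge absolutely. *)
Lemma is_series_clausen (q : nat) (t : R) : 0 < t < 2 * PI ->
  is_series (fun n => cl_term q n t) (clausen q t).
Proof.
  intros Ht. destruct q as [|q].
  - set (a := Rmin t (2 * PI - t)).
    assert (Ha1 : a <= t) by apply Rmin_l.
    assert (Ha2 : a <= 2 * PI - t) by apply Rmin_r.
    assert (Ha : 0 < a) by (apply Rmin_glb_lt; lra).
    destruct (log_cos_sum_uniform a ltac:(lra)) as [K HK].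
    change (is_lim_seq (sum_n (fun n => cl_term 0 n t)) (clausen 0 t)).
    apply is_lim_seq_of_error with (fun N => K * / INR (N + 1)).
    + intros N. simpl clausen. specialize (HK N t ltac:(lra)).
      replace (sum_n (fun n => cl_term 0 n t) N) with (log_cos_sum N t); auto.
      apply sum_n_ext. intros n. unfold cl_term. f_equal.
      * f_equal. change (INR 0) with 0. ring.
      * change (0 + 1)%nat with 1%nat. now rewrite pow_1.
    + replace (Finite 0) with (Rbar_mult K (Rbar_inv p_infty)) by (simpl; f_equal; ring).
      apply is_lim_seq_scal_l. apply is_lim_seq_inv; [| easy].
      apply (is_lim_seq_subseq INR). apply eventually_subseq; intros; lia.
      apply is_lim_seq_INR.
  - apply Series_correct. apply ex_series_dominated with (2 := ex_series_inv_square).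
    intros n. apply cl_term_bound.
Qed.

Lemma is_series_cos_term (q : nat) (t : R) : 0 < t < 2 * PI ->
  is_series (cos_term (2 * q + 1) t) ((-1) ^ q * clausen (2 * q) t).
Proof.
  intros Ht. apply is_series_ext with (fun n => (-1) ^ q * cl_term (2 * q) n t).
  - intros n. now rewrite cos_term_cl_term.
  - now apply is_series_Rmult_l, is_series_clausen.
Qed.

Lemma clausen_0_even (q : nat) : (1 <= q)%nat ->
  clausen (2 * q) 0 = (-1) ^ q * zeta_sum (2 * q + 1).
Proof.
  intros Hq. destruct q as [|q]; [lia |].
  unfold zeta_sum. rewrite <- Series_scal_l.
  replace (2 * S q)%nat with (S (S (2 * q))) at 1 by lia. unfold clausen.
  replace (S (S (2 * q))) with (2 * S q)%nat by lia.
  apply Series_ext. intros n. unfold cl_term.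
  rewrite cos_minus_even, Rmult_0_r, cos_0. unfold Rdiv. ring.
Qed.

(** At [t = 0] the odd phase makes every cosine vanish. Hence only zeta values at odd arguments
    occur in the finite sum. *)
Lemma clausen_0_odd (q : nat) : clausen (2 * q + 1) 0 = 0.
Proof.
  replace (2 * q + 1)%nat with (S (2 * q)) by lia. unfold clausen.
  rewrite (Series_ext _ (fun _ => 0 * 0)).
  - rewrite Series_scal_l. ring.
  - intros n. unfold cl_term.
    replace (INR (S n) * 0 - INR (S (2 * q)) * (PI / 2)) with
      (- (PI / 2) - INR (2 * q) * (PI / 2)) by (rewrite (S_INR (2 * q)); ring).
    rewrite cos_minus_even, cos_neg, cos_PI2. unfold Rdiv. ring.
Qed.

Lemma sum_n_even (a : nat -> R) (p : nat) :
  (forall k, (k <= p)%nat -> a (2 * k + 1)%nat = 0) ->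
  sum_n a (2 * p + 1) = sum_n (fun k => a (2 * k)%nat) p.
Proof.
  induction p as [|p IH]; intros H.
  - change (2 * 0 + 1)%nat with 1%nat. rewrite Rsum_Sn, !sum_O.
    rewrite (H O (le_n O) : a 1%nat = 0). R_eq. simpl. ring.
  - replace (2 * S p + 1)%nat with (S (S (2 * p + 1))) by lia.
    rewrite !Rsum_Sn, IH by (intros; apply H; lia).
    replace (S (S (2 * p + 1))) with (2 * S p + 1)%nat by lia.
    rewrite H by lia. replace (S (2 * p + 1)) with (2 * S p)%nat by lia. R_eq. ring.
Qed.

Lemma poly_part_even (p : nat) (t : R) :
  (-1) ^ S p * poly_part (2 * S p) t =
  sum_n (fun k => (-1) ^ k * zeta_sum (2 * (S p - k) + 1) * (t ^ (2 * k) / INR (fact (2 * k)))) p.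
Proof.
  unfold poly_part. replace (2 * S p)%nat with (S (2 * p + 1)) by lia.
  rewrite (sum_n_even (fun j => clausen (S (2 * p + 1) - j) 0 * (t ^ j / INR (fact j)))).
  - rewrite <- (sum_n_mult_l (K:=R_AbsRing)). apply sum_n_ext_loc. intros k Hk.
    change mult with Rmult.
    replace (S (2 * p + 1) - 2 * k)%nat with (2 * (S p - k))%nat by lia.
    rewrite clausen_0_even by lia.
    (* The sign [(-1)^(S p - k)] from [clausen_0_even] then meets its own copy and squares to 1,
       leaving [(-1)^k]. *)
    replace (S p) with ((S p - k) + k)%nat at 1 by lia.
    assert (H : (-1) ^ (S p - k) * (-1) ^ (S p - k) = 1).
    { rewrite <- Rpow_mult_distr. replace (-1 * -1) with 1 by ring. apply pow1. }
    rewrite pow_add. change mult with Rmult.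
    set (u := (-1) ^ (S p - k)) in *.
    transitivity (u * u * ((-1) ^ k * zeta_sum (2 * (S p - k) + 1) * (t ^ (2 * k) / INR (fact (2 * k))))).
    + unfold mult; simpl. ring.
    + rewrite H. R_eq. ring.
  - intros k Hk. replace (S (2 * p + 1) - (2 * k + 1))%nat with (2 * (p - k) + 1)%nat by lia.
    rewrite clausen_0_odd. ring.
Qed.

(** [z] stands for the zeta values at natural arguments, so that the identity is proved for any [z]
    with [z 0 = - 1 / 2] and [z m = zeta_sum m] for [2 <= m]. *)
Definition finite_term (z : nat -> R) (r : nat) (t : R) (k : nat) : R :=
  (-1) ^ k * ((INR r - INR k) * (2 * INR r + 2 * INR k - 1) / INR (fact (2 * k)))
    * t ^ (2 * k) * z (2 * r + 1 - 2 * k)%nat.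

Definition zeta_term (z : nat -> R) (r : nat) (t : R) (k : nat) : R :=
  INR (fact (2 * k)) * (4 * INR r + 2 * INR k - 1) / INR (fact (2 * r + 2 * k))
    * (z (2 * k)%nat / (2 * PI) ^ (2 * k)) * t ^ (2 * r + 2 * k).

Lemma fact_2S (k : nat) :
  INR (fact (2 * S k)) = (2 * INR k + 2) * (2 * INR k + 1) * INR (fact (2 * k)).
Proof.
  replace (2 * S k)%nat with (S (S (2 * k))) by lia.
  change (fact (S (S (2 * k)))) with (S (S (2 * k)) * (S (2 * k) * fact (2 * k)))%nat.
  rewrite !mult_INR, !S_INR, mult_INR. simpl (INR 2). ring.
Qed.

(** With [r = S p], the factor is [r (2r-1) - k (2k-1) = (r-k) (2r+2k-1)]. *)
Lemma poly_combination (z : nat -> R) (p : nat) (t : R) :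
  (forall m, (2 <= m)%nat -> z m = zeta_sum m) ->
  INR (S p) * (2 * INR (S p) - 1) * ((-1) ^ S p * poly_part (2 * S p) t)
    + 1 / 2 * t ^ 2 * ((-1) ^ p * poly_part (2 * p) t)
  = sum_n (finite_term z (S p) t) p.
Proof.
  intros Hz. rewrite poly_part_even.
  set (e := fun k => (-1) ^ k * zeta_sum (2 * (S p - k) + 1) * (t ^ (2 * k) / INR (fact (2 * k)))).
  (* The second polynomial is shifted by one index to absorb [t^2]; its terms then carry the same
     power of [t] and the same zeta value as [e]. *)
  set (e' := fun k => match k with O => 0 | S i =>
     1 / 2 * t ^ 2 * ((-1) ^ i * zeta_sum (2 * (p - i) + 1) * (t ^ (2 * i) / INR (fact (2 * i)))) end).
  assert (He' : 1 / 2 * t ^ 2 * ((-1) ^ p * poly_part (2 * p) t) = sum_n e' p).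
  { destruct p as [|p].
    - rewrite sum_O. simpl. ring.
    - rewrite poly_part_even.
      assert (HS : forall (g : nat -> R) c q,
        c * sum_n g q = sum_n (fun j => match j with O => 0 | S i => c * g i end) (S q)).
      { intros g c q. induction q as [|q IH].
        - rewrite Rsum_Sn, !sum_O. R_eq. ring.
        - rewrite !Rsum_Sn in *. rewrite Rmult_plus_distr_l, IH. R_eq. ring. }
      rewrite HS. reflexivity. }
  rewrite He'.
  assert (HL : forall q, INR (S p) * (2 * INR (S p) - 1) * sum_n e q + sum_n e' q
     = sum_n (fun k => INR (S p) * (2 * INR (S p) - 1) * e k + e' k) q).
  { induction q as [|q IH].
    - now rewrite !sum_O.
    - rewrite !Rsum_Sn, <- IH. R_eq. ring. }
  rewrite HL. apply sum_n_ext_loc. intros k Hk. unfold finite_term, e, e'.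
  rewrite Hz by lia. R_eq. destruct k as [|k].
  - replace (2 * S p + 1 - 2 * 0)%nat with (2 * (S p - 0) + 1)%nat by lia. simpl (INR 0).
    simpl (fact (2 * 0)). simpl (INR 1). field.
  - replace (2 * S p + 1 - 2 * S k)%nat with (2 * (S p - S k) + 1)%nat by lia.
    replace (2 * (p - k) + 1)%nat with (2 * (S p - S k) + 1)%nat by lia.
    rewrite fact_2S.
    replace (2 * S k)%nat with (2 * k + 2)%nat by lia. rewrite pow_add.
    rewrite (S_INR k). cbn [pow].
    set (f := INR (fact (2 * k))). assert (Hf : f <> 0) by apply INR_fact_neq_0.
    pose proof (pos_INR k). field. repeat split; lra.
Qed.

(** With [r = S p], the logarithms cancel because [r (2r-1) / (2r)! = 1 / (2 (2r-2)!)]. The harmonic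
    numbers leave [1 / (2r) + 1 / (2r-1) = (4r-1) / (2r (2r-1))]. *)
Lemma log_combination (p : nat) (t : R) : 
  INR (S p) * (2 * INR (S p) - 1) * log_part (2 * S p) t - 1 / 2 * t ^ 2 * log_part (2 * p) t
  = (4 * INR (S p) - 1) / INR (fact (2 * S p)) * (1 / 2) * t ^ (2 * S p).
Proof.
  unfold log_part. rewrite fact_2S.
  replace (2 * S p)%nat with (S (S (2 * p))) by lia. cbn [harmonic pow].
  rewrite !S_INR, mult_INR. simpl (INR 2).
  set (f := INR (fact (2 * p))). assert (Hf : f <> 0) by apply INR_fact_neq_0.
  set (h := harmonic (2 * p)). set (l := ln t). pose proof (pos_INR p).
  field. repeat split; lra.
Qed.

(** With [r = S p], [K = k + 1] and [n = r + K], the factor is [n (2n-1) - r (2r-1) = K (4r+2K-1)],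
    and [2K * (2K-1)! = (2K)!]. *)
Lemma zeta_combination (z : nat -> R) (p k : nat) (t : R) :
  (forall m, (2 <= m)%nat -> z m = zeta_sum m) ->
  zeta_term z (S p) t (S k) =
  1 / 2 * t ^ 2 * zw_term (2 * p) k t
    + - (INR (S p) * (2 * INR (S p) - 1)) * zw_term (2 * S p) k t.
Proof.
  intros Hz. unfold zeta_term, zw_term. rewrite Hz by lia.
  replace (2 * k + 2 + 2 * S p)%nat with (2 * S (k + S p))%nat by lia.
  replace (2 * S p + 2 * S k)%nat with (2 * S (k + S p))%nat by lia.
  replace (2 * k + 2 + 2 * p)%nat with (2 * (k + S p))%nat by lia.
  rewrite (fact_2S (k + S p)).
  replace (2 * S k)%nat with (S (2 * k + 1)) by lia.
  change (fact (S (2 * k + 1))) with (S (2 * k + 1) * fact (2 * k + 1))%nat.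
  rewrite mult_INR.
  replace (S (2 * k + 1)) with (2 * (k + 1))%nat by lia.
  replace (2 * S (k + S p))%nat with (2 * (k + S p) + 2)%nat by lia.
  rewrite pow_add.
  replace (INR (2 * (k + 1))) with (2 * INR k + 2) by (rewrite mult_INR, plus_INR; simpl; ring).
  rewrite plus_INR, !S_INR.
  set (f := INR (fact (2 * (k + S p)))). assert (Hf : f <> 0) by apply INR_fact_neq_0.
  set (g := INR (fact (2 * k + 1))). set (y := zeta_sum (2 * (k + 1))).
  assert (Hd : (2 * PI) ^ (2 * (k + 1)) <> 0)
    by (apply pow_nonzero; pose proof PI_RGT_0; lra).
  set (d := (2 * PI) ^ (2 * (k + 1))) in *.
  pose proof (pos_INR k). pose proof (pos_INR p). field. repeat split; lra.
Qed.

Lemma interior_identity (z : nat -> R) (p : nat) (t : R) :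
  z O = - 1 / 2 -> (forall m, (2 <= m)%nat -> z m = zeta_sum m) ->
  0 < t < 2 * PI ->
  exists C1 C2 S3 : R,
    is_series (cos_term (2 * S p + 1) t) C1 /\
    is_series (cos_term (2 * p + 1) t) C2 /\
    is_series (zeta_term z (S p) t) S3 /\
    INR (S p) * (2 * INR (S p) - 1) * C1 + 1 / 2 * t ^ 2 * C2
      = sum_n (finite_term z (S p) t) p + (-1) ^ p * S3.
Proof.
  intros Hz0 Hz Ht.
  set (R3 := 1 / 2 * t ^ 2 * zeta_part (2 * p) t
    + - (INR (S p) * (2 * INR (S p) - 1)) * zeta_part (2 * S p) t).
  exists ((-1) ^ S p * clausen (2 * S p) t), ((-1) ^ p * clausen (2 * p) t),
    (R3 + zeta_term z (S p) t 0).
  split; [| split; [| split]].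
  - now apply is_series_cos_term.
  - now apply is_series_cos_term.
  - assert (HS : is_series (fun k => zeta_term z (S p) t (S k)) R3).
    { apply is_series_ext with (fun k => 1 / 2 * t ^ 2 * zw_term (2 * p) k t
        + - (INR (S p) * (2 * INR (S p) - 1)) * zw_term (2 * S p) k t).
      - intros k. symmetry. now apply zeta_combination.
      - apply is_series_Rplus; apply is_series_Rmult_l; apply is_series_zeta_part; lra. }
    apply (is_series_decr_1 (V:=R_NormedModule) (zeta_term z (S p) t)).
    replace (plus _ _) with R3; [exact HS |]. unfold plus, opp; simpl. R_eq. ring.
  - rewrite <- (poly_combination z p t Hz), !clausen_expansion by auto.
    assert (HT : zeta_term z (S p) t 0 = - (INR (S p) * (2 * INR (S p) - 1) * log_part (2 * S p) t
      - 1 / 2 * t ^ 2 * log_part (2 * p) t)).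
    { rewrite log_combination. unfold zeta_term.
      change (2 * 0)%nat with O. rewrite Nat.add_0_r, Hz0. simpl (INR (fact 0)). simpl (INR 0).
      rewrite pow_O. field. apply INR_fact_neq_0. }
    rewrite HT. unfold R3. cbn [pow]. ring.
Qed.

(** * The endpoint [t = 2 PI] for [2 <= r] *)

Lemma cos_term_bound (q n : nat) (t : R) : (2 <= q)%nat ->
  Rabs (cos_term q t n) <= / INR (S n) ^ 2.
Proof.
  intros Hq. unfold cos_term, Rdiv. rewrite Rmult_1_l, Rabs_mult.
  rewrite (Rabs_pos_eq (/ _)) by (apply Rlt_le, inv_pow_pos).
  rewrite <- (Rmult_1_r (/ INR (S n) ^ 2)).
  apply Rmult_le_compat; auto using Rabs_pos.
  - apply Rlt_le, inv_pow_pos.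
  - now apply inv_pow_le_inv_square.
  - apply Rabs_le, COS_bound.
Qed.

(** For [2 <= r] the factorial [(2r+2k-1)!] is at least [(2k+2)!], so the coefficient is [O(1/k^2)],
    which gives a majorant valid up to [t = 2 PI]. For [r = 1] it is only of order [1/k]. *)
Lemma zeta_term_bound (z : nat -> R) (r k : nat) (t : R) :
  z O = - 1 / 2 -> (forall m, (2 <= m)%nat -> z m = zeta_sum m) ->
  (2 <= r)%nat -> 0 <= t <= 2 * PI ->
  Rabs (zeta_term z r t k) <= 4 * (2 * PI) ^ (2 * r) * / INR (S k) ^ 2.
Proof.
  intros Hz0 Hz Hr Ht. assert (Hpi := PI_RGT_0).
  assert (Hzb : Rabs (z (2 * k)%nat) <= 2).
  { destruct k as [|k].
    - simpl Nat.mul. rewrite Hz0. apply Rabs_le. lra.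
    - rewrite Hz by lia. pose proof (zeta_sum_bounds (2 * S k) ltac:(lia)).
      apply Rabs_le. lra. }
  set (A := INR (fact (2 * k)) * (4 * INR r + 2 * INR k - 1) / INR (fact (2 * r + 2 * k))).
  assert (HS : 0 < INR (S k)) by (apply (lt_INR 0); lia).
  assert (HA : 0 <= A <= 2 * / INR (S k) ^ 2).
  { pose proof (pos_INR k). assert (2 <= INR r) by (apply (le_INR 2); auto).
    pose proof (INR_fact_lt_0 (2 * k)). pose proof (INR_fact_lt_0 (2 * r + 2 * k)).
    assert (HF1 : INR (fact (2 * r + 2 * k)) = (2 * INR r + 2 * INR k) * INR (fact (2 * r + 2 * k - 1))).
    { replace (2 * r + 2 * k)%nat with (S (2 * r + 2 * k - 1)) at 1 by lia.
      change (fact (S (2 * r + 2 * k - 1))) with (S (2 * r + 2 * k - 1) * fact (2 * r + 2 * k - 1))%nat.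
      rewrite mult_INR. f_equal. replace (S (2 * r + 2 * k - 1)) with (2 * r + 2 * k)%nat by lia.
      rewrite plus_INR, !mult_INR. simpl. ring. }
    assert (HF2 : INR (fact (2 * S k)) <= INR (fact (2 * r + 2 * k - 1))).
    { apply le_INR, fact_le. lia. }
    rewrite fact_2S in HF2. unfold A. split.
    - apply Rmult_le_pos; [apply Rmult_le_pos; lra |]. left. now apply Rinv_0_lt_compat.
    - apply Rle_div_l; auto. rewrite HF1, S_INR.
      set (f := INR (fact (2 * k))) in *. set (g := INR (fact (2 * r + 2 * k - 1))) in *.
      set (a := INR k) in *. set (b := INR r) in *.
      apply Rle_trans with (2 * / (a + 1) ^ 2 * ((2 * b + 2 * a) * ((2 * a + 2) * (2 * a + 1) * f))).
      + replace (2 * / (a + 1) ^ 2 * ((2 * b + 2 * a) * ((2 * a + 2) * (2 * a + 1) * f)))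
          with (f * ((2 * b + 2 * a) * 4 * ((2 * a + 1) / (a + 1)))) by (field; lra).
        apply Rmult_le_compat_l; [lra |].
        assert (1 <= (2 * a + 1) / (a + 1)) by (apply Rle_div_r; lra). nra.
      + apply Rmult_le_compat_l.
        * apply Rmult_le_pos; [lra |]. left. apply Rinv_0_lt_compat, pow_lt. lra.
        * apply Rmult_le_compat_l; lra. }
  unfold zeta_term. fold A.
  assert (Hp : 0 < (2 * PI) ^ (2 * k)) by (apply pow_lt; lra).
  replace (A * (z (2 * k)%nat / (2 * PI) ^ (2 * k)) * t ^ (2 * r + 2 * k)) with
    (A * z (2 * k)%nat * (t ^ (2 * r + 2 * k) / (2 * PI) ^ (2 * k))) by (field; lra).
  rewrite !Rabs_mult, (Rabs_pos_eq A) by lra.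
  assert (HT : 0 <= t ^ (2 * r + 2 * k) / (2 * PI) ^ (2 * k) <= (2 * PI) ^ (2 * r)).
  { split. apply Rmult_le_pos. apply pow_le; lra. left; now apply Rinv_0_lt_compat.
    apply Rle_div_l; auto. rewrite <- pow_add. apply pow_incr. lra. }
  rewrite (Rabs_pos_eq (t ^ _ / _)) by lra.
  replace (4 * (2 * PI) ^ (2 * r) * / INR (S k) ^ 2) with
    (2 * / INR (S k) ^ 2 * 2 * (2 * PI) ^ (2 * r)) by ring.
  apply Rmult_le_compat; try lra.
  - apply Rmult_le_pos. lra. apply Rabs_pos.
  - apply Rmult_le_compat; try lra. apply Rabs_pos.
Qed.

Lemma boundary_identity (z : nat -> R) (p : nat) :
  z O = - 1 / 2 -> (forall m, (2 <= m)%nat -> z m = zeta_sum m) ->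
  (1 <= p)%nat ->
  exists C1 C2 S3 : R,
    is_series (cos_term (2 * S p + 1) (2 * PI)) C1 /\
    is_series (cos_term (2 * p + 1) (2 * PI)) C2 /\
    is_series (zeta_term z (S p) (2 * PI)) S3 /\
    INR (S p) * (2 * INR (S p) - 1) * C1 + 1 / 2 * (2 * PI) ^ 2 * C2
      = sum_n (finite_term z (S p) (2 * PI)) p + (-1) ^ p * S3.
Proof.
  intros Hz0 Hz Hp. assert (Hpi := PI_RGT_0).
  (* The points start at [PI] and increase to [2 * PI], staying in the open interval where
     [interior_identity] holds. *)
  set (x := fun j => 2 * PI * (1 - / INR (S (S j)))).
  assert (Hx : forall j, 0 < x j < 2 * PI).
  { intros j. unfold x. assert (Hj : 2 <= INR (S (S j))) by (apply (le_INR 2); lia).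
    assert (0 < / INR (S (S j)) <= / 2).
    { split. apply Rinv_0_lt_compat; lra. apply Rinv_le_contravar; lra. }
    split; nra. }
  assert (Hxl : is_lim_seq x (2 * PI)).
  { replace (Finite (2 * PI)) with (Finite (2 * PI * (1 - 0))) by (f_equal; ring).
    apply (is_lim_seq_scal_l _ _ (Finite (1 - 0))). apply is_lim_seq_minus'.
    apply is_lim_seq_const.
    replace (Finite 0) with (Rbar_inv p_infty) by reflexivity.
    apply is_lim_seq_inv; [| easy].
    apply (is_lim_seq_subseq INR). apply eventually_subseq; intros; lia.
    apply is_lim_seq_INR. }
  assert (HC : forall f : R -> R, (forall y, ex_derive f y) ->
     is_lim_seq (fun j => f (x j)) (f (2 * PI))).
  { intros f Hf. apply is_lim_seq_continuous; auto. now apply continuity_pt_of_ex_derive. }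
  assert (HCT : forall q, (2 <= q)%nat -> ex_series (cos_term q (2 * PI)) /\
     is_lim_seq (fun j => Series (cos_term q (x j))) (Series (cos_term q (2 * PI)))).
  { intros q Hq. apply (tannery (fun n j => cos_term q (x j) n) (cos_term q (2 * PI))
      (fun n => / INR (S n) ^ 2)).
    - intros; now apply cos_term_bound.
    - apply ex_series_inv_square.
    - intros n. apply (HC (fun y => cos_term q y n)). intros y. unfold cos_term. auto_derive. easy. }
  assert (HZT : ex_series (zeta_term z (S p) (2 * PI)) /\
     is_lim_seq (fun j => Series (zeta_term z (S p) (x j))) (Series (zeta_term z (S p) (2 * PI)))).
  { apply (tannery (fun k j => zeta_term z (S p) (x j) k) (zeta_term z (S p) (2 * PI))
      (fun k => 4 * (2 * PI) ^ (2 * S p) * / INR (S k) ^ 2)).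
    - intros n j. apply zeta_term_bound; auto. lia. specialize (Hx j). lra.
    - apply (ex_series_scal_l (4 * (2 * PI) ^ (2 * S p)) (fun k => / INR (S k) ^ 2)).
      apply ex_series_inv_square.
    - intros k. apply (HC (fun y => zeta_term z (S p) y k)).
      intros y. unfold zeta_term. auto_derive. easy. }
  destruct (HCT (2 * S p + 1)%nat ltac:(lia)) as [E1 L1].
  destruct (HCT (2 * p + 1)%nat ltac:(lia)) as [E2 L2].
  destruct HZT as [E3 L3].
  exists (Series (cos_term (2 * S p + 1) (2 * PI))), (Series (cos_term (2 * p + 1) (2 * PI))),
    (Series (zeta_term z (S p) (2 * PI))).
  repeat split; try now apply Series_correct.
  assert (HL : is_lim_seq (fun j => INR (S p) * (2 * INR (S p) - 1) * Series (cos_term (2 * S p + 1) (x j))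
      + 1 / 2 * x j ^ 2 * Series (cos_term (2 * p + 1) (x j)))
    (INR (S p) * (2 * INR (S p) - 1) * Series (cos_term (2 * S p + 1) (2 * PI))
      + 1 / 2 * (2 * PI) ^ 2 * Series (cos_term (2 * p + 1) (2 * PI)))).
  { apply is_lim_seq_plus'.
    - exact (is_lim_seq_scal_l _ _ (Finite _) L1).
    - apply is_lim_seq_mult'; auto. apply (HC (fun y => 1 / 2 * y ^ 2)).
      intros y. auto_derive. easy. }
  assert (HR : is_lim_seq (fun j => sum_n (finite_term z (S p) (x j)) p
      + (-1) ^ p * Series (zeta_term z (S p) (x j)))
    (sum_n (finite_term z (S p) (2 * PI)) p + (-1) ^ p * Series (zeta_term z (S p) (2 * PI)))).
  { apply is_lim_seq_plus'.
    - apply (is_lim_seq_sum_n (fun k j => finite_term z (S p) (x j) k) (finite_term z (S p) (2 * PI))).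
      intros k. apply (HC (fun y => finite_term z (S p) y k)).
      intros y. unfold finite_term. auto_derive. easy.
    - exact (is_lim_seq_scal_l _ _ (Finite _) L3). }
  assert (HE : forall j, INR (S p) * (2 * INR (S p) - 1) * Series (cos_term (2 * S p + 1) (x j))
      + 1 / 2 * x j ^ 2 * Series (cos_term (2 * p + 1) (x j))
      = sum_n (finite_term z (S p) (x j)) p + (-1) ^ p * Series (zeta_term z (S p) (x j))).
  { intros j. destruct (interior_identity z p (x j) Hz0 Hz (Hx j)) as [C1 [C2 [S3 [I1 [I2 [I3 I4]]]]]].
    now rewrite (is_series_unique _ _ I1), (is_series_unique _ _ I2), (is_series_unique _ _ I3). }
  apply (is_lim_seq_ext _ _ _ HE) in HL.
  apply is_lim_seq_unique in HL. apply is_lim_seq_unique in HR.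
  rewrite HL in HR. now injection HR.
Qed.

(** * The divergent series for [r = 1], and the identity on all of [[0, 2 PI]] *)

Lemma harmonic_diverges : is_lim_seq (sum_n (fun n => / INR (S n))) p_infty.
Proof.
  assert (H : forall N, ln (INR (S (S N))) <= sum_n (fun n => / INR (S n)) N).
  { assert (Hs : forall n, ln (INR (S (S n))) - ln (INR (S n)) <= / INR (S n)).
    { intros n. assert (Hn : 0 < INR (S n)) by (apply (lt_INR 0); lia).
      rewrite (S_INR (S n)). rewrite <- ln_div by lra.
      eapply Rle_trans; [apply ln_le_minus_1; apply Rdiv_lt_0_compat; lra |].
      apply Req_le. field. lra. }
    induction N as [|N IH].
    - rewrite sum_O. specialize (Hs O). simpl (INR 1) in *. rewrite ln_1 in Hs. lra.
    - rewrite Rsum_Sn. specialize (Hs (S N)).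
      apply Rle_trans with (sum_n (fun n => / INR (S n)) N + / INR (S (S N))); [lra | apply Rle_refl]. }
  apply is_lim_seq_le_p_loc with (fun N => ln (INR (S (S N)))).
  - exists O. intros n _. apply H.
  - apply (is_lim_comp_seq ln _ p_infty p_infty).
    + apply is_lim_ln_p.
    + exists O. intros; discriminate.
    + apply (is_lim_seq_subseq INR). apply eventually_subseq; intros; lia.
      apply is_lim_seq_INR.
Qed.

(** The conclusion of the theorem in the variable [t], with [t] later set to the absolute value of
    [PI x / c]. *)
Definition identity_at (z : nat -> R) (r : nat) (t : R) : Prop :=
  exists (S1 : R) (S2 S3 : Rbar),
    is_series (cos_term (2 * r + 1) t) S1 /\
    is_Rbar_series (cos_term (2 * r - 1) t) S2 /\
    is_Rbar_series (zeta_term z r t) S3 /\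
    ((2 <= r)%nat \/ 0 < t < 2 * PI -> is_finite S2 /\ is_finite S3) /\
    Rbar_plus (Finite (INR r * (2 * INR r - 1) * S1))
      (Rbar_mult (Finite (1 / 2 * t ^ 2)) S2)
    = Rbar_plus (Finite (sum_n (finite_term z r t) (r - 1)))
        (Rbar_mult (Finite ((-1) ^ (r - 1))) S3).

Lemma identity_at_finite (z : nat -> R) (p : nat) (t : R) (C1 C2 S3 : R) :
  is_series (cos_term (2 * S p + 1) t) C1 ->
  is_series (cos_term (2 * p + 1) t) C2 ->
  is_series (zeta_term z (S p) t) S3 ->
  INR (S p) * (2 * INR (S p) - 1) * C1 + 1 / 2 * t ^ 2 * C2
    = sum_n (finite_term z (S p) t) p + (-1) ^ p * S3 ->
  identity_at z (S p) t.
Proof.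
  intros H1 H2 H3 H. exists C1, (Finite C2), (Finite S3).
  replace (2 * S p - 1)%nat with (2 * p + 1)%nat by lia.
  replace (S p - 1)%nat with p by lia.
  repeat split; auto. 
  change (Finite (INR (S p) * (2 * INR (S p) - 1) * C1 + 1 / 2 * t ^ 2 * C2)
    = Finite (sum_n (finite_term z (S p) t) p + (-1) ^ p * S3)).
  now rewrite H.
Qed.

Lemma cos_2PI_INR (n : nat) : cos (INR n * (2 * PI)) = 1.
Proof.
  replace (INR n * (2 * PI)) with (0 + 2 * INR n * PI) by ring.
  rewrite cos_period. apply cos_0.
Qed.

Lemma Rbar_mult_p_infty (a : R) : 0 < a -> Rbar_mult (Finite a) p_infty = p_infty.
Proof.
  intros Ha. apply is_Rbar_mult_unique, is_Rbar_mult_sym, is_Rbar_mult_p_infty_pos.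
  exact Ha.
Qed.

(** For [1 <= k] the term is [2 PI^2 / (k+1)] times [zeta (2k) * (2k+3) / (2k+1)], a factor at least
    1. The constant [- 5 PI^2] makes the comparison an equality at [N = 0]: the term [k = 0] is
    [- 3 PI^2], against [2 PI^2] from the harmonic sum. *)
Lemma zeta_term_1_diverges (z : nat -> R) :
  z O = - 1 / 2 -> (forall m, (2 <= m)%nat -> z m = zeta_sum m) ->
  is_lim_seq (sum_n (zeta_term z 1 (2 * PI))) p_infty.
Proof.
  intros Hz0 Hz. assert (Hpi := PI_RGT_0).
  assert (H : forall N, - 5 * PI ^ 2 + 2 * PI ^ 2 * sum_n (fun n => / INR (S n)) N
     <= sum_n (zeta_term z 1 (2 * PI)) N).
  { induction N as [|N IH].
    - rewrite !sum_O. unfold zeta_term. simpl (2 * 0)%nat. rewrite Hz0. simpl. nra.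
    - rewrite !Rsum_Sn.
      assert (Ht : 2 * PI ^ 2 * / INR (S (S N)) <= zeta_term z 1 (2 * PI) (S N)).
      { unfold zeta_term. rewrite Hz by lia.
        pose proof (zeta_sum_bounds (2 * S N) ltac:(lia)) as Hb.
        set (y := zeta_sum (2 * S N)) in *.
        replace (2 * 1 + 2 * S N)%nat with (2 * S (S N))%nat by lia.
        rewrite (fact_2S (S N)).
        replace (2 * S (S N))%nat with (2 * S N + 2)%nat by lia. rewrite pow_add.
        assert (Hd : (2 * PI) ^ (2 * S N) <> 0) by (apply pow_nonzero; lra).
        set (d := (2 * PI) ^ (2 * S N)) in *.
        set (f := INR (fact (2 * S N))). assert (Hf : f <> 0) by apply INR_fact_neq_0.
        rewrite (S_INR (S N)). assert (Hk : 1 <= INR (S N)) by (apply (le_INR 1); lia).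
        set (k := INR (S N)) in *. simpl (INR 1).
        replace (f * (4 * 1 + 2 * k - 1) / ((2 * k + 2) * (2 * k + 1) * f) * (y / d) * (d * (2 * PI) ^ 2))
          with (2 * PI ^ 2 * / (k + 1) * (y * ((2 * k + 3) / (2 * k + 1)))) by (field; lra).
        rewrite <- (Rmult_1_r (2 * PI ^ 2 * / (k + 1))) at 1.
        apply Rmult_le_compat_l.
        - apply Rmult_le_pos; [nra |]. left; apply Rinv_0_lt_compat; lra.
        - assert (1 <= (2 * k + 3) / (2 * k + 1)) by (apply Rle_div_r; lra). nra. }
      lra. }
  apply is_lim_seq_le_p_loc with
    (fun N => - 5 * PI ^ 2 + 2 * PI ^ 2 * sum_n (fun n => / INR (S n)) N).
  - exists O. intros n _. apply H.
  - apply is_lim_seq_plus with (Finite (- 5 * PI ^ 2)) p_infty.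
    + apply is_lim_seq_const.
    + pose proof (is_lim_seq_scal_l _ (2 * PI ^ 2) _ harmonic_diverges) as HS.
      rewrite Rbar_mult_p_infty in HS by nra. exact HS.
    + reflexivity.
Qed.

Lemma identity_at_all (z : nat -> R) (r : nat) (t : R) :
  z O = - 1 / 2 -> (forall m, (2 <= m)%nat -> z m = zeta_sum m) ->
  (1 <= r)%nat -> 0 <= t <= 2 * PI -> identity_at z r t.
Proof.
  intros Hz0 Hz Hr Ht. assert (Hpi := PI_RGT_0). destruct r as [|p]; [lia |].
  destruct (Req_dec t 0) as [-> | Ht0]; [| destruct (Req_dec t (2 * PI)) as [-> | Ht1]].
  - assert (HC : forall q n, cos_term q 0 n = / INR (S n) ^ q).
    { intros q n. unfold cos_term. rewrite Rmult_0_r, cos_0. unfold Rdiv. ring. }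
    assert (H1 : is_series (cos_term (2 * S p + 1) 0) (zeta_sum (2 * S p + 1))).
    { apply is_series_ext with (2 := is_series_zeta_sum (2 * S p + 1) ltac:(lia)).
      intros n. now rewrite HC. }
    assert (H3 : is_series (zeta_term z (S p) 0) 0).
    { change (is_lim_seq (sum_n (zeta_term z (S p) 0)) 0).
      apply is_lim_seq_ext with (fun _ => 0); [| apply is_lim_seq_const].
      assert (Hk : forall k, zeta_term z (S p) 0 k = 0)
        by (intros k; unfold zeta_term; rewrite pow_i by lia; ring).
      induction n as [|n IH]. now rewrite sum_O, Hk. rewrite Rsum_Sn, <- IH, Hk. R_eq. ring. }
    assert (HF : forall q, sum_n (finite_term z (S p) 0) q = INR (S p) * (2 * INR (S p) - 1) * zeta_sum (2 * S p + 1)).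
    { induction q as [|q IH].
      - rewrite sum_O. unfold finite_term. rewrite Hz by lia.
        replace (2 * S p + 1 - 2 * 0)%nat with (2 * S p + 1)%nat by lia.
        simpl (fact (2 * 0)). simpl (INR 0). simpl (INR 1). simpl (0 ^ (2 * 0)). R_eq. cbn [pow]. field.
      - rewrite Rsum_Sn, IH. unfold finite_term. rewrite (pow_i (2 * S q)) by lia. R_eq. ring. }
    destruct p as [|p].
    + exists (zeta_sum (2 * 1 + 1)), p_infty, (Finite 0).
      split; [exact H1 | split; [| split; [exact H3 | split]]].
      * unfold is_Rbar_series. apply is_lim_seq_ext with (2 := harmonic_diverges).
        intros N. apply sum_n_ext. intros n. rewrite HC.
        change (2 * 1 - 1)%nat with 1%nat. now rewrite pow_1.
      * intros [H | H]; [lia | lra].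
      * rewrite HF. replace (1 / 2 * 0 ^ 2) with 0 by field.
        rewrite Rbar_mult_0_l, Rbar_mult_0_r. reflexivity.
    + apply identity_at_finite with (zeta_sum (2 * S (S p) + 1)) (zeta_sum (2 * S p + 1)) 0; auto.
      * apply is_series_ext with (2 := is_series_zeta_sum (2 * S p + 1) ltac:(lia)).
        intros n. now rewrite HC.
      * rewrite HF. ring.
  - destruct p as [|p].
    + assert (HC : forall q n, cos_term q (2 * PI) n = / INR (S n) ^ q).
      { intros q n. unfold cos_term. rewrite cos_2PI_INR. unfold Rdiv. ring. }
      exists (zeta_sum (2 * 1 + 1)), p_infty, p_infty.
      split; [| split; [| split; [| split]]].
      * apply is_series_ext with (2 := is_series_zeta_sum (2 * 1 + 1) ltac:(lia)).
        intros n. now rewrite HC.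
      * unfold is_Rbar_series. apply is_lim_seq_ext with (2 := harmonic_diverges).
        intros N. apply sum_n_ext. intros n. rewrite HC.
        change (2 * 1 - 1)%nat with 1%nat. now rewrite pow_1.
      * now apply zeta_term_1_diverges.
      * intros [H | H]; [lia | lra].
      (* Both infinite factors have positive coefficients, [(2 PI)^2 / 2] and [(-1)^0], so each side
         is [p_infty]. *)
      * rewrite !Rbar_mult_p_infty; [reflexivity | simpl; lra | nra].
    + destruct (boundary_identity z (S p) Hz0 Hz ltac:(lia)) as [C1 [C2 [S3 [I1 [I2 [I3 I4]]]]]].
      now apply identity_at_finite with C1 C2 S3.
  - destruct (interior_identity z p t Hz0 Hz ltac:(lra)) as [C1 [C2 [S3 [I1 [I2 [I3 I4]]]]]].
    now apply identity_at_finite with C1 C2 S3.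
Qed.

(** * Back to the complex zeta function and to the variable [x] *)

Lemma zeta_nat_series (zeta : C -> C) (m : nat) :
  is_riemann_zeta zeta -> (2 <= m)%nat -> zeta_nat zeta m = zeta_sum m.
Proof.
  intros [_ Hser] Hm.
  assert (Hre : 1 < Re (RtoC (INR m))).
  { simpl. apply Rlt_le_trans with 2. lra. now apply (le_INR 2). }
  pose proof (proj1 (is_Cseries_Cmod _ _) (Hser _ Hre)) as HC.
  symmetry. unfold zeta_nat. set (l := zeta (RtoC (INR m))) in *.
  apply is_series_unique.
  change (is_lim_seq (sum_n (fun n => / INR (S n) ^ m)) (Re l)).
  apply is_lim_seq_of_error with (2 := HC). intros N.
  replace (sum_n (fun n => / INR (S n) ^ m) N) with
    (Re (sum_n (fun n => nat_cpow_opp (S n) (RtoC (INR m))) N)).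
  - replace (Re _ - Re l) with (Re (sum_n (fun n => nat_cpow_opp (S n) (RtoC (INR m))) N - l)%C).
    apply re_le_Cmod. destruct (sum_n _ N), l. reflexivity.
  - assert (Ht : forall n, Re (nat_cpow_opp (S n) (RtoC (INR m))) = / INR (S n) ^ m).
    { intros n. assert (Hn : 0 < INR (S n)) by (apply (lt_INR 0); lia).
      unfold nat_cpow_opp. set (x := INR (S n)) in *.
      rewrite <- RtoC_mult, <- RtoC_opp.
      change (exp (- (INR m * ln x)) * cos 0 = / x ^ m). rewrite cos_0, Rmult_1_r.
      rewrite exp_Ropp. f_equal. rewrite <- Rpower_pow by auto. reflexivity. }
    induction N as [|N IH].
    + rewrite !sum_O. apply Ht.
    + rewrite Csum_Sn, Rsum_Sn, <- IH, <- Ht. destruct (sum_n _ N). reflexivity.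
Qed.

Lemma pow_Rabs_even (u : R) (m : nat) : Rabs u ^ (2 * m) = u ^ (2 * m).
Proof. now rewrite !pow_mult, pow2_abs. Qed.

Lemma cos_Rabs (u a : R) : cos (a * Rabs u) = cos (a * u).
Proof.
  unfold Rabs. destruct (Rcase_abs u); [| reflexivity].
  rewrite <- cos_neg. f_equal. ring.
Qed.

(* In the products of Rbar, 0 times an infinite value is 0.  This and infinite
   values of S2, S3 occur only for r = 1 and x = 0 or x = - 2 c, where the
   series of terms cos (n PI x / c) / n is the harmonic series. *)
Theorem theorem4p1 :
  forall (zeta : C -> C), is_riemann_zeta zeta ->
  forall (r : nat) (c x : R),
  (1 <= r)%nat -> 0 < c ->
  (- (2 * c) <= x < 2 * c \/ ((2 <= r)%nat /\ - (2 * c) <= x <= 2 * c)) ->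
  exists (S1 : R) (S2 S3 : Rbar),
    is_series
      (fun n : nat => 1 / INR (S n) ^ (2 * r + 1) * cos (INR (S n) * PI * x / c))
      S1 /\
    is_Rbar_series
      (fun n : nat => 1 / INR (S n) ^ (2 * r - 1) * cos (INR (S n) * PI * x / c))
      S2 /\
    is_Rbar_series
      (fun k : nat =>
         INR (fact (2 * k)) * (4 * INR r + 2 * INR k - 1)
           / INR (fact (2 * r + 2 * k))
         * (zeta_nat zeta (2 * k) / (2 * PI) ^ (2 * k))
         * (PI * x / c) ^ (2 * r + 2 * k))
      S3 /\
    ((2 <= r)%nat \/ (x <> 0 /\ x <> - (2 * c)) ->
       is_finite S2 /\ is_finite S3) /\
    Rbar_plus
      (Finite (INR r * (2 * INR r - 1) * S1))
      (Rbar_mult (Finite (1 / 2 * (PI * x / c) ^ 2)) S2)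
    =
    Rbar_plus
      (Finite
        (sum_n
           (fun k : nat =>
              (-1) ^ k * ((INR r - INR k) * (2 * INR r + 2 * INR k - 1)
                            / INR (fact (2 * k)))
              * (PI * x / c) ^ (2 * k)
              * zeta_nat zeta (2 * r + 1 - 2 * k))
           (r - 1)))
      (Rbar_mult (Finite ((-1) ^ (r - 1))) S3).
Proof.
  intros zeta Hzeta r c x Hr Hc Hx. assert (Hpi := PI_RGT_0).
  set (u := PI * x / c).
  assert (Hu : Rabs u = PI / c * Rabs x).
  { unfold u. replace (PI * x / c) with (PI / c * x) by (field; lra).
    rewrite Rabs_mult, Rabs_pos_eq; [reflexivity |]. left. now apply Rdiv_lt_0_compat. }
  assert (Hq : 0 < PI / c) by now apply Rdiv_lt_0_compat.
  assert (H2 : PI / c * (2 * c) = 2 * PI) by (field; lra).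
  assert (Hax : Rabs x <= 2 * c) by (apply Rabs_le; lra).
  assert (Ht : 0 <= Rabs u <= 2 * PI).
  { split. apply Rabs_pos. rewrite Hu, <- H2. apply Rmult_le_compat_l; lra. }
  (* Everything is even in [x]: the cosines, and the powers of [u], whose exponents are all even. So
     [t = Rabs u] covers negative [x]. *)
  destruct (identity_at_all (zeta_nat zeta) r (Rabs u)) as [S1 [S2 [S3 [I1 [I2 [I3 [I4 I5]]]]]]]; auto.
  { unfold zeta_nat. simpl. now apply zeta_0. }
  { intros m Hm. now apply zeta_nat_series. }
  assert (Hcos : forall q n, cos_term q (Rabs u) n
     = 1 / INR (S n) ^ q * cos (INR (S n) * PI * x / c)).
  { intros q n. unfold cos_term. rewrite cos_Rabs. do 2 f_equal. unfold u. field. lra. }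
  exists S1, S2, S3. split; [| split; [| split; [| split]]].
  - apply is_series_ext with (2 := I1). intros n. apply Hcos.
  - apply is_lim_seq_ext with (2 := I2). intros N. apply sum_n_ext. intros n. apply Hcos.
  - apply is_lim_seq_ext with (2 := I3). intros N. apply sum_n_ext. intros k.
    unfold zeta_term. now rewrite <- Nat.mul_add_distr_l, pow_Rabs_even.
  - intros H. apply I4. destruct (Compare_dec.le_lt_dec 2 r) as [Hr2 | Hr2]; [now left | right].
    destruct H as [H | [Hx0 Hxc]]; [lia |].
    (* Here [r = 1], so the hypothesis excludes [x = 2 * c]; with [x <> - (2 * c)] this puts
       [Rabs u] strictly below [2 * PI]. *)
    destruct Hx as [Hx | [Hx _]]; [| lia].
    rewrite Hu, <- H2. split.
    + apply Rmult_lt_0_compat; auto. now apply Rabs_pos_lt.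
    + apply Rmult_lt_compat_l; auto. apply Rabs_def1; lra.
  - replace (u ^ 2) with (Rabs u ^ 2) by (apply pow2_abs).
    rewrite I5. do 2 f_equal. apply sum_n_ext. intros k. unfold finite_term.
    now rewrite pow_Rabs_even.
Qed.
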